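(* Let $\varepsilon_1,\varepsilon_3>0$ and let $x(t)\in\mathcal D^{(2)}_{\varepsilon_1,\varepsilon_3}$ with a window function $g$ in the Schwartz class, threshold $\tau_0$ and window-width function $\sigma(t)$ as in the context. Fix $t\in\mathbb R$ and let $\tilde\varepsilon_1=\tilde\varepsilon_1(t)>0$, $\tilde\varepsilon_2=\tilde\varepsilon_2(t)>0$. Then the following hold. (a) Suppose $\tilde\varepsilon_1\ge\tau_0\sum_{k=1}^KA_k(t)+\sigma(t)\Pi_0(t)$. Then for every $\eta$ with $|\tilde V_x(t,\eta)|>\tilde\varepsilon_1$ there exists $k\in\{1,\dots,K\}$ such that $(t,\eta)\in O_k$. (b) Suppose $(t,\eta)$ satisfies $|\tilde V_x(t,\eta)|>\tilde\varepsilon_1$, $\big|\partial_\eta\big(\tilde V_x^{g_1}(t,\eta)/\tilde V_x(t,\eta)\big)\big|>\tilde\varepsilon_2$ and $(t,\eta)\in O_k$. Then $$\omega_x^{adp,2nd,c}(t,\eta)-\phi_k'(t)=\mathrm{Res}_4,\qquad \mathrm{Res}_4=\frac{\mathrm{Res}_1}{i2\pi\tilde V_x(t,\eta)}-\frac{\tilde V_x^{g_1}(t,\eta)\,\mathrm{Res}_3}{i2\pi\tilde V_x(t,\eta)}.$$ Furthermore, $$|\omega_x^{adp,2nd}(t,\eta)-\phi_k'(t)|<\mathrm{Bd}_1,$$ where $$\mathrm{Bd}_1=\max_{1\le k\le K}\ \sup_{\eta:\,(t,\eta)\in O_k}\Big\{\frac{|\mathrm{Res}_1|}{2\pi\tilde\varepsilon_1}+\frac1{2\pi\tilde\varepsilon_1^3\tilde\varepsilon_2}|\tilde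 V_x^{g_1}(t,\eta)|\big(|\partial_\eta\tilde V_x(t,\eta)|\,|\mathrm{Res}_1|+\tilde\varepsilon_1|\mathrm{Res}_2|\big)\Big\}.$$ (c) Suppose that $\tilde\varepsilon_1\ge\tau_0\sum_{k=1}^KA_k(t)+\sigma(t)\Pi_0(t)$ and $\mathrm{Bd}_1\le\frac12L_k(t)$, where $$L_k(t)=\frac1{\sigma(t)}\min\{\alpha_k+\alpha_{k-1},\ \alpha_k+\alpha_{k+1}\}.$$ Then for every $\tilde\varepsilon_3=\tilde\varepsilon_3(t)>0$ satisfying $\mathrm{Bd}_1\le\tilde\varepsilon_3\le\frac12L_k(t)$, $$\Big|\lim_{\lambda\to0}\frac{\sigma(t)}{g(0)}\int_{|\xi-\phi_k'(t)|<\tilde\varepsilon_3}R^{adp,2nd,\lambda}_{x,\tilde\varepsilon_1,\tilde\varepsilon_2}(t,\xi)\,d\xi-x_k(t)\Big|\le\mathrm{Bd}_2,$$ where $\mathrm{Bd}_2=\mathrm{Bd}_2'+\mathrm{Bd}_2''$ with $$\mathrm{Bd}_2'=\frac1{|g(0)|}\Big\{2\alpha_k\big(\tilde\varepsilon_1+\sigma(t)\Pi_0(t)\big)+A_k(t)\Big|\int_{|u|\ge\alpha_k}G_k(u)\,du\Big|+\sum_{\ell\ne k}A_\ell(t)M_{\ell,k}(t)\Big\},$$ $$\mathrm{Bd}_2''=\frac1{|g(0)|}\Big\{2\alpha_k\sigma(t)\Pi_0(t)+\sigma(t)A_k(t)\,\|g\|_1\,|Z_t|+\sum_{\ell\ne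 k}A_\ell(t)M_{\ell,k}(t)\Big\},$$ and $|Z_t|$ denotes the Lebesgue measure of $$Z_t=\Big\{\eta:\ (t,\eta)\in O_k,\ |\tilde V_x(t,\eta)|>\tilde\varepsilon_1,\ \big|\partial_\eta\big(\tilde V_x^{g_1}(t,\eta)/\tilde V_x(t,\eta)\big)\big|\le\tilde\varepsilon_2\Big\}.$$
   Context: Fourier transform: $\mathcal F f(\xi)=\hat f(\xi)=\int_{\mathbb R}f(\tau)e^{-i2\pi\xi\tau}d\tau$. The notation $\sum_{\ell\ne k}$ means the sum over $\ell\in\{1,\dots,K\}\setminus\{k\}$. Window. $g$ is in the Schwartz class, $g(0)\ne0$, $|\hat g(\xi)|$ even and decreasing for $\xi\ge0$. Put $g_1(\tau)=\tau g(\tau)$, $g_2(\tau)=\tau^2g(\tau)$, $g_3(\tau)=\tau g'(\tau)$. $\sigma:\mathbb R\to(0,\infty)$ is a $C^1$ function. Given $x(t)=\sum_{k=1}^Kx_k(t)$, $x_k(t)=A_k(t)e^{i2\pi\phi_k(t)}$ with $A_k(t),\phi_k'(t)>0$, define (the dependence on $t$ is suppressed) $$G_k(\xi)=\int_{\mathbb R}e^{i\pi\sigma^2(t)\phi_k''(t)\tau^2}g(\tau)e^{-i2\pi\xi\tau}d\tau .$$ It is assumed that $|G_k(\xi)|$ is even and decreasing for $\xi\ge0$. Let $0<\tau_0<1$ be a threshold and let $\alpha_k=\alpha_k(t)>0$ be the solution of $|G_k(\alpha_k)|=\tau_0$. Time-frequency zones: $$O_k=\{(t,\eta):|G_k(\sigma(t)(\eta-\phi_k'(t)))|>\tau_0\}=\{(t,\eta):|\eta-\phi_k'(t)|<\alpha_k/\sigma(t)\}.$$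 Signal class. $\mathcal D^{(2)}_{\varepsilon_1,\varepsilon_3}$ is the set of such signals $x$ with, for all $k$: $A_k\in C^2(\mathbb R)\cap L_\infty(\mathbb R)$, $\phi_k\in C^3(\mathbb R)$ (real-valued), $\phi_k''\in L_\infty(\mathbb R)$; $|A_k'(t)|\le\varepsilon_1$, $|\phi_k^{(3)}(t)|\le\varepsilon_3$ for all $t$; $\min_{2\le k\le K}\inf_{t}(\phi_k'(t)-\phi_{k-1}'(t))>0$; and $x$ is well-separated with $g$: there is $\sigma(t)$ such that $O_k\cap O_\ell=\emptyset$ for $k\ne\ell$. Such a $\sigma$ is the one used throughout. In $L_k(t)$, for $k=1$ or $k=K$ the term with the non-existing index ($\alpha_0$ or $\alpha_{K+1}$) is omitted. Adaptive STFT: for $f$ in the Schwartz class, $\tilde V_x^f(t,\eta)=\int_{\mathbb R}x(t+\tau)\frac1{\sigma(t)}f\big(\frac\tau{\sigma(t)}\big)e^{-i2\pi\eta\tau}d\tau$, and $\tilde V_x=\tilde V_x^g$. Phase transformations. Where $\tilde V_x\ne0$ and $\partial_\eta(\tilde V_x^{g_1}/\tilde V_x)\ne0$, let $$P_0(t,\eta)=\frac1{\partial_\eta\big(\tilde V_x^{g_1}/\tilde V_x\big)}\Big\{\partial_\eta\Big(\frac{\partial_t\tilde V_x}{\tilde V_x}\Big)+\frac{\sigma'(t)}{\sigma(t)}\partial_\eta\Big(\frac{\tilde V_x^{g_3}}{\tilde V_x}\Big)\Big\},$$ $$\omega_x^{adp,2nd,c}(t,\eta)=\frac{\sigma'(t)}{i2\pi\sigma(t)}+\frac{\partial_t\tilde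 V_x}{i2\pi\tilde V_x}-\frac{\tilde V_x^{g_1}}{i2\pi\tilde V_x}P_0(t,\eta)+\frac{\sigma'(t)}{\sigma(t)}\frac{\tilde V_x^{g_3}}{i2\pi\tilde V_x},\qquad \omega_x^{adp,2nd}=\mathrm{Re}\,\omega_x^{adp,2nd,c}$$ (all functions evaluated at $(t,\eta)$). 2nd-order adaptive FSST: for $\gamma_1,\gamma_2,\lambda>0$, $$R^{adp,2nd,\lambda}_{x,\gamma_1,\gamma_2}(t,\xi)=\int_{\{\eta:\,|\tilde V_x(t,\eta)|>\gamma_1,\ |\partial_\eta(\tilde V_x^{g_1}(t,\eta)/\tilde V_x(t,\eta))|>\gamma_2\}}\tilde V_x(t,\eta)\frac1\lambda h\Big(\frac{\xi-\omega_x^{adp,2nd}(t,\eta)}\lambda\Big)d\eta,$$ with $h$ a fixed compactly supported smooth function with $\int_{\mathbb R}h=1$; $\lambda\to0$ means $\lambda\to0^+$. Further notation. For $j\ge0$, $$G_{j,k}(t,\eta)=\int_{\mathbb R}e^{i2\pi(\phi_k'(t)\tau+\frac12\phi_k''(t)\tau^2)}\frac{\tau^j}{\sigma(t)^{j+1}}g\Big(\frac\tau{\sigma(t)}\Big)e^{-i2\pi\eta\tau}d\tau,$$ so $G_{0,k}(t,\eta)=G_k(\sigma(t)(\eta-\phi_k'(t)))$, and $$M_{\ell,k}(t)=\sigma(t)\int_{\{\eta:(t,\eta)\in O_k\}}|G_{0,\ell}(t,\eta)|d\eta=\int_{|u|<\alpha_k}|G_\ell(u+\sigma(t)(\phi_k'(t)-\phi_\ell'(t)))|du.$$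 Residuals: $$\mathrm{res}_0=\sum_{k=1}^K\int_{\mathbb R}\Big\{(A_k(t+\tau)-A_k(t))e^{i2\pi\phi_k(t+\tau)}+x_k(t)e^{i2\pi(\phi_k'(t)\tau+\frac12\phi_k''(t)\tau^2)}\big(e^{i2\pi(\phi_k(t+\tau)-\phi_k(t)-\phi_k'(t)\tau-\frac12\phi_k''(t)\tau^2)}-1\big)\Big\}\frac1{\sigma(t)}g\Big(\frac\tau{\sigma(t)}\Big)e^{-i2\pi\eta\tau}d\tau,$$ and $\mathrm{res}_1,\mathrm{res}_2,\mathrm{res}_0',\mathrm{res}_1'$ are the same expression with $g$ replaced by $g_1,g_2,g',g_3$ respectively. With $I_n=\int_{\mathbb R}|\tau^ng(\tau)|d\tau$, $$\Pi_0(t)=K\varepsilon_1I_1+\frac\pi3\varepsilon_3I_3\sigma^2(t)\sum_{k=1}^KA_k(t).$$ For each $k$ let $$B_k=\sum_{\ell\ne k}x_\ell(\phi_\ell'-\phi_k')G_{0,\ell},\quad D_k=\sum_{\ell\ne k}x_\ell(\phi_\ell''-\phi_k'')G_{1,\ell},\quad E_k=\sum_{\ell\ne k}x_\ell(\phi_\ell'-\phi_k')G_{1,\ell},\quad F_k=\sum_{\ell\ne k}x_\ell(\phi_\ell''-\phi_k'')G_{2,\ell}$$ (with $x_\ell,\phi_\ell',\phi_\ell''$ evaluated at $t$ and $G_{j,\ell}$ at $(t,\eta)$), and $$\mathrm{Res}_1=i2\pi B_k+i2\pi\sigma(t)D_k+i2\pi(\eta-\phi_k'(t))\mathrm{res}_0-\frac{\mathrm{res}_0'}{\sigma(t)}-i2\pi\phi_k''(t)\sigma(t)\mathrm{res}_1,$$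 $$\mathrm{Res}_2=4\pi^2\sigma(t)E_k+4\pi^2\sigma^2(t)F_k+i2\pi\,\mathrm{res}_0+4\pi^2(\eta-\phi_k'(t))\sigma(t)\mathrm{res}_1+i2\pi\,\mathrm{res}_1'-4\pi^2\phi_k''(t)\sigma^2(t)\mathrm{res}_2,$$ $$\mathrm{Res}_3=\frac{\tilde V_x\,\mathrm{Res}_2-\partial_\eta\tilde V_x\,\mathrm{Res}_1}{\tilde V_x\,\partial_\eta\tilde V_x^{g_1}-\tilde V_x^{g_1}\,\partial_\eta\tilde V_x}.$$ These depend on $k$ and $(t,\eta)$; in $\mathrm{Bd}_1$ they are taken with the index $k$ of the maximum.
   Formalization: In (b) the strict bound by Bd_1 is asserted only when Bd_1>0, with ≤ Bd_1 in general; the strict bound fails for Bd_1=0, e.g. a single pure tone x(t)=e^{i2πt} with Gaussian window and σ=1, where it reads 0<0. *)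

(* Defs.v *)
(* MathComp-Analysis: reals are an arbitrary [R : realType], complex numbers
   are [R[i]].  Real-to-complex integrals and derivatives are taken
   componentwise. *)
From HB Require Import structures.
From mathcomp Require Import all_boot all_order all_algebra.
From mathcomp Require Import all_classical all_reals all_analysis.
From mathcomp Require Import complex.

Set Implicit Arguments.
Unset Strict Implicit.
Unset Printing Implicit Defensive.

Import Order.TTheory GRing.Theory Num.Theory.
Import numFieldNormedType.Exports.

Local Open Scope classical_set_scope.
Local Open Scope complex_scope.
Local Open Scope ring_scope.

Section ComplexCalculus.
Context {R : realType}.
Implicit Types (f : R -> R[i]) (x : R).

(* The real-valued modulus; the library norm [`|z|] on [R[i]] takes its values
   in [R[i]]. *)
Definition cmod (z : R[i]) : R := ComplexField.Normc.normc z.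

Definition cexpi x : R[i] := cos x +i* sin x.

Definition cint (D : set R) f : R[i] :=
  Rintegral (@lebesgue_measure R) D (fun x => complex.Re (f x)) +i*
  Rintegral (@lebesgue_measure R) D (fun x => complex.Im (f x)).

Definition cderivn (n : nat) f x : R[i] :=
  derive1n n (fun y => complex.Re (f y)) x +i*
  derive1n n (fun y => complex.Im (f y)) x.

Definition cderiv f x : R[i] := cderivn 1 f x.

Definition smooth (u : R -> R) : Prop :=
  forall (n : nat) (x : R), derivable (derive1n n u) x 1.

Definition csmooth f : Prop :=
  smooth (fun x => complex.Re (f x)) /\ smooth (fun x => complex.Im (f x)).

Definition schwartz f : Prop :=
  csmooth f /\
  forall m n : nat, exists M : R,
    forall x, `|x| ^+ m * cmod (cderivn n f x) <= M.

Definition class_Cn (n : nat) (u : R -> R) : Prop :=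
  (forall m : nat, (m < n)%N -> forall x, derivable (derive1n m u) x 1) /\
  continuous (derive1n n u).

Definition Linfty (u : R -> R) : Prop :=
  u \in Lfun (@lebesgue_measure R) +oo%E.

Definition fourier f (xi : R) : R[i] :=
  cint setT (fun tau => f tau * cexpi (- (2 * pi * xi * tau))).

(* "decreasing" is taken in the weak sense, the more general hypothesis;
   uniqueness of the zone half-widths is part of [zone_halfwidth]. *)
Definition even_decreasing (u : R -> R) : Prop :=
  (forall x, u (- x) = u x) /\
  (forall x y : R, 0 <= x -> x <= y -> u y <= u x).

Definition window f : Prop :=
  [/\ schwartz f, f 0 != 0 & even_decreasing (fun xi => cmod (fourier f xi))].

Definition mollifier f : Prop :=
  [/\ csmooth f, compact (closure [set x | f x != 0]) & cint setT f = 1].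

End ComplexCalculus.

Section Signal.
Context {R : realType} {K : nat}.
(* [g]: window, [sigma]: window width, [A], [phi]: amplitudes and phases;
   the components, numbered 1..K in the mathematics, are indexed by 'I_K. *)
Variables (g : R -> R[i]) (sigma : R -> R) (A phi : 'I_K -> R -> R).
Implicit Types (k l : 'I_K) (t eta : R) (f : R -> R[i]).

Definition dphi k : R -> R := derive1n 1 (phi k).
Definition ddphi k : R -> R := derive1n 2 (phi k).

Definition component k t : R[i] := (A k t)%:C * cexpi (2 * pi * phi k t).

Definition signal t : R[i] := \sum_(k < K) component k t.

Definition g1 (tau : R) : R[i] := tau%:C * g tau.
Definition g2 (tau : R) : R[i] := (tau ^+ 2)%:C * g tau.
Definition g3 (tau : R) : R[i] := tau%:C * cderiv g tau.

Definition Gk k t (xi : R) : R[i] :=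
  fourier (fun tau =>
    cexpi (pi * sigma t ^+ 2 * ddphi k t * tau ^+ 2) * g tau) xi.

Definition zone (tau0 : R) k : set (R * R) :=
  [set p | tau0 < cmod (Gk k p.1 (sigma p.1 * (p.2 - dphi k p.1)))].

Definition zone_at (tau0 : R) k t : set R := [set eta | zone tau0 k (t, eta)].

Definition zone_halfwidth (tau0 : R) (alpha : 'I_K -> R -> R) : Prop :=
  forall k t,
    [/\ 0 < alpha k t,
        cmod (Gk k t (alpha k t)) = tau0 &
        forall xi : R, 0 < xi -> cmod (Gk k t xi) = tau0 -> xi = alpha k t].

(* [sigma] is an admissible window width for the signal, [alpha] being the
   corresponding half-widths, and it separates the components. *)
Definition well_separating (tau0 : R) (alpha : 'I_K -> R -> R) : Prop :=
  [/\ (forall t, 0 < sigma t) /\ class_Cn 1 sigma,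
      forall k t, even_decreasing (fun xi => cmod (Gk k t xi)),
      zone_halfwidth tau0 alpha &
      forall k l, k != l -> zone tau0 k `&` zone tau0 l = set0].

Definition stft f t eta : R[i] :=
  fourier (fun tau =>
    signal (t + tau) * ((sigma t)^-1)%:C * f (tau / sigma t)) eta.

Definition dt (F : R -> R -> R[i]) t eta : R[i] := cderiv (F^~ eta) t.
Definition deta (F : R -> R -> R[i]) t eta : R[i] := cderiv (F t) eta.

Definition V : R -> R -> R[i] := stft g.
Definition V1 : R -> R -> R[i] := stft g1.
Definition V3 : R -> R -> R[i] := stft g3.

Definition ratio1 t eta : R[i] := V1 t eta / V t eta.

Definition i2pi : R[i] := 0 +i* (2 * pi).

Definition dlogsigma t : R[i] := (derive1 sigma t / sigma t)%:C.

Definition P0 t eta : R[i] :=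
  (deta ratio1 t eta)^-1 *
  (deta (fun s e => dt V s e / V s e) t eta +
   dlogsigma t * deta (fun s e => V3 s e / V s e) t eta).

Definition omega_c t eta : R[i] :=
  dlogsigma t / i2pi +
  dt V t eta / (i2pi * V t eta) -
  V1 t eta / (i2pi * V t eta) * P0 t eta +
  dlogsigma t * (V3 t eta / (i2pi * V t eta)).

Definition omega t eta : R := complex.Re (omega_c t eta).

(* second-order adaptive FSST; c1, c2 are the thresholds gamma_1, gamma_2 *)
Definition fsst (h : R -> R[i]) (c1 c2 lam t xi : R) : R[i] :=
  cint [set eta | c1 < cmod (V t eta) /\ c2 < cmod (deta ratio1 t eta)]
    (fun eta =>
       V t eta * (lam^-1)%:C * h ((xi - omega t eta) / lam)).

Definition chirp k t (tau : R) : R[i] :=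
  cexpi (2 * pi * (dphi k t * tau + 2^-1 * ddphi k t * tau ^+ 2)).

Definition Gj (j : nat) k t eta : R[i] :=
  fourier (fun tau =>
    chirp k t tau * (tau ^+ j / sigma t ^+ j.+1)%:C * g (tau / sigma t)) eta.

Definition Mlk (tau0 : R) l k t : R :=
  sigma t * Rintegral (@lebesgue_measure R) (zone_at tau0 k t)
              (fun eta => cmod (Gj 0 l t eta)).

Definition res f t eta : R[i] :=
  \sum_(k < K) fourier (fun tau =>
    ((A k (t + tau) - A k t)%:C * cexpi (2 * pi * phi k (t + tau)) +
     component k t * chirp k t tau *
       (cexpi (2 * pi * (phi k (t + tau) - phi k t - dphi k t * tau
                           - 2^-1 * ddphi k t * tau ^+ 2)) - 1))
    * ((sigma t)^-1)%:C * f (tau / sigma t)) eta.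

Definition absmoment (n : nat) : R :=
  Rintegral (@lebesgue_measure R) setT (fun tau => cmod ((tau ^+ n)%:C * g tau)).

Definition L1norm : R :=
  Rintegral (@lebesgue_measure R) setT (fun tau => cmod (g tau)).

Definition Pi0 (e1 e3 t : R) : R :=
  K%:R * e1 * absmoment 1 +
  pi / 3 * e3 * absmoment 3 * sigma t ^+ 2 * \sum_(k < K) A k t.

Definition Bk k t eta : R[i] :=
  \sum_(l < K | l != k)
    component l t * (dphi l t - dphi k t)%:C * Gj 0 l t eta.
Definition Dk k t eta : R[i] :=
  \sum_(l < K | l != k)
    component l t * (ddphi l t - ddphi k t)%:C * Gj 1 l t eta.
Definition Ek k t eta : R[i] :=
  \sum_(l < K | l != k)
    component l t * (dphi l t - dphi k t)%:C * Gj 1 l t eta.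
Definition Fk k t eta : R[i] :=
  \sum_(l < K | l != k)
    component l t * (ddphi l t - ddphi k t)%:C * Gj 2 l t eta.

Definition Res1 k t eta : R[i] :=
  i2pi * Bk k t eta + i2pi * (sigma t)%:C * Dk k t eta
  + i2pi * (eta - dphi k t)%:C * res g t eta
  - res (cderiv g) t eta / (sigma t)%:C
  - i2pi * (ddphi k t * sigma t)%:C * res g1 t eta.

Definition Res2 k t eta : R[i] :=
  (4 * pi ^+ 2 * sigma t)%:C * Ek k t eta
  + (4 * pi ^+ 2 * sigma t ^+ 2)%:C * Fk k t eta
  + i2pi * res g t eta
  + (4 * pi ^+ 2 * (eta - dphi k t) * sigma t)%:C * res g1 t eta
  + i2pi * res g3 t eta
  - (4 * pi ^+ 2 * ddphi k t * sigma t ^+ 2)%:C * res g2 t eta.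

Definition Res3 k t eta : R[i] :=
  (V t eta * Res2 k t eta - deta V t eta * Res1 k t eta) /
  (V t eta * deta V1 t eta - V1 t eta * deta V t eta).

Definition Res4 k t eta : R[i] :=
  Res1 k t eta / (i2pi * V t eta)
  - V1 t eta * Res3 k t eta / (i2pi * V t eta).

(* Extended real, so that the supremum needs no boundedness side condition *)
Definition Bd1 (tau0 e1 e2 t : R) : \bar R :=
  \big[maxe/-oo%E]_(k < K)
    ereal_sup [set (cmod (Res1 k t eta) / (2 * pi * e1)
        + (2 * pi * e1 ^+ 3 * e2)^-1 * cmod (V1 t eta)
          * (cmod (deta V t eta) * cmod (Res1 k t eta)
             + e1 * cmod (Res2 k t eta)))%:E
      | eta in zone_at tau0 k t].

(* Extended real: the minimum runs over the existing neighbours of k, so it is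
   +oo (no constraint) if K = 1. *)
Definition Lk (alpha : 'I_K -> R -> R) k t : \bar R :=
  (((sigma t)^-1)%:E *
   \big[mine/+oo]_(l < K | (l.+1 == k :> nat) || (k.+1 == l :> nat))
      (alpha k t + alpha l t)%:E)%E.

Definition Zt (tau0 e1 e2 : R) k t : set R :=
  [set eta | [/\ zone tau0 k (t, eta), e1 < cmod (V t eta) &
                 cmod (deta ratio1 t eta) <= e2]].

Definition Bd2' (eps1 eps3 tau0 e1 : R) (alpha : 'I_K -> R -> R) k t : R :=
  (cmod (g 0))^-1 *
  (2 * alpha k t * (e1 + sigma t * Pi0 eps1 eps3 t)
   + A k t * cmod (cint [set u | alpha k t <= `|u|] (Gk k t))
   + \sum_(l < K | l != k) A l t * Mlk tau0 l k t).

Definition Bd2'' (eps1 eps3 tau0 e1 e2 : R) (alpha : 'I_K -> R -> R) k t : R :=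
  (cmod (g 0))^-1 *
  (2 * alpha k t * sigma t * Pi0 eps1 eps3 t
   + sigma t * A k t * L1norm * fine (lebesgue_measure (Zt tau0 e1 e2 k t))
   + \sum_(l < K | l != k) A l t * Mlk tau0 l k t).

Definition Bd2 (eps1 eps3 tau0 e1 e2 : R) (alpha : 'I_K -> R -> R) k t : R :=
  Bd2' eps1 eps3 tau0 e1 alpha k t + Bd2'' eps1 eps3 tau0 e1 e2 alpha k t.

End Signal.

(* Membership of [signal A phi] in D^(2)_{eps1,eps3}; the class refers to the
   decomposition into components, hence the arguments A and phi. *)
Definition signal_class {R : realType} {K : nat} (g : R -> R[i])
    (tau0 eps1 eps3 : R) (A phi : 'I_K -> R -> R) : Prop :=
  [/\ forall k t, 0 < A k t /\ 0 < dphi phi k t,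
      forall k, [/\ class_Cn 2 (A k), Linfty (A k),
                    class_Cn 3 (phi k) & Linfty (ddphi phi k)],
      forall k t, `|derive1 (A k) t| <= eps1 /\
                  `|derive1n 3 (phi k) t| <= eps3,
      forall k l : 'I_K, l = k.+1 :> nat ->
        (0 < ereal_inf [set (dphi phi l t - dphi phi k t)%:E | t in setT])%E &
      exists (sigma : R -> R) (alpha : 'I_K -> R -> R),
        well_separating g sigma phi tau0 alpha].

(* Main.v *)
(* Freezing the phase to second order at [t] gives
   V = sum_k x_k G_{0,k} + res_0, with |res_0| <= sigma Pi_0 by Taylor's formula;
   outside all the zones every |G_{0,k}| is at most tau_0, whence (a).

   The substitution y = t + tau moves the time dependence of V to the window, and
   integrating by parts against each chirp then yields, for any k,
     dV/dt = i2pi phi_k' V + i2pi sigma phi_k'' V^{g1} + Res_1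
             - (sigma'/sigma) (V + V^{g3}),     dRes_1/deta = Res_2.
   Eliminating phi_k'' between this identity and its derivative in eta is exactly
   what the second-order phase transformation does, whence (b).

   By (b), omega lies within eps_3 of phi_l' on the l-th zone; as the phi_l' are
   at least L_k >= 2 eps_3 away from phi_k', the limit of the synthesis integral
   is the integral of V over the points of O_k above both thresholds.  Since
   sigma times the integral of G_{0,k} over O_k is g(0) minus a tail, by Fourier
   inversion at 0, the error consists of that tail, the other components, res_0,
   and the two discarded parts of O_k. *)

Require Import Defs.
From HB Require Import structures.
From mathcomp Require Import all_boot all_order all_algebra.
From mathcomp Require Import all_classical all_reals all_analysis.
From mathcomp Require Import measurable_realfun lebesgue_integral_under.
From mathcomp Require Import complex.
From mathcomp Require Import ring lra.

Set Implicit Arguments.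
Unset Strict Implicit.
Unset Printing Implicit Defensive.

Import Order.TTheory GRing.Theory Num.Theory.
Import numFieldNormedType.Exports.

Local Open Scope classical_set_scope.
Local Open Scope complex_scope.
Local Open Scope ring_scope.

(** * Complex-valued functions of a real variable *)

Section ComplexAlgebra.
Context {R : realType}.
Implicit Types (z w : R[i]) (x y : R).

(** Two classes of continuous functions carry the analysis: [decays], decreasing faster than any
    power, and [polybounded], of at most polynomial growth. The signal seen from t, the chirps and
    the residual parts are polynomially bounded and the windows decay, so every transform is the
    Fourier integral of a decaying function.

    The strict inequality of (b) has one source: |V| exceeds the threshold e1, so the error is at
    most e1/|V| < 1 times the bound. This gives nothing when the bound is 0, which is why strictness
    is stated for positive [Bd1]; in (c) the positivity of e3 takes its place.

    The limit in (c) is pointwise in eta, and it would depend on the mollifier wherever omega lies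
    at distance exactly e3 from phi_k'. The strict bound on the zone of k and the separation of the
    other zones exclude such points. Both Bd2' and Bd2'' contain the residual and the other
    components because V is expanded twice, over O_k and over Z_t. *)

Lemma eq_ReIm z w : complex.Re z = complex.Re w ->
  complex.Im z = complex.Im w -> z = w.
Proof. by case: z => a b; case: w => c d /= -> ->. Qed.

Lemma cReD z w : complex.Re (z + w) = complex.Re z + complex.Re w.
Proof. by case: z => a b; case: w. Qed.

Lemma cImD z w : complex.Im (z + w) = complex.Im z + complex.Im w.
Proof. by case: z => a b; case: w. Qed.

Lemma cReN z : complex.Re (- z) = - complex.Re z.
Proof. by case: z. Qed.

Lemma cImN z : complex.Im (- z) = - complex.Im z.
Proof. by case: z. Qed.

Lemma cReM z w : complex.Re (z * w) =
  complex.Re z * complex.Re w - complex.Im z * complex.Im w.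
Proof. by case: z => a b; case: w. Qed.

Lemma cImM z w : complex.Im (z * w) =
  complex.Re z * complex.Im w + complex.Im z * complex.Re w.
Proof. by case: z => a b; case: w. Qed.

Definition ReImE := (cReD, cImD, cReN, cImN, cReM, cImM).

Lemma real_complexD x y : (x + y)%:C = x%:C + y%:C :> R[i].
Proof. exact: rmorphD. Qed.

Lemma real_complexM x y : (x * y)%:C = x%:C * y%:C :> R[i].
Proof. exact: rmorphM. Qed.

Lemma real_complexN x : (- x)%:C = - x%:C :> R[i].
Proof. exact: rmorphN. Qed.

Lemma real_complexB x y : (x - y)%:C = x%:C - y%:C :> R[i].
Proof. exact: rmorphB. Qed.

Lemma real_complexV x : (x^-1)%:C = (x%:C)^-1 :> R[i].
Proof. exact: fmorphV. Qed.

Lemma real_complex_nat n : (n%:R)%:C = n%:R :> R[i].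
Proof. exact: rmorph_nat. Qed.

Lemma real_complex_eq0 x : (x%:C == 0 :> R[i]) = (x == 0).
Proof. exact: fmorph_eq0. Qed.

Lemma cmod_normE z : (cmod z)%:C = `|z|.
Proof. by []. Qed.

Lemma cmod0 : cmod (0 : R[i]) = 0.
Proof. exact: ComplexField.Normc.normc0. Qed.

Lemma cmodM z w : cmod (z * w) = cmod z * cmod w.
Proof. exact: ComplexField.Normc.normcM. Qed.

Lemma cmodV z : cmod z^-1 = (cmod z)^-1.
Proof. exact: ComplexField.Normc.normcV. Qed.

Lemma cmod_ge0 z : 0 <= cmod z.
Proof. by case: z => a b; exact: sqrtr_ge0. Qed.

Lemma cmod_eq0 z : (cmod z == 0) = (z == 0).
Proof.
apply/eqP/eqP => [|->]; last exact: cmod0.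
exact: ComplexField.Normc.eq0_normc.
Qed.

Lemma cmod_gt0 z : (0 < cmod z) = (z != 0).
Proof. by rewrite lt_def cmod_ge0 andbT cmod_eq0. Qed.

Lemma cmodN z : cmod (- z) = cmod z.
Proof. by apply: complexI; rewrite !cmod_normE normrN. Qed.

Lemma ler_cmodD z w : cmod (z + w) <= cmod z + cmod w.
Proof. by rewrite -lecR real_complexD !cmod_normE; exact: ler_normD. Qed.

Lemma ler_cmodB z w : cmod (z - w) <= cmod z + cmod w.
Proof. by rewrite (le_trans (ler_cmodD _ _))// cmodN. Qed.

Lemma cmod_real x : cmod x%:C = `|x|.
Proof. by rewrite /cmod /= expr0n/= addr0 sqrtr_sqr. Qed.

Lemma ler_cmod_sum (I : Type) (r : seq I) (P : pred I) (F : I -> R[i]) :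
  cmod (\sum_(i <- r | P i) F i) <= \sum_(i <- r | P i) cmod (F i).
Proof.
elim/big_ind2: _ => //; first by rewrite cmod0.
by move=> z x w y zx wy; rewrite (le_trans (ler_cmodD _ _))// lerD.
Qed.

Lemma cmod_sqr z : cmod z ^+ 2 = complex.Re z ^+ 2 + complex.Im z ^+ 2.
Proof. by case: z => a b; rewrite sqr_sqrtr// addr_ge0// sqr_ge0. Qed.

Lemma ler_Re_cmod z : `|complex.Re z| <= cmod z.
Proof.
rewrite -(@ler_pXn2r _ 2)// ?nnegrE ?cmod_ge0// real_normK ?num_real//.
by rewrite cmod_sqr lerDl sqr_ge0.
Qed.

Lemma ler_Im_cmod z : `|complex.Im z| <= cmod z.
Proof.
rewrite -(@ler_pXn2r _ 2)// ?nnegrE ?cmod_ge0// real_normK ?num_real//.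
by rewrite cmod_sqr lerDr sqr_ge0.
Qed.

Lemma ler_cmod_ReIm z : cmod z <= `|complex.Re z| + `|complex.Im z|.
Proof.
rewrite -(@ler_pXn2r _ 2)// ?nnegrE ?cmod_ge0// ?addr_ge0//.
rewrite cmod_sqr sqrrD !real_normK ?num_real// addrAC lerDl.
by rewrite mulrn_wge0// mulr_ge0.
Qed.

Lemma cmod_cexpi x : cmod (cexpi x) = 1.
Proof. by rewrite /cmod /= cos2Dsin2 sqrtr1. Qed.

Lemma cexpi0 : cexpi 0 = 1 :> R[i].
Proof. by rewrite /cexpi cos0 sin0. Qed.

Lemma cexpiD x y : cexpi (x + y) = cexpi x * cexpi y.
Proof.
apply: eq_ReIm; rewrite ?cReM ?cImM /=; first exact: cosD.
by rewrite sinD addrC [cos x * _]mulrC.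
Qed.

(** The derivative of [cexpi] produces the factor ['i%C]; this form of the constant lets [ring]
    match the two. *)
Lemma i2piE : i2pi = 2%:R * pi%:C * 'i%C :> R[i].
Proof. by apply: eq_ReIm; rewrite -real_complex_nat !ReImE /=; ring. Qed.

Lemma i2pi_neq0 : i2pi != 0 :> R[i].
Proof. by rewrite eq_complex /= eqxx /= mulf_neq0// gt_eqF// pi_gt0. Qed.

Lemma cmod_i2pi : cmod (i2pi : R[i]) = 2 * pi.
Proof.
rewrite /cmod /= expr0n/= add0r sqrtr_sqr ger0_norm//.
by rewrite mulr_ge0// pi_ge0.
Qed.

End ComplexAlgebra.

(** * Derivatives of complex-valued functions *)

Section ComplexDerivative.
Context {R : realType}.
Implicit Types (f g : R -> R[i]) (u : R -> R) (x : R) (l m : R[i]).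

(** A relation, because [cderiv] has a value even where a component is not differentiable; here
    existence and value travel together. *)
Definition is_cderive f x l : Prop :=
  is_derive x 1 (fun y => complex.Re (f y)) (complex.Re l) /\
  is_derive x 1 (fun y => complex.Im (f y)) (complex.Im l).

Definition ccontinuous f : Prop :=
  continuous (fun y => complex.Re (f y)) /\
  continuous (fun y => complex.Im (f y)).

Lemma is_cderiveE f x l : is_cderive f x l -> cderiv f x = l.
Proof.
move=> [f1 f2]; apply: eq_ReIm; rewrite /cderiv /cderivn /= derive1E.
  by have := @derive_val _ _ _ _ _ _ _ f1.
by have := @derive_val _ _ _ _ _ _ _ f2.
Qed.

Lemma is_cderive_eq f x l m : is_cderive f x l -> l = m -> is_cderive f x m.
Proof. by move=> ? <-. Qed.

Lemma is_cderive_ccontinuous f (df : R -> R[i]) :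
  (forall x, is_cderive f x (df x)) -> ccontinuous f.
Proof.
move=> H; split=> x; apply/differentiable_continuous/derivable1_diffP;
  have [h1 h2] := H x.
  by have := @ex_derive _ _ _ _ _ _ _ h1.
by have := @ex_derive _ _ _ _ _ _ _ h2.
Qed.

Lemma is_cderive_cst l x : is_cderive (fun=> l) x 0.
Proof. by split; exact: is_derive_cst. Qed.

Lemma is_cderive_real u x (du : R) :
  is_derive x 1 u du -> is_cderive (fun y => (u y)%:C) x du%:C.
Proof. by move=> H; split=> //; exact: is_derive_cst. Qed.

Lemma is_cderiveD f g x l m : is_cderive f x l -> is_cderive g x m ->
  is_cderive (fun y => f y + g y) x (l + m).
Proof.
move=> [f1 f2] [g1 g2]; split.
  rewrite cReD (_ : (fun _ => _) =
    (fun y => complex.Re (f y)) + (fun y => complex.Re (g y))).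
    exact: is_deriveD.
  by apply/funext => y; rewrite cReD.
rewrite cImD (_ : (fun _ => _) =
    (fun y => complex.Im (f y)) + (fun y => complex.Im (g y))).
  exact: is_deriveD.
by apply/funext => y; rewrite cImD.
Qed.

Lemma is_cderiveM f g x l m : is_cderive f x l -> is_cderive g x m ->
  is_cderive (fun y => f y * g y) x (l * g x + f x * m).
Proof.
move=> [f1 f2] [g1 g2]; split.
  rewrite (_ : (fun _ => _) =
    (fun y => complex.Re (f y)) * (fun y => complex.Re (g y)) -
    (fun y => complex.Im (f y)) * (fun y => complex.Im (g y))); last first.
    by apply/funext => y; rewrite cReM.
  apply: is_derive_eq; rewrite !ReImE /= /GRing.scale /=; ring.
rewrite (_ : (fun _ => _) =
    (fun y => complex.Re (f y)) * (fun y => complex.Im (g y)) +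
    (fun y => complex.Im (f y)) * (fun y => complex.Re (g y))); last first.
  by apply/funext => y; rewrite cImM.
apply: is_derive_eq (is_deriveD (is_deriveM f1 g2) (is_deriveM f2 g1)) _.
rewrite !ReImE /= /GRing.scale /=; ring.
Qed.

Lemma is_cderiveZ f x l c : is_cderive f x l ->
  is_cderive (fun y => c * f y) x (c * l).
Proof.
move=> fl; apply: (is_cderive_eq (is_cderiveM (is_cderive_cst c x) fl)).
by rewrite mul0r add0r.
Qed.

Lemma is_cderiveN f x l : is_cderive f x l ->
  is_cderive (fun y => - f y) x (- l).
Proof.
move=> fl; have := is_cderiveZ (-1) fl; rewrite mulN1r.
by under eq_fun do rewrite mulN1r.
Qed.

Lemma is_cderiveB f g x l m : is_cderive f x l -> is_cderive g x m ->
  is_cderive (fun y => f y - g y) x (l - m).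
Proof. by move=> fl gm; apply: is_cderiveD fl (is_cderiveN gm). Qed.

Lemma is_cderive_sum (I : Type) (r : seq I) (P : pred I) (F : I -> R -> R[i])
    (dF : I -> R[i]) x :
  (forall i, P i -> is_cderive (F i) x (dF i)) ->
  is_cderive (fun y => \sum_(i <- r | P i) F i y) x (\sum_(i <- r | P i) dF i).
Proof.
move=> H; elim: r => [|i r IH].
  rewrite big_nil; under eq_fun do rewrite big_nil.
  exact: is_cderive_cst.
rewrite big_cons; under eq_fun do rewrite big_cons.
by case: ifPn => // Pi; apply: is_cderiveD IH; exact: H.
Qed.

Lemma is_cderive_cexpi u x (du : R) : is_derive x 1 u du ->
  is_cderive (fun y => cexpi (u y)) x ('i%C * du%:C * cexpi (u x)).
Proof.
move=> udu; split.
  rewrite (_ : (fun _ => _) = cos \o u)//.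
  have := is_derive1_comp (is_derive_cos (u x)) udu.
  by move/is_derive_eq; apply; rewrite !ReImE /=; ring.
rewrite (_ : (fun _ => _) = sin \o u)//.
have := is_derive1_comp (is_derive_sin (u x)) udu.
by move/is_derive_eq; apply; rewrite !ReImE /=; ring.
Qed.

Lemma is_cderive_comp f u x l (du : R) :
  is_cderive f (u x) l -> is_derive x 1 u du ->
  is_cderive (fun y => f (u y)) x (l * du%:C).
Proof.
move=> [f1 f2] udu; split.
  have := is_derive1_comp f1 udu.
  by move/is_derive_eq; apply; rewrite !ReImE /=; ring.
have := is_derive1_comp f2 udu.
by move/is_derive_eq; apply; rewrite !ReImE /=; ring.
Qed.

(** The inverse is the conjugate divided by the squared modulus [n], so both components are real
    quotients with the nonvanishing denominator [n]. *)
Lemma is_cderiveV f x l : f x != 0 -> is_cderive f x l ->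
  is_cderive (fun y => (f y)^-1) x (- l / f x ^+ 2).
Proof.
move=> fx0 [f1 f2].
pose a y := complex.Re (f y); pose b y := complex.Im (f y).
have fE y : f y = a y +i* b y by apply: eq_ReIm.
pose n : R -> R := a * a + b * b.
have nE y : n y = a y * a y + b y * b y by [].
have n0 : n x != 0.
  rewrite /n /= !fctE -!expr2 -cmod_sqr sqrf_eq0 cmod_eq0; exact: fx0.
have invE y : (f y)^-1 = (a y / n y) -i* (b y / n y).
  by rewrite fE /n /= !fctE -!expr2.
have nd : is_derive x 1 n
    (2 * (a x * complex.Re l + b x * complex.Im l)).
  apply: is_derive_eq (is_deriveD (is_deriveM f1 f1) (is_deriveM f2 f2)) _.
  by rewrite /GRing.scale /=; ring.
have nVd := is_deriveV n0 nd.
have lE : - l / f x ^+ 2 = - l * ((a x / n x) -i* (b x / n x)) ^+ 2.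
  by rewrite -invE exprVn.
split.
  rewrite (_ : (fun _ => _) = a * (fun y => (n y)^-1)); last first.
    by apply/funext => y; rewrite invE.
  apply: is_derive_eq; rewrite lE expr2 !ReImE /= /GRing.scale /=.
  rewrite /n !fctE; field.
  by move: n0; rewrite /n !fctE.
rewrite (_ : (fun _ => _) = - b * (fun y => (n y)^-1)); last first.
  by apply/funext => y; rewrite invE /= mulNr.
apply: is_derive_eq; rewrite lE expr2 !ReImE /= /GRing.scale /=.
rewrite /n !fctE; field.
by move: n0; rewrite /n !fctE.
Qed.

Lemma is_cderive_div f g x l m : g x != 0 ->
  is_cderive f x l -> is_cderive g x m ->
  is_cderive (fun y => f y / g y) x ((l * g x - f x * m) / g x ^+ 2).
Proof.
move=> gx0 fl gm.
apply: (is_cderive_eq (is_cderiveM fl (is_cderiveV gx0 gm))); field.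
exact: gx0.
Qed.

End ComplexDerivative.

(** * Componentwise measurability and integration *)

Section ComplexIntegral.
Context {R : realType}.
Local Notation mu := (@lebesgue_measure R).
Implicit Types (f g : R -> R[i]) (D : set R) (G : R -> R).

Definition cmeasurable D f : Prop :=
  measurable_fun D (fun x => complex.Re (f x)) /\
  measurable_fun D (fun x => complex.Im (f x)).

Definition cintegrable D f : Prop :=
  mu.-integrable D (EFin \o (fun x => complex.Re (f x))) /\
  mu.-integrable D (EFin \o (fun x => complex.Im (f x))).

Lemma eq_cint D f g : {in D, f =1 g} -> cint D f = cint D g.
Proof.
by move=> fg; congr (_ +i* _); apply: eq_Rintegral => x xD; rewrite fg.
Qed.

Lemma ccontinuous_measurable D f : measurable D -> ccontinuous f ->
  cmeasurable D f.
Proof.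
move=> mD [f1 f2]; split; apply: measurable_funTS;
  exact: continuous_measurable_fun.
Qed.

Lemma cmeasurableD D f g : cmeasurable D f -> cmeasurable D g ->
  cmeasurable D (fun x => f x + g x).
Proof.
move=> [f1 f2] [g1 g2]; split.
  under eq_fun do rewrite cReD; exact: measurable_funD.
under eq_fun do rewrite cImD; exact: measurable_funD.
Qed.

Lemma cmeasurableM D f g : cmeasurable D f -> cmeasurable D g ->
  cmeasurable D (fun x => f x * g x).
Proof.
move=> [f1 f2] [g1 g2]; split.
  under eq_fun do rewrite cReM.
  by apply: measurable_funB; apply: measurable_funM.
under eq_fun do rewrite cImM.
by apply: measurable_funD; apply: measurable_funM.
Qed.

Lemma cmeasurable_cst D (c : R[i]) : cmeasurable D (fun=> c).
Proof. by split; exact: measurable_cst. Qed.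

Lemma cmeasurableB D f g : cmeasurable D f -> cmeasurable D g ->
  cmeasurable D (fun x => f x - g x).
Proof.
move=> mf mg; apply: cmeasurableD => //.
under eq_fun do rewrite -mulN1r; apply: cmeasurableM => //; exact: cmeasurable_cst.
Qed.

Lemma cmeasurable_sum D (I : Type) (r : seq I) (P : pred I)
    (F : I -> R -> R[i]) : (forall i, P i -> cmeasurable D (F i)) ->
  cmeasurable D (fun x => \sum_(i <- r | P i) F i x).
Proof.
move=> H; elim: r => [|i r IH].
  rewrite (_ : (fun _ => _) = fun=> 0); first exact: cmeasurable_cst.
  by apply/funext => x; rewrite big_nil.
have [Pi|nPi] := boolP (P i); last first.
  by under eq_fun do rewrite big_cons (negbTE nPi).
by under eq_fun do rewrite big_cons Pi; apply: cmeasurableD => //; exact: H.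
Qed.

Lemma measurable_cmod D f : measurable D -> cmeasurable D f ->
  measurable_fun D (fun x => cmod (f x)).
Proof.
move=> mD [f1 f2].
rewrite (_ : (fun _ => _) = Num.sqrt \o (fun x =>
  complex.Re (f x) ^+ 2 + complex.Im (f x) ^+ 2)); last first.
  apply/funext => x /=; rewrite -cmod_sqr sqrtr_sqr ger0_norm//.
  exact: cmod_ge0.
apply: measurableT_comp.
  by apply: continuous_measurable_fun; exact: sqrt_continuous.
by apply: measurable_funD; apply: measurable_funX.
Qed.

Lemma cmeasurableV D f : measurable D -> cmeasurable D f ->
  cmeasurable D (fun x => (f x)^-1).
Proof.
move=> mD [f1 f2].
have mn : measurable_fun D (fun x =>
    (complex.Re (f x) ^+ 2 + complex.Im (f x) ^+ 2)^-1).
  (* On nonnegative reals inversion is the power -1, also at 0, and powers are measurable. *)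
  rewrite (_ : (fun _ => _) = (@powR R ^~ (-1)) \o (fun x =>
      complex.Re (f x) ^+ 2 + complex.Im (f x) ^+ 2)); last first.
    by apply/funext => x /=; rewrite powR_inv1// addr_ge0 ?sqr_ge0.
  apply: measurableT_comp; first exact: measurable_powR.
  by apply: measurable_funD; apply: measurable_funX.
split.
  rewrite (_ : (fun _ => _) = (fun x => complex.Re (f x) *
    (complex.Re (f x) ^+ 2 + complex.Im (f x) ^+ 2)^-1)).
    exact: measurable_funM.
  by apply/funext => x; case: (f x).
rewrite (_ : (fun _ => _) = (fun x => - complex.Im (f x) *
  (complex.Re (f x) ^+ 2 + complex.Im (f x) ^+ 2)^-1)).
  apply: measurable_funM => //; exact: measurable_funN.
by apply/funext => x; case: (f x) => a b /=; rewrite mulNr.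
Qed.

Lemma integrableD_fin D (u v : R -> R) : measurable D ->
  mu.-integrable D (EFin \o u) -> mu.-integrable D (EFin \o v) ->
  mu.-integrable D (EFin \o (fun x => u x + v x)).
Proof.
move=> mD ui vi.
exact: (@eq_integrable _ _ _ mu D mD _ _ _ (@integrableD _ _ _ mu D mD _ _ ui vi)).
Qed.

Lemma integrableB_fin D (u v : R -> R) : measurable D ->
  mu.-integrable D (EFin \o u) -> mu.-integrable D (EFin \o v) ->
  mu.-integrable D (EFin \o (fun x => u x - v x)).
Proof.
move=> mD ui vi.
exact: (@eq_integrable _ _ _ mu D mD _ _ _ (@integrableB _ _ _ mu D mD _ _ ui vi)).
Qed.

Lemma integrableZl_fin D (u : R -> R) (r : R) : measurable D ->
  mu.-integrable D (EFin \o u) -> mu.-integrable D (EFin \o (fun x => r * u x)).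
Proof.
move=> mD ui.
exact: (@eq_integrable _ _ _ mu D mD _ _ _ (@integrableZl _ _ _ mu D mD r _ ui)).
Qed.

Lemma integrable_dominated D (u G : R -> R) : measurable D ->
  measurable_fun D u -> mu.-integrable D (EFin \o G) ->
  (forall x, D x -> `|u x| <= G x) -> mu.-integrable D (EFin \o u).
Proof.
move=> mD mu_ iG H; apply: le_integrable iG => //.
  exact/measurable_EFinP.
move=> x Dx /=; rewrite lee_fin (le_trans (H _ Dx))// ler_norm//.
Qed.

Lemma cintegrable_dominated D f G : measurable D -> cmeasurable D f ->
  mu.-integrable D (EFin \o G) ->
  (forall x, D x -> cmod (f x) <= G x) -> cintegrable D f.
Proof.
move=> mD [f1 f2] iG H; split; apply: (integrable_dominated mD _ iG) => // x Dx.
  exact: le_trans (ler_Re_cmod _) (H x Dx).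
exact: le_trans (ler_Im_cmod _) (H x Dx).
Qed.

Lemma cintegrable_cmeasurable D f : measurable D -> cintegrable D f ->
  cmeasurable D f.
Proof.
by move=> mD [/(measurable_int mu) /measurable_EFinP f1
  /(measurable_int mu) /measurable_EFinP f2].
Qed.

Lemma cintegrable_cmod D f : measurable D -> cintegrable D f ->
  mu.-integrable D (EFin \o (fun x => cmod (f x))).
Proof.
move=> mD fi; have [f1 f2] := fi.
apply: (@integrable_dominated D _
  (fun x => `|complex.Re (f x)| + `|complex.Im (f x)|)) => //.
- by apply: measurable_cmod => //; exact: cintegrable_cmeasurable.
- by apply: integrableD_fin => //; exact: integrable_norm.
- by move=> x Dx; rewrite ger0_norm ?cmod_ge0// ler_cmod_ReIm.
Qed.

Lemma cintegrableS D E f : measurable E -> measurable D -> D `<=` E ->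
  cintegrable E f -> cintegrable D f.
Proof. by move=> mE mD DE [f1 f2]; split; apply: (@integrableS _ _ _ mu E D). Qed.

Lemma cintegrableD D f g : measurable D -> cintegrable D f ->
  cintegrable D g -> cintegrable D (fun x => f x + g x).
Proof.
move=> mD [f1 f2] [g1 g2]; split.
  by under [X in EFin \o X]eq_fun do rewrite cReD; exact: integrableD_fin.
by under [X in EFin \o X]eq_fun do rewrite cImD; exact: integrableD_fin.
Qed.

Lemma cintD D f g : measurable D -> cintegrable D f -> cintegrable D g ->
  cint D (fun x => f x + g x) = cint D f + cint D g.
Proof.
move=> mD [f1 f2] [g1 g2]; apply: eq_ReIm; rewrite ?cReD ?cImD /=.
  by rewrite -RintegralD//; apply: eq_Rintegral => x _; rewrite cReD.
by rewrite -RintegralD//; apply: eq_Rintegral => x _; rewrite cImD.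
Qed.

Lemma cintegrableZ D f (c : R[i]) : measurable D -> cintegrable D f ->
  cintegrable D (fun x => c * f x).
Proof.
move=> mD [f1 f2]; split.
  under [X in EFin \o X]eq_fun do rewrite cReM.
  by apply: integrableB_fin => //; exact: integrableZl_fin.
under [X in EFin \o X]eq_fun do rewrite cImM.
by apply: integrableD_fin => //; exact: integrableZl_fin.
Qed.

Lemma cintZ D f (c : R[i]) : measurable D -> cintegrable D f ->
  cint D (fun x => c * f x) = c * cint D f.
Proof.
move=> mD [f1 f2]; apply: eq_ReIm; rewrite ?cReM ?cImM /=.
  rewrite -!RintegralZl// -RintegralB//; [|exact: integrableZl_fin..].
  by apply: eq_Rintegral => x _; rewrite cReM.
rewrite -!RintegralZl// -RintegralD//; [|exact: integrableZl_fin..].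
by apply: eq_Rintegral => x _; rewrite cImM.
Qed.

Lemma cintegrableB D f g : measurable D -> cintegrable D f ->
  cintegrable D g -> cintegrable D (fun x => f x - g x).
Proof.
move=> mD fi gi; apply: cintegrableD => //.
by under eq_fun do rewrite -mulN1r; exact: cintegrableZ.
Qed.

Lemma cintB D f g : measurable D -> cintegrable D f -> cintegrable D g ->
  cint D (fun x => f x - g x) = cint D f - cint D g.
Proof.
move=> mD fi gi.
transitivity (cint D (fun x => f x + (-1) * g x)).
  by apply: eq_cint => x _; rewrite mulN1r.
by rewrite cintD// ?cintZ ?mulN1r//; exact: cintegrableZ.
Qed.

Lemma cintegrable0 D : cintegrable D (fun=> 0).
Proof. by split; exact: integrable0. Qed.

Lemma cintegrable_sum D (I : Type) (r : seq I) (P : pred I)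
    (F : I -> R -> R[i]) : measurable D ->
  (forall i, P i -> cintegrable D (F i)) ->
  cintegrable D (fun x => \sum_(i <- r | P i) F i x).
Proof.
move=> mD H; elim: r => [|i r IH].
  rewrite (_ : (fun _ => _) = fun=> 0); first exact: cintegrable0.
  by apply/funext => x; rewrite big_nil.
have [Pi|nPi] := boolP (P i); last first.
  by under eq_fun do rewrite big_cons (negbTE nPi).
by under eq_fun do rewrite big_cons Pi; apply: cintegrableD => //; exact: H.
Qed.

Lemma cint0 D : cint D (fun=> 0) = 0 :> R[i].
Proof.
by apply: eq_ReIm; rewrite /= /Rintegral integral0.
Qed.

Lemma cint_sum D (I : Type) (r : seq I) (P : pred I)
    (F : I -> R -> R[i]) : measurable D ->
  (forall i, P i -> cintegrable D (F i)) ->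
  cint D (fun x => \sum_(i <- r | P i) F i x) =
  \sum_(i <- r | P i) cint D (F i).
Proof.
move=> mD H; elim: r => [|i r IH].
  by rewrite big_nil -[RHS](cint0 D); apply: eq_cint => x _; rewrite big_nil.
have [Pi|nPi] := boolP (P i); last first.
  rewrite big_cons (negbTE nPi) -IH; apply: eq_cint => x _.
  by rewrite big_cons (negbTE nPi).
rewrite big_cons Pi -IH -cintD//; [|exact: H|exact: cintegrable_sum].
by apply: eq_cint => x _; rewrite big_cons Pi.
Qed.

(* Rotating the integral onto the positive real axis reduces the bound to the
   one on real parts. *)
Lemma ler_cmod_cint D f G : measurable D -> cintegrable D f ->
  mu.-integrable D (EFin \o G) -> (forall x, D x -> cmod (f x) <= G x) ->
  cmod (cint D f) <= \int[mu]_(x in D) G x.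
Proof.
move=> mD fi iG H; set z := cint D f.
have [z0|z0] := eqVneq z 0.
  rewrite z0 cmod0; apply: Rintegral_ge0 => x Dx.
  exact: le_trans (cmod_ge0 _) (H x Dx).
pose c : R[i] := (cmod z)%:C / z.
have c1 : cmod c = 1.
  rewrite /c cmodM cmodV cmod_real ger0_norm ?cmod_ge0// divff//.
  by rewrite cmod_eq0.
have -> : cmod z = complex.Re (cint D (fun x => c * f x)).
  by rewrite cintZ// -/z /c divfK.
have [ci _] := cintegrableZ c mD fi.
apply: le_Rintegral => // x Dx.
rewrite (le_trans (ler_norm _))// (le_trans (ler_Re_cmod _))// cmodM c1 mul1r.
exact: H.
Qed.

Lemma ler_cmod_cint_cmod D f : measurable D -> cintegrable D f ->
  cmod (cint D f) <= \int[mu]_(x in D) cmod (f x).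
Proof. by move=> mD fi; apply: ler_cmod_cint => //; exact: cintegrable_cmod. Qed.

Lemma cint_setU D E f : measurable D -> measurable E ->
  cintegrable (D `|` E) f -> [disjoint D & E] ->
  cint (D `|` E) f = cint D f + cint E f.
Proof.
move=> mD mE [f1 f2] DE; apply: eq_ReIm; rewrite ?cReD ?cImD /=;
  exact: Rintegral_setU.
Qed.

(** Both components follow from one real statement about a projection [p] with |p z| <= |z|, so a
    single dominating function for the modulus serves for the two. *)
Lemma is_cderive_under_cint D (f df : R -> R -> R[i]) (G : R -> R) (a u v : R) :
  measurable D -> `]u, v[%classic a ->
  (forall x, `]u, v[%classic x -> cintegrable D (f x)) ->
  (forall x y, `]u, v[%classic x -> D y -> is_cderive (f^~ y) x (df x y)) ->
  mu.-integrable D (EFin \o G) ->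
  (forall x y, `]u, v[%classic x -> D y -> cmod (df x y) <= G y) ->
  is_cderive (fun x => cint D (f x)) a (cint D (df a)).
Proof.
move=> mD Ia fi fd iG H.
(* The real theorem wants a bound that is nonnegative everywhere, whereas [G] is compared with a
   modulus only on [D]. *)
pose G' y := `|G y|.
have G0 y : 0 <= G' y by exact: normr_ge0.
have iG' : mu.-integrable D (EFin \o G') by exact: integrable_norm.
have key (p : R[i] -> R) :
    (forall x, `]u, v[%classic x ->
       mu.-integrable D (EFin \o (fun y => p (f x y)))) ->
    (forall x y, `]u, v[%classic x -> D y ->
       is_derive x 1 (fun x => p (f x y)) (p (df x y))) ->
    (forall z, `|p z| <= cmod z) ->
    is_derive a 1 (fun x => \int[mu]_(y in D) p (f x y))
      (\int[mu]_(y in D) p (df a y)).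
  move=> pi pd pz.
  have dE x y : `]u, v[%classic x -> D y ->
      partial1of2 (fun x y => p (f x y)) x y = p (df x y).
    move=> Ix Dy; rewrite partial1of2E.
    by have := @derive_val _ _ _ _ _ _ _ (pd x y Ix Dy).
  have pd' x y : `]u, v[%classic x -> D y -> derivable (fun x => p (f x y)) x 1.
    by move=> Ix Dy; have := @ex_derive _ _ _ _ _ _ _ (pd x y Ix Dy).
  have bd x y : `]u, v[%classic x -> D y ->
      `|partial1of2 (fun x y => p (f x y)) x y| <= G' y.
    move=> Ix Dy; rewrite dE//; apply: le_trans (pz _) (le_trans (H _ _ Ix Dy) _).
    exact: ler_norm.
  apply: DeriveDef.
    exact: (@derivable_under_integral _ _ _ mu _ D mD a u v Ia pi pd' G' G0 iG' bd).
  rewrite -derive1E.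
  rewrite (@differentiation_under_integral _ _ _ mu _ D mD a u v Ia pi pd' G' G0 iG' bd).
  by apply: eq_Rintegral => y; rewrite inE => Dy; exact: dE.
split; apply: key.
- by move=> x Ix; have [] := fi x Ix.
- by move=> x y Ix Dy; have [] := fd x y Ix Dy.
- exact: ler_Re_cmod.
- by move=> x Ix; have [] := fi x Ix.
- by move=> x y Ix Dy; have [] := fd x y Ix Dy.
- exact: ler_Im_cmod.
Qed.

End ComplexIntegral.

(** * Rapidly decaying functions and Fourier inversion *)

Section AffineSubstitution.
Context {R : realType}.
Local Notation mu := (@lebesgue_measure R).
Variables (a b : R).
Hypothesis a0 : 0 < a.
Let F (x : R) : R := a * x + b.

Let measurable_F : measurable_fun setT F.
Proof.
apply: continuous_measurable_fun => x; apply: cvgD; last exact: cvg_cst.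
by apply: cvgM; [exact: cvg_cst|exact: cvg_id].
Qed.

(** The pushforward of Lebesgue measure under the affine map, scaled by [a], agrees with Lebesgue
    measure on half-open intervals, hence on all measurable sets by uniqueness. *)
Lemma lebesgue_measure_affine (A : set R) : measurable A ->
  mu (F @^-1` A) = ((a^-1)%:E * mu A)%E.
Proof.
move=> mA.
have a0' : 0 <= a by exact: ltW.
pose nu := mscale (NngNum a0') (pushforward mu (F : _ -> measurableTypeR R)).
have H X : ocitv X -> mu X = nu measurable_F X.
  move=> [[x y] _ <-] /=.
  rewrite /nu/= /mscale /= /pushforward /=.
  have -> : F @^-1` `]x, y]%classic = `](x - b) / a, (y - b) / a]%classic.
    apply/seteqP; split=> z /=; rewrite !in_itv/= /F ltr_pdivrMr// ler_pdivlMr//;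
    by rewrite ltrBlDr lerBrDr ![z * a]mulrC.
  rewrite !lebesgue_measure_itv/= !lte_fin ltr_pM2r ?invr_gt0// ltrD2r.
  case: ifPn => _; last by rewrite mule0.
  by rewrite -EFinB -!EFinM; congr EFin; field; rewrite gt_eqF.
have := @lebesgue_measure_unique _ (nu measurable_F) H A mA.
rewrite /nu /= /mscale /= /pushforward /= => ->.
by rewrite muleA -EFinM mulVf ?gt_eqF// mul1e.
Qed.

Lemma ge0_integral_affine (u : R -> \bar R) : measurable_fun setT u ->
  (forall x, 0 <= u x)%E ->
  (\int[mu]_x u (F x) = (a^-1)%:E * \int[mu]_x u x)%E.
Proof.
move=> mu_ u0.
have a0' : 0 <= a^-1 by rewrite invr_ge0 ltW.
have := @ge0_integral_pushforward _ _ _ _ R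
  (F : measurableTypeR R -> measurableTypeR R) measurable_F mu setT u measurableT mu_.
rewrite preimage_setT => <-; last by move=> x _; exact: u0.
rewrite -(@ge0_integral_mscale _ _ _ mu setT measurableT (NngNum a0'))//.
apply: eq_measure_integral => A mA _.
by rewrite /mscale/= /pushforward /= lebesgue_measure_affine.
Qed.

Lemma integrable_affine (u : R -> R) : mu.-integrable setT (EFin \o u) ->
  mu.-integrable setT (EFin \o (fun x => u (F x))).
Proof.
move=> /integrableP[mu_ uoo]; apply/integrableP; split.
  exact: (@measurableT_comp _ _ _ _ _ _ (EFin \o u) _ F).
rewrite (@ge0_integral_affine (fun x => `|(EFin \o u) x|)%E)//.
  by rewrite lte_mul_pinfty// ?lee_fin ?invr_ge0 ?ltW.
exact: measurableT_comp.
Qed.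

Lemma Rintegral_affine (u : R -> R) : mu.-integrable setT (EFin \o u) ->
  \int[mu]_x u (F x) = a^-1 * \int[mu]_x u x.
Proof.
move=> ui; have mu_ : measurable_fun setT (EFin \o u) by have /integrableP[] := ui.
rewrite /Rintegral integralE.
have E1 : (\int[mu]_x (fun x => (u (F x))%:E)^\+ x =
    (a^-1)%:E * \int[mu]_x (EFin \o u)^\+ x)%E.
  rewrite -ge0_integral_affine; last by move=> x; exact: funepos_ge0.
    by apply: eq_integral => x _; rewrite ?funeposE ?funenegE.
  exact: measurable_funepos.
have E2 : (\int[mu]_x (fun x => (u (F x))%:E)^\- x =
    (a^-1)%:E * \int[mu]_x (EFin \o u)^\- x)%E.
  rewrite -ge0_integral_affine; last by move=> x; exact: funeneg_ge0.
    by apply: eq_integral => x _; rewrite ?funeposE ?funenegE.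
  exact: measurable_funeneg.
rewrite E1 E2 -muleBr//; last first.
  apply: fin_num_adde_defr.
  exact: (@integrable_pos_fin_num _ _ _ mu setT measurableT).
by rewrite -integralE fineM//; exact: integrable_fin_num.
Qed.

Lemma Rintegral_affine_set (D : set R) (u : R -> R) : measurable D ->
  mu.-integrable D (EFin \o u) ->
  \int[mu]_(x in F @^-1` D) u (F x) = a^-1 * \int[mu]_(x in D) u x.
Proof.
move=> mD ui; rewrite Rintegral_mkcond [in RHS]Rintegral_mkcond.
rewrite -Rintegral_affine; last first.
  by rewrite -restrict_EFin; apply/(@integrable_mkcond _ _ _ mu D _ mD).
apply: eq_Rintegral => x _; rewrite /patch.
have [h|h] := boolP (F x \in D).
  by rewrite mem_set//=; move: h; rewrite inE.
by rewrite ifN// notin_setE/= => /mem_set; apply/negP.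
Qed.

End AffineSubstitution.

(** * Integrals over the whole line *)

Section RealLine.
Context {R : realType}.
Local Notation mu := (@lebesgue_measure R).

Lemma cvg_Rintegral_itv (v : R -> R) : mu.-integrable setT (EFin \o v) ->
  \int[mu]_(x in `[- n%:R, n%:R]) v x @[n --> \oo] --> \int[mu]_x v x.
Proof.
move=> vi.
have mv : measurable_fun setT v by have /measurable_int/measurable_EFinP := vi.
pose f n := EFin \o (v \_ `[- n%:R, n%:R]) : R -> \bar R.
have := @dominated_convergence _ _ _ mu setT measurableT f (EFin \o v)
  (EFin \o (fun x => `|v x|)).
case.
- move=> n; apply/measurable_EFinP; apply/(measurable_restrictT _ _).1 => //.
  exact: measurable_funTS.
- exact/measurable_EFinP.
- apply: aeW => x _; apply: cvg_near_cst; near=> n.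
  rewrite /f /= patchE mem_set//= in_itv/= -ler_norml.
  near: n; exact: nbhs_infty_ger.
- exact: integrable_norm.
- apply: aeW => x n _; rewrite /f /= lee_fin patchE.
  by case: ifPn => // _; rewrite normr0.
move=> _ _ H.
pose I n : set R := `[- n%:R, n%:R]%classic.
have iE n : (\int[mu]_x f n x = \int[mu]_(x in I n) (v x)%:E)%E.
  rewrite [RHS]integral_mkcond; apply: eq_integral => x _.
  by rewrite /f restrict_EFin.
apply: (@fine_cvg _ _ _ _ (fun n => \int[mu]_(x in I n) (v x)%:E)%E).
rewrite /Rintegral fineK; last exact: integrable_fin_num.
by move: H; under eq_fun do rewrite /= iE.
Unshelve. all: end_near. Qed.

(** The fundamental theorem is applied on [-n, n]; since [v] is integrable, these integrals converge
    to the one over the line. *)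
Lemma Rintegral_derive (u v : R -> R) (l : R) :
  (forall x : R, is_derive x 1 u (v x)) -> continuous v ->
  mu.-integrable setT (EFin \o v) ->
  (u n%:R - u (- n%:R)) @[n --> \oo] --> l ->
  \int[mu]_x v x = l.
Proof.
move=> uv cv vi ul.
apply: (cvg_unique _ (cvg_Rintegral_itv vi)); first exact: Rhausdorff.
apply: cvg_trans ul; apply: near_eq_cvg; near=> n.
have n0 : - n%:R < n%:R :> R.
  by rewrite -subr_gt0 opprK addr_gt0// ltr0n; near: n; exists 1%N.
have cu : continuous u.
  move=> x; apply/differentiable_continuous/derivable1_diffP.
  by have := @ex_derive _ _ _ _ _ _ _ (uv x).
rewrite /Rintegral (@continuous_FTC2 _ v u _ _ n0)//.
- exact: continuous_subspaceT.
- split.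
  + by move=> x _; have := @ex_derive _ _ _ _ _ _ _ (uv x).
  + by apply: cvg_at_right_filter; exact: cu.
  + by apply: cvg_at_left_filter; exact: cu.
- move=> x _; rewrite derive1E.
  by have := @derive_val _ _ _ _ _ _ _ (uv x).
Unshelve. all: end_near. Qed.

(** The primitive [atan] is bounded. This function is the model for the dominating functions of the
    decay arguments. *)
Lemma integrable_oneDsqrV :
  mu.-integrable setT (EFin \o (fun x : R => (1 + x ^+ 2)^-1)).
Proof.
have pos (x : R) : 0 < 1 + x ^+ 2 by rewrite ltr_wpDr// sqr_ge0.
have cf : continuous (fun x : R => (1 + x ^+ 2)^-1).
  move=> x; apply: cvgV; first by rewrite gt_eqF.
  apply: cvgD; first exact: cvg_cst.
  exact: exprn_continuous.
have ge0 (x : R) : 0 <= (1 + x ^+ 2)^-1 by rewrite invr_ge0 ltW.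
apply/integrableP; split.
  by apply/measurable_EFinP; exact: continuous_measurable_fun.
under eq_integral do rewrite /= ger0_norm//.
rewrite ge0_symfun_integralT//; last by move=> x /=; rewrite sqrrN.
rewrite (_ : [set x | _] = `[0, +oo[%classic); last first.
  by apply/seteqP; split=> x /=; rewrite in_itv/= andbT.
rewrite (@ge0_continuous_FTC2y _ _ atan 0 (pi / 2))//.
- by rewrite -EFinB lte_mul_pinfty ?ltry// lee_fin.
- exact: continuous_subspaceT.
- exact: cvgy_atan.
- by apply: cvg_at_right_filter; exact: continuous_atan.
- move=> x _; rewrite derive1E.
  exact: derive_val.
Qed.

End RealLine.

Section Continuity.
Context {R : realType}.
Implicit Types (f g : R -> R[i]) (u : R -> R).

Lemma ccontinuous_cst (c : R[i]) : ccontinuous (fun=> c : R[i]).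
Proof. by split=> x; exact: cvg_cst. Qed.

Lemma ccontinuousD f g : ccontinuous f -> ccontinuous g ->
  ccontinuous (fun x => f x + g x).
Proof.
move=> [f1 f2] [g1 g2]; split=> x.
  under eq_fun do rewrite cReD.
  by apply: cvgD; [exact: f1|exact: g1].
under eq_fun do rewrite cImD.
by apply: cvgD; [exact: f2|exact: g2].
Qed.

Lemma ccontinuousM f g : ccontinuous f -> ccontinuous g ->
  ccontinuous (fun x => f x * g x).
Proof.
move=> [f1 f2] [g1 g2]; split=> x.
  under eq_fun do rewrite cReM.
  apply: cvgB; apply: cvgM;
    by [exact: f1|exact: g1|exact: f2|exact: g2].
under eq_fun do rewrite cImM.
apply: cvgD; apply: cvgM;
  by [exact: f1|exact: g1|exact: f2|exact: g2].
Qed.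

Lemma ccontinuous_comp f u : ccontinuous f -> continuous u ->
  ccontinuous (fun x => f (u x)).
Proof.
move=> [f1 f2] cu; split=> x.
  by apply: (@continuous_comp _ _ _ u (fun y => complex.Re (f y)) x);
    [exact: cu|exact: f1].
by apply: (@continuous_comp _ _ _ u (fun y => complex.Im (f y)) x);
    [exact: cu|exact: f2].
Qed.

Lemma ccontinuous_real u : continuous u -> ccontinuous (fun x => (u x)%:C).
Proof. by move=> cu; split=> // x; exact: cvg_cst. Qed.

Lemma ccontinuous_cexpi u : continuous u -> ccontinuous (fun x => cexpi (u x)).
Proof.
move=> cu; split=> x.
  by apply: (@continuous_comp _ _ _ u cos x);
    [exact: cu|exact: continuous_cos].
by apply: (@continuous_comp _ _ _ u sin x);
    [exact: cu|exact: continuous_sin].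
Qed.

Lemma continuous_affine (a b : R) : continuous (fun x : R => a * x + b).
Proof.
move=> x; apply: cvgD; last exact: cvg_cst.
by apply: cvgM; [exact: cvg_cst|exact: cvg_id].
Qed.

Lemma is_derive_affine (a b x : R) : is_derive x 1 (fun y : R => a * y + b) a.
Proof.
rewrite (_ : (fun _ => _) = a *: (id : R -> R) + cst b).
  by apply: is_derive_eq; rewrite addr0 /GRing.scale /= mulr1.
by apply/funext.
Qed.

End Continuity.

(** * Functions of rapid decay and their multipliers *)

Section Decay.
Context {R : realType}.
Implicit Types (f g p q : R -> R[i]).

(** The Schwartz class without smoothness: derivatives are supplied separately where they are
    needed. The weight 1 + |x| is at least 1, so one bound also controls the function near 0 and
    lower powers are free. *)
Definition decays f : Prop := ccontinuous f /\
  forall m : nat, exists M : R, forall x, (1 + `|x|) ^+ m * cmod (f x) <= M.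

(** Multipliers of [decays]: signals, chirps, oscillating exponentials and polynomials all belong
    here. *)
Definition polybounded p : Prop := ccontinuous p /\
  exists (m : nat) (M : R), forall x, cmod (p x) <= M * (1 + `|x|) ^+ m.

Let w1 (x : R) : 1 <= 1 + `|x|. Proof. by rewrite lerDl. Qed.

Let wX1 (x : R) n : 1 <= (1 + `|x|) ^+ n. Proof. exact: exprn_ege1. Qed.

Lemma polybounded_ge0 p : polybounded p -> exists (m : nat) (M : R),
  0 <= M /\ forall x, cmod (p x) <= M * (1 + `|x|) ^+ m.
Proof.
move=> [_ [m [M H]]]; exists m, M; split => //.
have := le_trans (cmod_ge0 _) (H 0).
by rewrite pmulr_lge0.
Qed.

Lemma decays_bound f m : decays f ->
  exists2 M : R, 0 <= M & forall x, (1 + `|x|) ^+ m * cmod (f x) <= M.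
Proof.
move=> [_ /(_ m)[M H]]; exists M => //.
by apply: le_trans (H 0); rewrite mulr_ge0 ?cmod_ge0// ltW.
Qed.

Lemma polybounded_bounded p (M : R) : ccontinuous p ->
  (forall x, cmod (p x) <= M) -> polybounded p.
Proof. by move=> cp H; split=> //; exists 0%N, M => x; rewrite expr0 mulr1. Qed.

Lemma polybounded_cst (c : R[i]) : polybounded (fun=> c).
Proof.
by apply: (@polybounded_bounded _ (cmod c)) => //; exact: ccontinuous_cst.
Qed.

Lemma polyboundedM p q : polybounded p -> polybounded q ->
  polybounded (fun x => p x * q x).
Proof.
move=> pp pq; split.
  by apply: ccontinuousM; [case: pp|case: pq].
have [m [M [M0 H]]] := polybounded_ge0 pp.
have [n [N [N0 H']]] := polybounded_ge0 pq.
exists (m + n)%N, (M * N) => x; rewrite cmodM exprD mulrACA.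
by apply: ler_pM; rewrite ?cmod_ge0.
Qed.

Lemma polyboundedD p q : polybounded p -> polybounded q ->
  polybounded (fun x => p x + q x).
Proof.
move=> pp pq; split.
  by apply: ccontinuousD; [case: pp|case: pq].
have [m [M [M0 H]]] := polybounded_ge0 pp.
have [n [N [N0 H']]] := polybounded_ge0 pq.
exists (m + n)%N, (M + N) => x; rewrite (le_trans (ler_cmodD _ _))// mulrDl.
apply: lerD; (apply: le_trans; first by [exact: H|exact: H']);
  rewrite ler_wpM2l// exprD ?ler_peMr// ?ler_peMl// ltW//.
Qed.

Lemma polybounded_id : polybounded (fun x => x%:C).
Proof.
split; first by apply: ccontinuous_real => x; exact: cvg_id.
exists 1%N, 1 => x; rewrite cmod_real mul1r expr1.
by rewrite lerDr.
Qed.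

Lemma polybounded_cexpi (u : R -> R) : continuous u ->
  polybounded (fun x => cexpi (u x)).
Proof.
move=> cu; apply: (@polybounded_bounded _ 1); first exact: ccontinuous_cexpi.
by move=> x; rewrite cmod_cexpi.
Qed.

Lemma decays_polyM p f : polybounded p -> decays f ->
  decays (fun x => p x * f x).
Proof.
move=> pp df; split.
  by apply: ccontinuousM; [case: pp|case: df].
move=> m; have [n [M [M0 H]]] := polybounded_ge0 pp.
have [N N0 H'] := decays_bound (m + n) df.
exists (M * N) => x; rewrite cmodM.
apply: (@le_trans _ _ ((1 + `|x|) ^+ m * ((M * (1 + `|x|) ^+ n) * cmod (f x)))).
  apply: ler_wpM2l; first exact: ltW.
  by apply: ler_wpM2r => //; exact: cmod_ge0.
have -> : (1 + `|x|) ^+ m * (M * (1 + `|x|) ^+ n * cmod (f x)) =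
    M * ((1 + `|x|) ^+ (m + n) * cmod (f x)) by rewrite exprD; ring.
by rewrite ler_wpM2l.
Qed.

Lemma decaysZ (c : R[i]) f : decays f -> decays (fun x => c * f x).
Proof. exact: decays_polyM (polybounded_cst c). Qed.

Lemma decays_polyMr p f : polybounded p -> decays f ->
  decays (fun x => f x * p x).
Proof.
move=> pp df; under eq_fun do rewrite mulrC; exact: decays_polyM.
Qed.

Lemma decaysD f g : decays f -> decays g -> decays (fun x => f x + g x).
Proof.
move=> df dg; split.
  by apply: ccontinuousD; [case: df|case: dg].
move=> m; have [_ /(_ m)[M H]] := df; have [_ /(_ m)[N H']] := dg.
exists (M + N) => x; apply: le_trans (lerD (H x) (H' x)).
by rewrite -mulrDr ler_wpM2l ?ler_cmodD// ltW.
Qed.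

Lemma decaysB f g : decays f -> decays g -> decays (fun x => f x - g x).
Proof.
move=> df dg; apply: decaysD => //.
by under eq_fun do rewrite -mulN1r; exact: decaysZ.
Qed.

(** Since 1 + |x| <= (1 + s) (1 + |x/s|), the constant of order m is multiplied by (1 + s)^m. *)
Lemma decays_dilate f (s : R) : 0 < s -> decays f ->
  decays (fun x => f (x / s)).
Proof.
move=> s0 df; split.
  apply: ccontinuous_comp; first by case: df.
  by move=> x; apply: cvgM; [exact: cvg_id|exact: cvg_cst].
move=> m; have [M M0 H] := decays_bound m df.
exists ((1 + s) ^+ m * M) => x.
apply: (@le_trans _ _ ((1 + s) ^+ m * ((1 + `|x / s|) ^+ m * cmod (f (x / s))))).
  rewrite mulrA ler_wpM2r ?cmod_ge0// -exprMn lerXn2r ?nnegrE//.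
  - by rewrite mulr_ge0 ?addr_ge0// ltW.
  - rewrite normrM normfV (gtr0_norm s0).
    have -> : (1 + s) * (1 + `|x| / s) = 1 + s + `|x| / s + `|x|.
      by field; rewrite gt_eqF.
    have : 0 <= `|x| / s by rewrite divr_ge0// ltW.
    lra.
by rewrite ler_wpM2l// exprn_ge0// addr_ge0// ltW.
Qed.

Lemma decays_integrable f : decays f -> cintegrable setT f.
Proof.
move=> df; have [M M0 H] := decays_bound 2 df.
apply: (@cintegrable_dominated _ _ _ (fun x => M * (1 + x ^+ 2)^-1)) => //.
- by apply: ccontinuous_measurable => //; case: df.
- by apply: integrableZl_fin => //; exact: integrable_oneDsqrV.
- move=> x _; have p : 0 < 1 + x ^+ 2 by rewrite ltr_wpDr// sqr_ge0.
  rewrite ler_pdivlMr// mulrC; apply: le_trans (H x).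
  rewrite ler_wpM2r ?cmod_ge0// sqrrD -(real_normK (num_real x)) expr1n.
  by rewrite mul1r addrAC lerDl mulrn_wge0.
Qed.

(** The threshold is a natural number and the condition is on |x|, so that both endpoints of [-n, n]
    are covered at once. *)
Lemma decays_cvg0 f : decays f -> forall e, 0 < e ->
  exists N : nat, forall x, N%:R <= `|x| -> cmod (f x) <= e.
Proof.
move=> df e e0; have [M M0 H] := decays_bound 1 df.
exists (Num.truncn (M / e)).+1 => x xN.
have := H x; rewrite expr1 => Hx.
have p : M / e <= 1 + `|x|.
  rewrite (le_trans (ltW (truncnS_gt _)))// (le_trans xN)//.
  by rewrite lerDr.
rewrite -(@ler_pM2l _ (1 + `|x|))//; apply: le_trans Hx _.
by rewrite -ler_pdivrMr.
Qed.

(** The primitive vanishes at both ends. Its decay is asked only in epsilon form because [F] will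
    also be a Fourier transform, for which the Riemann-Lebesgue lemma provides no rate. *)
Lemma cint_derive_decays F f : (forall x, is_cderive F x (f x)) ->
  ccontinuous f -> cintegrable setT f ->
  (forall e, 0 < e ->
    exists N : nat, forall x, N%:R <= `|x| -> cmod (F x) <= e) ->
  cint setT f = 0.
Proof.
move=> Ff [cf1 cf2] [fi1 fi2] HF.
have key (q : R[i] -> R) : (forall z, `|q z| <= cmod z) ->
    q (F n%:R) - q (F (- n%:R)) @[n --> \oo] --> (0 : R).
  move=> qz; apply/cvgrPdist_le => e e0.
  have e20 : 0 < e / 2 by rewrite divr_gt0.
  have [N HN] := HF _ e20.
  near=> n; rewrite sub0r normrN.
  have Nn : N%:R <= n%:R :> R by rewrite ler_nat; near: n; exact: nbhs_infty_ge.
  rewrite (le_trans (ler_normB _ _))// [e]splitr lerD//.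
    by rewrite (le_trans (qz _))// HN// ger0_norm.
  by rewrite (le_trans (qz _))// HN// normrN ger0_norm.
apply: eq_ReIm => /=.
- apply: (@Rintegral_derive _ (fun x => complex.Re (F x))) => //.
    by move=> x; have [] := Ff x.
  exact/key/ler_Re_cmod.
- apply: (@Rintegral_derive _ (fun x => complex.Im (F x))) => //.
    by move=> x; have [] := Ff x.
  exact/key/ler_Im_cmod.
Unshelve. all: end_near. Qed.

End Decay.

Section PowerBound.
Context {R : realType}.

(** For x > 0 the function C/(n+1) x^(n+1) - u(x) vanishes at 0 and has nonnegative derivative; the
    same holds for -u and for the reflections of u and -u, which yields the modulus and the negative
    half-line. Iterated, this gives the Taylor estimates and the bounds on sine and cosine. *)
Lemma ler_norm_derive_pow (u du : R -> R) (C : R) (n : nat) :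
  (forall x : R, is_derive x 1 u (du x)) -> u 0 = 0 ->
  (forall x, `|du x| <= C * `|x| ^+ n) ->
  forall x, `|u x| <= C / n.+1%:R * `|x| ^+ n.+1.
Proof.
have pos (v dv : R -> R) : (forall x : R, is_derive x 1 v (dv x)) -> v 0 = 0 ->
    (forall x, `|dv x| <= C * `|x| ^+ n) ->
    forall x, 0 < x -> v x <= C / n.+1%:R * x ^+ n.+1.
  move=> vdv v0 dvC x x0.
  pose w : R -> R := (fun y => C / n.+1%:R * y ^+ n.+1 - v y).
  have dw (z : R) : is_derive z 1 w (C * z ^+ n - dv z).
    rewrite (_ : w = (C / n.+1%:R) *: ((id : R -> R) ^+ n.+1) - v); last first.
      by apply/funext => y; rewrite !fctE.
    apply: is_derive_eq; rewrite /GRing.scale /= mulr1; congr (_ - _).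
    by rewrite mulrA divfK// pnatr_eq0.
  have cw : {within `[0, x], continuous w}.
    apply: derivable_within_continuous => y _.
    by have := @ex_derive _ _ _ _ _ _ _ (dw y).
  have [c] := MVT x0 (fun y _ => dw y) cw.
  rewrite in_itv/= => /andP[c0 cx].
  have -> : w 0 = 0 by rewrite /w expr0n/= mulr0 v0 subrr.
  rewrite !subr0 => wx.
  have : 0 <= w x.
    rewrite wx; apply: mulr_ge0; last exact: ltW.
    rewrite subr_ge0.
    by rewrite (le_trans (ler_norm _))// (le_trans (dvC _))// gtr0_norm.
  by rewrite /w subr_ge0.
move=> udu u0 duC.
have key (x : R) : 0 < x -> `|u x| <= C / n.+1%:R * x ^+ n.+1.
  move=> x0; rewrite ler_norml; apply/andP; split; last exact: pos.
  rewrite lerNl; apply: (pos (fun y => - u y) (fun y => - du y)) => //.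
  - by rewrite u0 oppr0.
  - by move=> y; rewrite normrN.
move=> x; have [x0|x0|->] := ltgtP x 0; last first.
- by rewrite u0 normr0 expr0n mulr0.
- by rewrite (gtr0_norm x0); exact: key.
have keyN (y : R) : 0 < y -> `|u (- y)| <= C / n.+1%:R * y ^+ n.+1.
  have dN (z : R) : is_derive z 1 (fun y => u (- y)) (- du (- z)).
    have dn : is_derive z 1 (fun y : R => - y) (-1).
      by apply: is_deriveN.
    have := is_derive1_comp (udu (- z)) dn.
    by move/is_derive_eq; apply; rewrite mulrN1.
  move=> y0; rewrite ler_norml; apply/andP; split.
    rewrite lerNl; apply: (pos (fun y => - u (- y)) (fun y => du (- y))) => //.
    - by move=> z; have := is_deriveN (dN z); rewrite opprK.
    - by rewrite oppr0 u0 oppr0.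
    - by move=> z; rewrite -[in X in _ <= X](normrN z).
  apply: (pos (fun y => u (- y)) (fun y => - du (- y))) => //.
  - by rewrite oppr0.
  - by move=> z; rewrite normrN -[in X in _ <= X](normrN z).
by rewrite (ltr0_norm x0) -{1}[x]opprK; apply: keyN; rewrite oppr_gt0.
Qed.

End PowerBound.

(** * The Fourier transform of decaying functions *)

Section Fourier.
Context {R : realType}.
Local Notation mu := (@lebesgue_measure R).
Implicit Types (f g : R -> R[i]) (xi : R).

Lemma continuous_wave xi : continuous (fun tau => - (2 * pi * xi * tau) : R).
Proof.
move=> x; rewrite (_ : (fun _ => _) = (fun y : R => - (2 * pi * xi) * y + 0)).
  exact: continuous_affine.
by apply/funext => y; rewrite addr0 mulNr.
Qed.

Lemma decays_wave f xi : decays f ->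
  decays (fun tau => f tau * cexpi (- (2 * pi * xi * tau))).
Proof.
by move=> df; apply: decays_polyMr => //; apply/polybounded_cexpi/continuous_wave.
Qed.

Lemma eq_fourier f g xi : f =1 g -> fourier f xi = fourier g xi.
Proof. by move=> fg; apply: eq_cint => x _; rewrite fg. Qed.

Lemma fourierD f g xi : decays f -> decays g ->
  fourier (fun tau => f tau + g tau) xi = fourier f xi + fourier g xi.
Proof.
move=> df dg; rewrite /fourier -cintD//; last 2 first.
- by apply: decays_integrable; exact: decays_wave.
- by apply: decays_integrable; exact: decays_wave.
by apply: eq_cint => x _; rewrite mulrDl.
Qed.

Lemma fourierB f g xi : decays f -> decays g ->
  fourier (fun tau => f tau - g tau) xi = fourier f xi - fourier g xi.
Proof.
move=> df dg; rewrite /fourier -cintB//; last 2 first.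
- by apply: decays_integrable; exact: decays_wave.
- by apply: decays_integrable; exact: decays_wave.
by apply: eq_cint => x _; rewrite mulrBl.
Qed.

Lemma fourierZ f (c : R[i]) xi : decays f ->
  fourier (fun tau => c * f tau) xi = c * fourier f xi.
Proof.
move=> df; rewrite /fourier -cintZ//; last first.
  by apply: decays_integrable; exact: decays_wave.
by apply: eq_cint => x _; rewrite mulrA.
Qed.

Lemma fourier_sum (I : Type) (r : seq I) (F : I -> R -> R[i]) xi :
  (forall i, decays (F i)) ->
  fourier (fun tau => \sum_(i <- r) F i tau) xi =
  \sum_(i <- r) fourier (F i) xi.
Proof.
move=> H; rewrite /fourier -cint_sum//; last first.
  by move=> i _; apply: decays_integrable; exact: decays_wave.
by apply: eq_cint => x _; rewrite mulr_suml.
Qed.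

Lemma ler_cmod_fourier f (G : R -> R) xi : decays f ->
  mu.-integrable setT (EFin \o G) -> (forall x, cmod (f x) <= G x) ->
  cmod (fourier f xi) <= \int[mu]_x G x.
Proof.
move=> df iG H; apply: ler_cmod_cint => //.
  by apply: decays_integrable; exact: decays_wave.
by move=> x _; rewrite cmodM cmod_cexpi mulr1.
Qed.

Lemma is_cderive_fourier f xi : decays f ->
  is_cderive (fourier f) xi (- i2pi * fourier (fun tau => tau%:C * f tau) xi).
Proof.
move=> df.
have dtf : decays (fun tau => tau%:C * f tau).
  exact: decays_polyM polybounded_id df.
have Ia : `]xi - 1, xi + 1[%classic xi.
  by rewrite /= in_itv/= ltrBlDr !ltrDl ltr01.
have := @is_cderive_under_cint R setT
  (fun x y => f y * cexpi (- (2 * pi * x * y)))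
  (fun x y => - i2pi * (y%:C * f y) * cexpi (- (2 * pi * x * y)))
  (fun y => 2 * pi * cmod (y%:C * f y)) _ _ _ measurableT Ia.
move=> /(_ _ _ _ _)/is_cderive_eq; apply.
- by move=> x _; apply: decays_integrable; exact: decays_wave.
- move=> x y _ _.
  have du : is_derive x 1 (fun z => - (2 * pi * z * y)) (- (2 * pi * y)).
    rewrite (_ : (fun _ => _) = (fun z : R => (- (2 * pi * y)) * z + 0)).
      exact: is_derive_affine.
    by apply/funext => z; ring.
  have := is_cderiveZ (f y) (is_cderive_cexpi du).
  move/is_cderive_eq; apply.
  by rewrite i2piE !(real_complexN, real_complexM) real_complex_nat; ring.
- apply: integrableZl_fin => //; apply: cintegrable_cmod => //.
  exact: decays_integrable.
- by move=> x y _ _; rewrite !cmodM cmodN cmod_i2pi cmod_cexpi mulr1.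
- rewrite -fourierZ//; apply: eq_fourier => y; ring.
Qed.

Lemma fourier_ccontinuous f : decays f -> ccontinuous (fourier f).
Proof.
by move=> df; apply: is_cderive_ccontinuous => xi; exact: is_cderive_fourier.
Qed.

(** Integration by parts without boundary terms: the derivative [F'] of f times the wave has
    integral 0, and its two summands are the two sides of the identity. *)
Lemma fourier_derive f df xi : decays f -> decays df ->
  (forall x, is_cderive f x (df x)) ->
  fourier df xi = i2pi * xi%:C * fourier f xi.
Proof.
move=> cf cdf fdf.
pose F x := f x * cexpi (- (2 * pi * xi * x)).
pose F' x := df x * cexpi (- (2 * pi * xi * x)) -
  (i2pi * xi%:C) * (f x * cexpi (- (2 * pi * xi * x))).
have FF' x : is_cderive F x (F' x).
  have du : is_derive x 1 (fun z => - (2 * pi * xi * z)) (- (2 * pi * xi)).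
    rewrite (_ : (fun _ => _) = (fun z : R => (- (2 * pi * xi)) * z + 0)).
      exact: is_derive_affine.
    by apply/funext => z; ring.
  have := is_cderiveM (fdf x) (is_cderive_cexpi du).
  move/is_cderive_eq; apply.
  by rewrite /F' i2piE !(real_complexN, real_complexM) real_complex_nat; ring.
have dF' : decays F'.
  by apply: decaysB; [exact: decays_wave|apply: decaysZ; exact: decays_wave].
have : cint setT F' = 0.
  apply: (cint_derive_decays FF'); first by case: dF'.
    exact: decays_integrable.
  exact: decays_cvg0 (decays_wave _ cf).
have iw h : decays h ->
    cintegrable setT (fun tau => h tau * cexpi (- (2 * pi * xi * tau))).
  by move=> dh; apply: decays_integrable; exact: decays_wave.
rewrite /F' cintB//; [|exact: iw|by apply: cintegrableZ => //; exact: iw].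
by rewrite cintZ//; [move/eqP; rewrite subr_eq0 => /eqP|exact: iw].
Qed.

(** The transform is bounded by the L^1 norm of f, and (2 pi xi)^2 times the transform by that of
    f''. The factor (2 pi)^2 >= 1 is dropped and the two bounds are added. *)
Lemma fourier_decay2 f df ddf : decays f -> decays df -> decays ddf ->
  (forall x, is_cderive f x (df x)) -> (forall x, is_cderive df x (ddf x)) ->
  exists2 M : R, 0 <= M & forall xi, cmod (fourier f xi) <= M * (1 + xi ^+ 2)^-1.
Proof.
move=> cf cdf cddf fdf dfddf.
pose M1 := \int[mu]_x cmod (f x); pose M2 := \int[mu]_x cmod (ddf x).
have M10 : 0 <= M1 by apply: Rintegral_ge0 => x _; exact: cmod_ge0.
have M20 : 0 <= M2 by apply: Rintegral_ge0 => x _; exact: cmod_ge0.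
have H1 xi : cmod (fourier f xi) <= M1.
  apply: ler_cmod_fourier => //; apply: cintegrable_cmod => //.
  exact: decays_integrable.
have H2 xi : cmod (fourier ddf xi) <= M2.
  apply: ler_cmod_fourier => //; apply: cintegrable_cmod => //.
  exact: decays_integrable.
exists (M1 + M2) => [|xi]; first exact: addr_ge0.
have p : 0 < 1 + xi ^+ 2 by rewrite ltr_wpDr// sqr_ge0.
rewrite ler_pdivlMr// mulrDr mulr1; apply: lerD; first exact: H1.
apply: le_trans (H2 xi).
rewrite (fourier_derive _ cdf cddf dfddf) (fourier_derive _ cf cdf fdf).
rewrite !cmodM cmod_i2pi cmod_real.
have -> : 2 * pi * `|xi| * (2 * pi * `|xi| * cmod (fourier f xi)) =
  (2 * pi) ^+ 2 * (cmod (fourier f xi) * `|xi| ^+ 2) by ring.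
rewrite real_normK ?num_real//; apply: ler_peMl.
  by rewrite mulr_ge0 ?cmod_ge0 ?sqr_ge0.
by apply: exprn_ege1; have := pi_ge2 R; lra.
Qed.

Lemma fourier_integrable f df ddf : decays f -> decays df -> decays ddf ->
  (forall x, is_cderive f x (df x)) -> (forall x, is_cderive df x (ddf x)) ->
  cintegrable setT (fourier f).
Proof.
move=> cf cdf cddf fdf dfddf.
have [M M0 H] := fourier_decay2 cf cdf cddf fdf dfddf.
apply: (@cintegrable_dominated _ _ _ (fun x => M * (1 + x ^+ 2)^-1)) => //.
- by apply: ccontinuous_measurable => //; exact: fourier_ccontinuous.
- by apply: integrableZl_fin => //; exact: integrable_oneDsqrV.
Qed.

End Fourier.

Arguments cmod : simpl never.
Arguments cint : simpl never.

(** * The Gaussian and the Riemann-Lebesgue lemma *)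

Section Inversion.
Context {R : realType}.
Local Notation mu := (@lebesgue_measure R).
Implicit Types (f g : R -> R[i]) (xi : R).

Definition gaussian (x : R) : R[i] := (expR (- (pi * x ^+ 2)))%:C.

Lemma is_derive_sqr (c x : R) :
  is_derive x 1 (fun y : R => c * y ^+ 2) (2 * c * x).
Proof.
rewrite (_ : (fun _ => _) = c *: ((id : R -> R) * (id : R -> R))).
  by apply: is_derive_eq; rewrite /GRing.scale /=; ring.
by apply/funext => y; rewrite !fctE /GRing.scale /= expr2.
Qed.

Lemma is_cderive_expR_sqr (c x : R) :
  is_cderive (fun y => (expR (c * y ^+ 2))%:C) x
    ((2 * c * x)%:C * (expR (c * x ^+ 2))%:C).
Proof.
rewrite -real_complexM; apply: is_cderive_real.
have := @is_derive1_comp _ expR (fun y => c * y ^+ 2) x _ _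
  (is_derive_expR (c * x ^+ 2)) (is_derive_sqr c x).
by move/is_derive_eq; apply; rewrite mulrC.
Qed.

Lemma is_cderive_gaussian x :
  is_cderive gaussian x ((- (2 * pi))%:C * (x%:C * gaussian x)).
Proof.
have := is_cderive_expR_sqr (- pi) x.
rewrite /gaussian; under eq_fun do rewrite mulNr.
move/is_cderive_eq; apply.
rewrite [RHS]mulrA -[in RHS]real_complexM.
by congr ((_)%:C * (expR _)%:C); ring.
Qed.

(** After taking m-th roots it suffices that 1 + |x| <= 2 m exp(pi x^2 / m), which follows from exp
    y >= 1 + y. The exponent is m = n + 1 so that division by m is legitimate for n = 0 too. *)
Lemma decays_gaussian : decays gaussian.
Proof.
split; first exact: is_cderive_ccontinuous is_cderive_gaussian.
move=> n; pose m := n.+1; exists ((2 * m%:R) ^+ m) => x.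
have m1 : 1 <= m%:R :> R by rewrite ler1n.
have m0 : 0 < m%:R :> R by rewrite ltr0n.
have x2 : 0 <= x ^+ 2 by exact: sqr_ge0.
rewrite /gaussian cmod_real (ger0_norm (expR_ge0 _)) expRN.
rewrite ler_pdivrMr ?expR_gt0//.
apply: (@le_trans _ _ ((1 + `|x|) ^+ m)).
  by rewrite ler_weXn2l ?lerDl.
have -> : expR (pi * x ^+ 2) = expR (pi * x ^+ 2 / m%:R) ^+ m.
  by rewrite -expRM_natl; congr expR; field; rewrite gt_eqF.
rewrite -exprMn; apply: lerXn2r; rewrite ?nnegrE ?addr_ge0//.
apply: (@le_trans _ _ (2 * m%:R * (1 + pi * x ^+ 2 / m%:R))); last first.
  by apply: ler_wpM2l; [rewrite mulr_ge0|exact: expR_ge1Dx].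
have -> : 2 * m%:R * (1 + pi * x ^+ 2 / m%:R) = 2 * m%:R + 2 * pi * x ^+ 2.
  by field; rewrite gt_eqF.
have h1 : `|x| <= 1 + x ^+ 2.
  rewrite -(real_normK (num_real x)).
  have : 0 <= (`|x| - 1) ^+ 2 by exact: sqr_ge0.
  have : 0 <= `|x| by [].
  by rewrite sqrrB; nra.
have := pi_ge2 R; nra.
Qed.

(** The transform solves the same equation y' = -2 pi x y as the Gaussian, so its product [Q] with
    exp(pi x^2) is constant; the constant is the Gaussian integral, rescaled by sqrt(pi). *)
Lemma fourier_gaussian xi : fourier gaussian xi = gaussian xi.
Proof.
have dxg : decays (fun x => x%:C * gaussian x).
  exact: decays_polyM polybounded_id decays_gaussian.
have F' x : is_cderive (fourier gaussian) x
    ((- (2 * pi * x))%:C * fourier gaussian x).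
  apply: is_cderive_eq (is_cderive_fourier x decays_gaussian) _.
  have := fourier_derive x decays_gaussian (decaysZ (- (2 * pi))%:C dxg)
    is_cderive_gaussian.
  rewrite fourierZ// => H.
  have p0 : (- (2 * pi))%:C != 0 :> R[i].
    by rewrite real_complex_eq0 oppr_eq0 mulf_neq0// gt_eqF// pi_gt0.
  apply: (mulfI p0); rewrite mulrCA H.
  rewrite !mulrA; congr (_ * _).
  by apply: eq_ReIm; rewrite !ReImE /=; ring.
pose Q x := (expR (pi * x ^+ 2))%:C * fourier gaussian x.
have Q' x : is_cderive Q x 0.
  apply: (is_cderive_eq (is_cderiveM (is_cderive_expR_sqr pi x) (F' x))).
  by rewrite real_complexN; ring.
have QE x : Q x = Q 0.
  apply: eq_ReIm.
    apply: (@is_derive_0_is_cst _ (fun x => complex.Re (Q x))) => y.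
    by have [] := Q' y.
  apply: (@is_derive_0_is_cst _ (fun x => complex.Im (Q x))) => y.
  by have [] := Q' y.
have Q0 : Q 0 = 1.
  rewrite /Q expr0n /= mulr0 expR0 mul1r /fourier.
  transitivity (cint setT gaussian).
    by apply: eq_cint => x _; rewrite mulr0 mul0r oppr0 cexpi0 mulr1.
  have sp : 0 < Num.sqrt pi :> R by rewrite sqrtr_gt0 pi_gt0.
  apply: eq_ReIm => /=; last by rewrite /Rintegral integral0.
  have := Rintegral_affine 0 sp (@integrableT_gauss R).
  rewrite {2}/Rintegral (@integralT_gauss R) /= mulVf ?gt_eqF// => <-.
  apply: eq_Rintegral => x _; rewrite /gauss_fun addr0 exprMn sqr_sqrtr//.
  exact: pi_ge0.
have := QE xi; rewrite Q0 /Q => /(canRL (mulKf _)) ->; last first.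
  by rewrite real_complex_eq0 gt_eqF// expR_gt0.
by rewrite mulr1 -real_complexV /gaussian expRN.
Qed.

Lemma ler_weight_shift (l y : R) : `|l| <= 1 ->
  1 + `|y| <= 2 * (1 + `|y + l|).
Proof.
move=> l1; have : `|y| <= `|y + l| + `|l|.
  by rewrite -{1}[y](addrK l) ler_normB.
have : 0 <= `|y + l| by [].
lra.
Qed.

(* Translating by half a period changes the sign of the oscillating factor, so
   the Fourier integral is controlled by the modulus of continuity in L^1. *)
Lemma fourier_cvg0 f : decays f -> forall e, 0 < e ->
  exists N : nat, forall xi, N%:R <= `|xi| -> cmod (fourier f xi) <= e.
Proof.
move=> df e e0.
have [M M0 HM] := decays_bound 2 df.
pose D (l : R) := \int[mu]_y cmod (f y - f (y + l)).
have dfl l : ccontinuous (fun y => f y - f (y + l)).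
  apply: ccontinuousD; first by case: df.
  under eq_fun do rewrite -mulN1r.
  apply: ccontinuousM; first exact: ccontinuous_cst.
  apply: (@ccontinuous_comp _ f (fun y => y + l)); first by case: df.
  by move=> y; apply: cvgD; [exact: cvg_id|exact: cvg_cst].
(* A shift by at most 1 changes the weight by a factor at most 2, so the shifted term costs 4 M and
   the unshifted one M: hence 5 M. *)
have bd l y : `|l| <= 1 -> cmod (f y - f (y + l)) <= 5 * M * (1 + y ^+ 2)^-1.
  move=> l1; have p : 0 < 1 + y ^+ 2 by rewrite ltr_wpDr// sqr_ge0.
  have ywE : 1 + y ^+ 2 <= (1 + `|y|) ^+ 2.
    rewrite sqrrD -(real_normK (num_real y)) expr1n mul1r addrAC lerDl.
    by rewrite mulrn_wge0.
  rewrite ler_pdivlMr//; apply: (@le_trans _ _ ((cmod (f y) + cmod (f (y + l)))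
    * (1 + `|y|) ^+ 2)).
    by apply: ler_pM => //; [exact: cmod_ge0|exact: ltW|exact: ler_cmodB].
  rewrite mulrDl.
  have h1 := HM y; have h2 := HM (y + l).
  have h3 : (1 + `|y|) ^+ 2 <= 4 * (1 + `|y + l|) ^+ 2.
    have -> : 4 * (1 + `|y + l|) ^+ 2 = (2 * (1 + `|y + l|)) ^+ 2 by ring.
    by rewrite lerXn2r ?nnegrE ?mulr_ge0 ?addr_ge0// ler_weight_shift.
  have h4 : cmod (f (y + l)) * (1 + `|y|) ^+ 2 <=
      4 * ((1 + `|y + l|) ^+ 2 * cmod (f (y + l))).
    by rewrite mulrA mulrC ler_wpM2r ?cmod_ge0.
  rewrite [cmod (f y) * _]mulrC; lra.
have iG : mu.-integrable setT (EFin \o (fun y : R => 5 * M * (1 + y ^+ 2)^-1)).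
  by apply: integrableZl_fin => //; exact: integrable_oneDsqrV.
have cI l : `|l| <= 1 -> cintegrable setT (fun y => f y - f (y + l)).
  move=> l1; apply: (cintegrable_dominated _ _ iG) => //.
    exact: ccontinuous_measurable.
  by move=> y _; exact: bd.
have I01 : (0 : R) \in `]-1, 1[%classic.
  by rewrite inE /= in_itv/= ltrN10 ltr01.
have Il (l : R) : `]-1, 1[%classic l -> `|l| <= 1.
  by rewrite /= in_itv/= -ltr_norml => /ltW.
(* Continuity of translations in L^1, by dominated convergence with the bound [bd], which is uniform
   in the shift. *)
have cD : {for 0, continuous D}.
  apply: (@continuity_under_integral R _ _ mu
    (fun l y => cmod (f y - f (y + l))) setT measurableT (-1) 1 _ _
    (fun y => 5 * M * (1 + y ^+ 2)^-1) iG _ 0 I01).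
  - by move=> l /Il l1; apply: cintegrable_cmod => //; exact: cI.
  - apply: aeW => y _ l _.
    have [c1 c2] : ccontinuous (fun l => f y - f (y + l)).
      apply: ccontinuousD; first exact: ccontinuous_cst.
      under eq_fun do rewrite -mulN1r.
      apply: ccontinuousM; first exact: ccontinuous_cst.
      apply: (@ccontinuous_comp _ f (fun l => y + l)); first by case: df.
      by move=> z; apply: cvgD; [exact: cvg_cst|exact: cvg_id].
    rewrite (_ : (fun _ => _) = (fun l => Num.sqrt
      (complex.Re (f y - f (y + l)) ^+ 2 + complex.Im (f y - f (y + l)) ^+ 2))).
      apply: (@continuous_comp _ _ _ (fun l =>
        complex.Re (f y - f (y + l)) ^+ 2 + complex.Im (f y - f (y + l)) ^+ 2)
        (@Num.sqrt R)); last exact: sqrt_continuous.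
      apply: cvgD.
        by apply: (@continuous_comp _ _ _ (fun l => complex.Re (f y - f (y + l)))
          (fun z : R => z ^+ 2)); [exact: c1|exact: exprn_continuous].
      by apply: (@continuous_comp _ _ _ (fun l => complex.Im (f y - f (y + l)))
          (fun z : R => z ^+ 2)); [exact: c2|exact: exprn_continuous].
    apply/funext => z; rewrite -cmod_sqr sqrtr_sqr ger0_norm//.
    exact: cmod_ge0.
  - move=> l /Il l1; apply: aeW => y _.
    by rewrite ger0_norm ?cmod_ge0// bd.
have D0 : D 0 = 0.
  rewrite /D; under eq_Rintegral do rewrite addr0 subrr cmod0.
  by rewrite Rintegral_cst// mul0r.
move/cvgrPdist_le : cD => /(_ e e0); rewrite D0 => -[d /= d0 Hd].
(* The threshold is at least 1 and above 1/d: the first keeps the half-period [l] below 1 so that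
   [bd] applies, the second makes |l| < d. *)
exists (Num.truncn d^-1).+1 => xi xiN.
have xi1 : 1 <= `|xi| by rewrite (le_trans _ xiN)// ler1n.
have xi0 : xi != 0 by rewrite -normr_gt0 (lt_le_trans ltr01).
have dxi : d^-1 < `|xi| by rewrite (lt_le_trans _ xiN)// truncnS_gt.
pose l := (2 * xi)^-1.
have lxi : `|l| = `|xi|^-1 / 2.
  by rewrite /l normfV normrM invfM mulrC normr_nat.
have ixi : `|xi|^-1 <= 1 by rewrite invf_le1// normr_gt0.
have ixi0 : 0 < `|xi|^-1 by rewrite invr_gt0 normr_gt0.
have l1 : `|l| <= 1 by rewrite lxi; lra.
have ld : `|l| < d.
  have : `|xi|^-1 < d by rewrite invf_plt// posrE// normr_gt0.
  by rewrite lxi; lra.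
have dw := decays_wave xi df.
have E1 : fourier f xi = - cint setT (fun y => f (y + l) *
    cexpi (- (2 * pi * xi * y))).
  rewrite /fourier.
  have [i1 i2] := decays_integrable dw.
  transitivity (cint setT (fun y => f (1 * y + l) *
      cexpi (- (2 * pi * xi * (1 * y + l))))).
    apply: eq_ReIm => /=.
      by rewrite (Rintegral_affine l ltr01 i1) invr1 mul1r.
    by rewrite (Rintegral_affine l ltr01 i2) invr1 mul1r.
  rewrite -mulN1r -cintZ//; last first.
    have [j1 j2] := (integrable_affine l ltr01 i1, integrable_affine l ltr01 i2).
    have j : cintegrable setT (fun y => f (1 * y + l) *
        cexpi (- (2 * pi * xi * (1 * y + l)))) by split.
    have := cintegrableZ (cexpi (2 * pi * xi * l)) measurableT j.
    rewrite (_ : (fun x => _) = (fun y => f (y + l) *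
      cexpi (- (2 * pi * xi * y))))//.
    apply/funext => y; rewrite mulrCA -cexpiD mul1r.
    by congr (_ * cexpi _); ring.
  apply: eq_cint => y _; rewrite mul1r mulrCA; congr (_ * _).
  rewrite (_ : - (2 * pi * xi * (y + l)) = - (2 * pi * xi * y) - pi).
    rewrite cexpiD mulrC; congr (_ * _).
    by rewrite /cexpi cosN sinN cospi sinpi oppr0 -real_complexN.
  by rewrite /l; field.
have E2 : 2 * fourier f xi = cint setT (fun y => (f y - f (y + l)) *
    cexpi (- (2 * pi * xi * y))).
  rewrite (_ : 2 = 1 + 1)// mulrDl mul1r {2}E1.
  rewrite /fourier -cintB//.
  - by apply: eq_cint => y _; rewrite mulrBl.
  - exact: decays_integrable.
  - have := cintegrableB measurableT (decays_integrable dw).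
    have [c1 c2] := cI _ l1.
    have bi := cI _ l1.
    move=> _; apply: (@cintegrable_dominated _ _ _
      (fun y => cmod (f (y + l)))) => //.
    + apply: cmeasurableM; apply: ccontinuous_measurable => //.
        apply: (@ccontinuous_comp _ f (fun y => y + l)); first by case: df.
        by move=> z; apply: cvgD; [exact: cvg_id|exact: cvg_cst].
      exact/ccontinuous_cexpi/continuous_wave.
    + have [i1 i2] := decays_integrable df.
      apply: cintegrable_cmod => //; split.
        have := integrable_affine l ltr01 i1.
        by under eq_fun do rewrite mul1r.
      have := integrable_affine l ltr01 i2.
      by under eq_fun do rewrite mul1r.
    + by move=> y _; rewrite cmodM cmod_cexpi mulr1.
have De : `|D l| <= e.
  rewrite -normrN -[- D l]sub0r; apply: Hd => /=.
  by rewrite sub0r normrN.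
have : cmod (2 * fourier f xi) <= D l.
  rewrite E2; apply: ler_cmod_cint => //.
  - apply: (@cintegrable_dominated _ _ _ (fun y => cmod (f y - f (y + l)))) => //.
    + apply: cmeasurableM; apply: ccontinuous_measurable => //.
      exact/ccontinuous_cexpi/continuous_wave.
    + by apply: cintegrable_cmod => //; exact: cI.
    + by move=> y _; rewrite cmodM cmod_cexpi mulr1.
  - by apply: cintegrable_cmod => //; exact: cI.
  - by move=> y _; rewrite cmodM cmod_cexpi mulr1.
rewrite cmodM -real_complex_nat cmod_real normr_nat => H.
have := le_trans H (le_trans (ler_norm _) De).
have := cmod_ge0 (fourier f xi); lra.
Qed.

End Inversion.

(** * Fourier inversion at the origin *)

Section FourierInversion.
Context {R : realType}.
Implicit Types (f g df ddf : R -> R[i]) (xi : R).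

Lemma decays_bound_linear f df : decays df ->
  (forall x, is_cderive f x (df x)) -> f 0 = 0 ->
  exists2 C : R, 0 <= C & forall x, cmod (f x) <= C * `|x|.
Proof.
move=> ddf fdf f0; have [C C0 HC] := decays_bound 0 ddf.
have {}HC x : cmod (df x) <= C by have := HC x; rewrite expr0 mul1r.
exists (2 * C) => [|x]; first by rewrite mulr_ge0.
rewrite (le_trans (ler_cmod_ReIm _))// -mulrA mulr_natl mulr2n.
have bd (p : R[i] -> R) : p 0 = 0 -> (forall z, `|p z| <= cmod z) ->
    (forall x : R, is_derive x 1 (fun y => p (f y)) (p (df x))) ->
    `|p (f x)| <= C * `|x|.
  move=> p0 pz pd.
  have := ler_norm_derive_pow (n := 0) (C := C) pd.
  rewrite f0 p0 => /(_ erefl) H.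
  have := H _ x; rewrite divr1 expr1; apply => y.
  by rewrite expr0 mulr1 (le_trans (pz _)).
apply: lerD.
  by apply: bd; [by []|exact: ler_Re_cmod|move=> y; have [] := fdf y].
by apply: bd; [by []|exact: ler_Im_cmod|move=> y; have [] := fdf y].
Qed.

(** Hadamard's quotient: if f vanishes at 0 then f is x times this function, and the value [df 0] at
    the origin makes it continuous there. *)
Definition slope0 (f df : R -> R[i]) (x : R) : R[i] :=
  if x == 0 then df 0 else f x / x%:C.

Lemma slope0E f df x : f 0 = 0 -> x%:C * slope0 f df x = f x.
Proof.
move=> f0; rewrite /slope0; case: eqVneq => [->|x0]; first by rewrite mul0r f0.
by rewrite mulrCA divff ?mulr1// real_complex_eq0.
Qed.

Lemma continuous_slope0 (u du : R -> R) :
  (forall x : R, is_derive x 1 u (du x)) -> u 0 = 0 ->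
  continuous (fun x => if x == 0 then du 0 else u x / x).
Proof.
move=> udu u0 x; have [->|x0] := eqVneq x 0.
  apply/continuous_withinNx; rewrite eqxx.
  have [d0 <-] := udu 0.
  have : h^-1 *: (u (h + 0) - u 0) @[h --> (0:R)^'] --> 'D_1 u 0.
    have := d0; rewrite /derivable /derive.
    under eq_fun do rewrite /shift /= scaler1.
    by under [in X in _ -> X]eq_fun do rewrite /shift /=.
  apply: cvg_trans; apply: near_eq_cvg; near=> h.
  have h0 : h != 0 by near: h; exact: nbhs_dnbhs_neq.
  by rewrite (negbTE h0) addr0 u0 subr0 /GRing.scale /= mulrC.
have cq : {for x, continuous (fun y => u y / y)}.
  apply: cvgM; last by apply: cvgV => //; exact: cvg_id.
  apply/differentiable_continuous/derivable1_diffP.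
  by have := @ex_derive _ _ _ _ _ _ _ (udu x).
rewrite /continuous_at (negbTE x0).
apply: cvg_trans cq; apply: near_eq_cvg; near=> y.
have y0 : y != 0.
  near: y; exact: (open_neq x0).
by rewrite (negbTE y0).
Unshelve. all: end_near. Qed.

(** For |x| <= 1 the weight is at most 2^m and the quotient is controlled by the linear bound on f,
    or by the bound on its derivative at 0; for |x| > 1 division by |x| only helps. *)
Lemma decays_slope0 f df : decays f -> decays df ->
  (forall x, is_cderive f x (df x)) -> f 0 = 0 -> decays (slope0 f df).
Proof.
move=> cf cdf fdf f0.
have sE x : slope0 f df x =
    (if x == 0 then complex.Re (df 0) else complex.Re (f x) / x) +i*
    (if x == 0 then complex.Im (df 0) else complex.Im (f x) / x).
  rewrite /slope0; case: eqVneq => [_|x0]; first by case: (df 0).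
  by apply: eq_ReIm; rewrite -real_complexV !ReImE /=; ring.
split.
  split.
    under eq_fun do rewrite sE /=.
    by apply: (@continuous_slope0 (fun x => complex.Re (f x))
      (fun x => complex.Re (df x))); [move=> x; have [] := fdf x|rewrite f0].
  under eq_fun do rewrite sE /=.
  by apply: (@continuous_slope0 (fun x => complex.Im (f x))
    (fun x => complex.Im (df x))); [move=> x; have [] := fdf x|rewrite f0].
move=> m; have [M M0 HM] := decays_bound m cf.
have [C C0 HC] := decays_bound_linear cdf fdf f0.
have [D D0 HD] := decays_bound 0 cdf.
exists (2 ^+ m * (C + D) + M) => x.
have w0 : 0 <= (1 + `|x|) ^+ m by rewrite exprn_ge0// addr_ge0.
have [x1|x1] := leP `|x| 1.
  rewrite -[leLHS]addr0 lerD//; apply: ler_pM => //; first exact: cmod_ge0.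
    by rewrite lerXn2r ?nnegrE ?addr_ge0//; lra.
  rewrite /slope0; case: eqVneq => [_|x0].
    have := HD 0; rewrite expr0 mul1r => h.
    by rewrite -[leLHS]add0r lerD.
  rewrite -[leLHS]addr0 lerD// cmodM cmodV cmod_real ler_pdivrMr ?normr_gt0//.
have x0 : x != 0 by rewrite -normr_gt0 (lt_trans _ x1).
rewrite -[leLHS]add0r lerD//; first by rewrite mulr_ge0// ?addr_ge0 ?exprn_ge0.
apply: le_trans (HM x); rewrite ler_wpM2l// /slope0 (negbTE x0).
rewrite cmodM cmodV cmod_real ler_pdivrMr ?normr_gt0// ler_peMr ?cmod_ge0//.
exact: ltW.
Qed.

(* [f - f 0 * gaussian] vanishes at 0, hence is the variable times a decaying
   function [H]; its transform is then a multiple of the derivative of the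
   transform of [H], whose integral is 0 by the Riemann-Lebesgue lemma. *)
Theorem fourier_inversion0 f df ddf : decays f -> decays df -> decays ddf ->
  (forall x, is_cderive f x (df x)) -> (forall x, is_cderive df x (ddf x)) ->
  cint setT (fourier f) = f 0.
Proof.
move=> cf cdf cddf fdf dfddf.
have g0 : gaussian 0 = 1 :> R[i].
  by rewrite /gaussian expr0n /= mulr0 oppr0 expR0.
pose k x := f x - f 0 * gaussian x.
pose dk x := df x - f 0 * ((- (2 * pi))%:C * (x%:C * gaussian x)).
have kdk x : is_cderive k x (dk x).
  by apply: is_cderiveB => //; apply: is_cderiveZ; exact: is_cderive_gaussian.
have dg := @decays_gaussian R.
have ck : decays k by apply: decaysB => //; exact: decaysZ.
have cdk : decays dk.
  apply: decaysB => //; do 2 apply: decaysZ.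
  exact: decays_polyM polybounded_id dg.
have k0 : k 0 = 0 by rewrite /k g0 mulr1 subrr.
pose H := slope0 k dk.
have cH : decays H by exact: decays_slope0.
have HE x : is_cderive (fourier H) x (- i2pi * fourier k x).
  apply: is_cderive_eq (is_cderive_fourier x cH) _.
  by congr (_ * _); apply: eq_fourier => y; exact: slope0E.
have fi : cintegrable setT (fourier f) by exact: fourier_integrable dfddf.
have gi : cintegrable setT (fourier (@gaussian R)).
  rewrite (_ : fourier _ = @gaussian R); first exact: decays_integrable.
  by apply/funext => x; exact: fourier_gaussian.
have kE x : fourier k x = fourier f x - f 0 * fourier (@gaussian R) x.
  by rewrite /k fourierB// ?fourierZ//; exact: decaysZ.
have ki : cintegrable setT (fourier k).
  rewrite (_ : fourier k =
    fun x => fourier f x - f 0 * fourier (@gaussian R) x).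
    by apply: cintegrableB => //; exact: cintegrableZ.
  by apply/funext => x; exact: kE.
have : cint setT (fun x => - i2pi * fourier k x) = 0.
  apply: (cint_derive_decays HE).
  - apply: ccontinuousM; first exact: ccontinuous_cst.
    exact: fourier_ccontinuous.
  - exact: cintegrableZ.
  - exact: fourier_cvg0.
rewrite cintZ// => /eqP; rewrite mulf_eq0 oppr_eq0 (negbTE i2pi_neq0) /=.
have -> : cint setT (fourier k) = cint setT (fourier f) - f 0.
  transitivity (cint setT (fun x => fourier f x - f 0 * fourier (@gaussian R) x)).
    by apply: eq_cint => x _; exact: kE.
  rewrite cintB//; last exact: cintegrableZ.
  rewrite cintZ//; congr (_ - _).
  (* As the Gaussian is its own transform, the integral of its transform is its transform at
     frequency 0, that is 1. *)
  transitivity (f 0 * fourier (@gaussian R) 0).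
    congr (_ * _); rewrite /fourier; apply: eq_cint => x _.
    by rewrite -/(fourier gaussian x) fourier_gaussian mulr0 mul0r oppr0 cexpi0 mulr1.
  by rewrite fourier_gaussian g0 mulr1.
by rewrite subr_eq0 => /eqP.
Qed.

End FourierInversion.

(** * Windowed transforms of the signal *)

Section Schwartz.
Context {R : realType}.
Implicit Types (f : R -> R[i]).

Lemma schwartz_is_cderive f n (x : R) : schwartz f ->
  is_cderive (cderivn n f) x (cderivn n.+1 f x).
Proof.
move=> [[f1 f2] _]; split.
  by apply: DeriveDef; [exact: f1|rewrite -derive1E].
by apply: DeriveDef; [exact: f2|rewrite -derive1E].
Qed.

Lemma cderivn0 f : cderivn 0 f = f.
Proof. by apply/funext => x; apply: eq_ReIm. Qed.

Lemma schwartz_decays f n : schwartz f -> decays (cderivn n f).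
Proof.
move=> sf; split.
  by apply: is_cderive_ccontinuous => x; exact: schwartz_is_cderive.
have [_ H] := sf; move=> m.
have [M0 H0] := H 0%N n; have [M1 H1] := H m n.
(* From (1 + |x|)^m <= 2^m (1 + |x|^m): the two summands are controlled by the Schwartz bounds of
   order 0 and m. *)
exists (2 ^+ m * (M0 + M1)) => x.
have c0 := cmod_ge0 (cderivn n f x).
apply: (@le_trans _ _ (2 ^+ m * ((1 + `|x| ^+ m) * cmod (cderivn n f x)))).
  rewrite mulrA; apply: ler_wpM2r => //.
  have [x1|x1] := leP `|x| 1.
    apply: (@le_trans _ _ (2 ^+ m)).
      by rewrite lerXn2r ?nnegrE ?addr_ge0//; lra.
    by rewrite ler_peMr ?exprn_ge0// lerDl exprn_ge0.
  apply: (@le_trans _ _ ((2 * `|x|) ^+ m)).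
    by rewrite lerXn2r ?nnegrE ?addr_ge0 ?mulr_ge0//; lra.
  by rewrite exprMn ler_wpM2l ?exprn_ge0// lerDr.
apply: ler_wpM2l; first exact: exprn_ge0.
rewrite mulrDl mul1r lerD//.
by have := H0 x; rewrite expr0 mul1r.
Qed.

End Schwartz.

(** * Fourier integrals with a dilated window *)

Section WindowedTransform.
Context {R : realType}.
Local Notation mu := (@lebesgue_measure R).
Implicit Types (f g p q : R -> R[i]) (s xi : R).

(* Both the adaptive transform of the signal and those of its chirp and residual
   parts have this shape, [p] being the signal seen from the current time. *)
Definition wft s p f xi : R[i] :=
  fourier (fun tau => p tau * (s^-1)%:C * f (tau / s)) xi.

Lemma decays_wft s p f : 0 < s -> polybounded p -> decays f ->
  decays (fun tau => p tau * (s^-1)%:C * f (tau / s)).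
Proof.
move=> s0 pp df; apply: decays_polyM; last exact: decays_dilate.
by apply: polyboundedM => //; exact: polybounded_cst.
Qed.

Lemma wftD s p q f xi : 0 < s -> polybounded p -> polybounded q -> decays f ->
  wft s (fun tau => p tau + q tau) f xi = wft s p f xi + wft s q f xi.
Proof.
move=> s0 pp pq df; rewrite /wft -fourierD//; [|exact: decays_wft..].
by apply: eq_fourier => x; ring.
Qed.

Lemma wftZ s p f xi (c : R[i]) : 0 < s -> polybounded p -> decays f ->
  wft s (fun tau => c * p tau) f xi = c * wft s p f xi.
Proof.
move=> s0 pp df; rewrite /wft -fourierZ//; last exact: decays_wft.
by apply: eq_fourier => x; ring.
Qed.

Lemma wft_sum (I : Type) (r : seq I) s (p : I -> R -> R[i]) f xi : 0 < s ->
  (forall i, polybounded (p i)) -> decays f ->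
  wft s (fun tau => \sum_(i <- r) p i tau) f xi = \sum_(i <- r) wft s (p i) f xi.
Proof.
move=> s0 pp df; rewrite /wft -(@fourier_sum _ _ _
  (fun i tau => p i tau * (s^-1)%:C * f (tau / s))); last first.
  by move=> i; exact: decays_wft.
by apply: eq_fourier => x; rewrite !mulr_suml.
Qed.

(** Differentiating the wave produces tau = s (tau/s): the factor s comes out and tau/s is absorbed
    into the window, which becomes u f(u). *)
Lemma is_cderive_wft s p f xi : 0 < s -> polybounded p -> decays f ->
  is_cderive (wft s p f) xi
    (- i2pi * s%:C * wft s p (fun u => u%:C * f u) xi).
Proof.
move=> s0 pp df.
apply: is_cderive_eq (is_cderive_fourier xi (decays_wft s0 pp df)) _.
rewrite -mulrA; congr (_ * _); rewrite /wft -fourierZ; last first.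
  by apply: (@decays_wft s p (fun u => u%:C * f u)) => //;
    exact: decays_polyM polybounded_id df.
apply: eq_fourier => x.
rewrite real_complexM.
have -> : x%:C = s%:C * (x%:C * (s^-1)%:C) :> R[i].
  by rewrite mulrCA -[s%:C * _]real_complexM divff ?mulr1// gt_eqF.
have e : s%:C * (s^-1)%:C = 1 :> R[i] by rewrite -real_complexM divff// gt_eqF.
have -> : s%:C * (x%:C * (s^-1)%:C) * (s^-1)%:C =
  s%:C * (s^-1)%:C * (x%:C * (s^-1)%:C) :> R[i] by ring.
by rewrite e; ring.
Qed.

Lemma wft_ccontinuous s p f : 0 < s -> polybounded p -> decays f ->
  ccontinuous (wft s p f).
Proof. by move=> s0 pp df; apply: fourier_ccontinuous; exact: decays_wft. Qed.

(** Integration by parts: [fourier_derive] applied to p(x) f(x/s) trades the derivative of the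
    window for that of the signal. *)
Lemma wft_cderive s p dp f df xi : 0 < s ->
  polybounded p -> polybounded dp -> decays f -> decays df ->
  (forall x, is_cderive p x (dp x)) -> (forall x, is_cderive f x (df x)) ->
  wft s p df xi = i2pi * xi%:C * s%:C * wft s p f xi - s%:C * wft s dp f xi.
Proof.
move=> s0 pp pdp cf cdf pdp' fdf.
have e : s%:C * (s^-1)%:C = 1 :> R[i] by rewrite -real_complexM divff// gt_eqF.
pose F x := p x * f (x / s).
pose dF x := dp x * f (x / s) + p x * (df (x / s) * (s^-1)%:C).
have dd h : decays h -> decays (fun x => h (x / s)) by exact: decays_dilate.
have cF : decays F by apply: decays_polyM => //; exact: dd.
have c1 : decays (fun x => dp x * f (x / s)).
  by apply: decays_polyM => //; exact: dd.
have c2 : decays (fun x => p x * (df (x / s) * (s^-1)%:C)).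
  apply: decays_polyM => //; apply: decays_polyMr; last exact: dd.
  exact: polybounded_cst.
have cdF : decays dF by exact: decaysD.
have FdF x : is_cderive F x (dF x).
  apply: is_cderiveM; first exact: pdp'.
  apply: (@is_cderive_comp _ f (fun x => x / s)); first exact: fdf.
  rewrite (_ : (fun _ => _) = (fun x : R => s^-1 * x + 0)).
    exact: is_derive_affine.
  by apply/funext => y; rewrite addr0 mulrC.
have := fourier_derive xi cF cdF FdF.
rewrite /dF fourierD//.
have -> : fourier F xi = s%:C * wft s p f xi.
  rewrite /wft -fourierZ; last exact: decays_wft.
  apply: eq_fourier => x; rewrite /F -[LHS]mul1r -e; ring.
have -> : fourier (fun x => dp x * f (x / s)) xi = s%:C * wft s dp f xi.
  rewrite /wft -fourierZ; last exact: decays_wft.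
  apply: eq_fourier => x; rewrite -[LHS]mul1r -e; ring.
have -> : fourier (fun x => p x * (df (x / s) * (s^-1)%:C)) xi = wft s p df xi.
  by apply: eq_fourier => x; ring.
by move=> /(canRL (addKr _)) ->; ring.
Qed.

(** The substitution u = tau/s absorbs the factor 1/s and turns |tau|^n into s^n |u|^n, leaving an
    absolute moment of the window. *)
Lemma ler_cmod_wft s p f (c : R) (n : nat) xi : 0 < s -> polybounded p ->
  decays f -> (forall tau, cmod (p tau) <= c * `|tau| ^+ n) ->
  cmod (wft s p f xi) <=
  c * s ^+ n * \int[mu]_tau cmod ((tau ^+ n)%:C * f tau).
Proof.
move=> s0 pp df pc.
have dnf : decays (fun tau => (tau ^+ n)%:C * f tau).
  elim: n {pc} => [|n IH].
    by under eq_fun do rewrite expr0 mul1r.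
  under eq_fun do rewrite exprS real_complexM -mulrA.
  exact: decays_polyM polybounded_id IH.
pose h (tau : R) : R := cmod ((tau ^+ n)%:C * f tau).
have hi : mu.-integrable setT (EFin \o h).
  by apply: cintegrable_cmod => //; exact: decays_integrable.
have s10 : 0 < s^-1 by rewrite invr_gt0.
have hsi := integrable_affine 0 s10 hi.
have := Rintegral_affine 0 s10 hi; rewrite invrK => hE.
have -> : c * s ^+ n * \int[mu]_tau h tau =
    \int[mu]_tau (c * s ^+ n / s * h (s^-1 * tau + 0)).
  by rewrite RintegralZl// hE; field; rewrite gt_eqF.
apply: ler_cmod_fourier; first exact: decays_wft.
  exact: integrableZl_fin.
move=> x; rewrite /h !cmodM !cmod_real addr0 -[s^-1 * x]mulrC normrX.
rewrite normrM normfV (gtr0_norm s0) expr_div_n.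
have -> : c * s ^+ n / s * (`|x| ^+ n / s ^+ n * cmod (f (x / s))) =
   c * `|x| ^+ n / s * cmod (f (x / s)).
  have s_ := lt0r_neq0 s0; have sn := expf_neq0 n s_.
  by field; rewrite ?s_ ?sn.
by apply: ler_wpM2r; [exact: cmod_ge0|apply: ler_wpM2r; [exact: ltW|]].
Qed.

End WindowedTransform.

(** * Bounds on sine, cosine and the unit exponential *)

Section Trigonometry.
Context {R : realType}.

Lemma ler_norm_sin (x : R) : `|sin x| <= `|x|.
Proof.
have := ler_norm_derive_pow (n := 0) (C := 1) (@is_derive_sin R) (@sin0 R).
by move=> /(_ _ x); rewrite divr1 expr1 mul1r; apply => y; rewrite mul1r cos_max.
Qed.

Lemma ler_norm_1Bcos (x : R) : 1 - cos x <= x ^+ 2 / 2.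
Proof.
have d (y : R) : is_derive y 1 (fun z => 1 - cos z) (sin y).
  have := is_deriveB (is_derive_cst (1 : R) y 1) (is_derive_cos y).
  by rewrite sub0r opprK.
have := ler_norm_derive_pow (n := 1) (C := 1) d.
rewrite cos0 subrr => /(_ erefl) H.
rewrite (le_trans (ler_norm _))// (le_trans (H _ x))//.
  by move=> y; rewrite expr1 mul1r ler_norm_sin.
by rewrite real_normK ?num_real// mul1r mulrC.
Qed.

(** The square of the left side is 2 (1 - cos x), which is at most x^2. *)
Lemma ler_cmod_cexpiB1 (x : R) : cmod (cexpi x - 1) <= `|x|.
Proof.
rewrite -(@ler_pXn2r _ 2)// ?nnegrE ?cmod_ge0// real_normK ?num_real//.
rewrite cmod_sqr !ReImE /= oppr0 addr0.
have := ler_norm_1Bcos x; have := cos2Dsin2 x; nra.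
Qed.

End Trigonometry.

(** * Taylor remainders *)

Section Taylor.
Context {R : realType}.
Implicit Types (u d : R -> R).

Lemma is_derive_shift u (d t x : R) :
  is_derive (t + x) 1 u d -> is_derive x 1 (fun y => u (t + y)) d.
Proof.
move=> ud; have h : is_derive x 1 (fun y : R => t + y) 1.
  have := is_derive_affine 1 t x.
  rewrite (_ : (fun _ => _) = fun y => t + y)//.
  by apply/funext => y; rewrite mul1r addrC.
have := @is_derive1_comp _ u (fun y => t + y) x _ _ ud h.
by move/is_derive_eq; apply; rewrite mulr1.
Qed.

Lemma is_derive_shiftB u (d t c x : R) :
  is_derive (t + x) 1 u d -> is_derive x 1 (fun y => u (t + y) - c) d.
Proof.
move=> ud; have := is_deriveB (is_derive_shift ud) (is_derive_cst c x 1).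
by rewrite subr0.
Qed.

Lemma is_derive_continuous (u du : R -> R) :
  (forall x : R, is_derive x 1 u (du x)) -> continuous u.
Proof.
move=> ud x; apply/differentiable_continuous/derivable1_diffP.
by have := @ex_derive _ _ _ _ _ _ _ (ud x).
Qed.

Lemma ler_taylor0 u d (C t : R) : (forall x : R, is_derive x 1 u (d x)) ->
  (forall x, `|d x| <= C) -> forall tau, `|u (t + tau) - u t| <= C * `|tau|.
Proof.
move=> ud dC tau.
have d1 (x : R) : is_derive x 1 (fun y => u (t + y) - u t) (d (t + x)).
  exact: is_derive_shiftB.
have := ler_norm_derive_pow (n := 0) (C := C) d1.
rewrite addr0 subrr => /(_ erefl) H.
have := H _ tau; rewrite divr1 expr1; apply => x.
by rewrite expr0 mulr1.
Qed.

Definition taylor_remainder u (d1 d2 t tau : R) : R :=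
  u (t + tau) - u t - d1 * tau - 2^-1 * d2 * tau ^+ 2.

Lemma is_derive_taylor_remainder u (du d1 d2 t x : R) :
  is_derive (t + x) 1 u du ->
  is_derive x 1 (taylor_remainder u d1 d2 t) (du - d1 - d2 * x).
Proof.
move=> ud.
have h := is_derive_shift ud.
have q := is_derive_sqr (2^-1 * d2) x.
have l := is_derive_affine d1 (u t) x.
have := is_deriveB (is_deriveB h l) q.
rewrite (_ : _ - _ - _ = taylor_remainder u d1 d2 t).
  by move/is_derive_eq; apply; field.
by apply/funext => y; rewrite !fctE /taylor_remainder; ring.
Qed.

(** The bound C on the third derivative is integrated three times from 0; the powers |tau|, |tau|^2,
    |tau|^3 come with the constants C, C/2, C/6. *)
Lemma ler_taylor_remainder u (d1 d2 d3 : R -> R) (C t : R) :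
  (forall x : R, is_derive x 1 u (d1 x)) ->
  (forall x : R, is_derive x 1 d1 (d2 x)) ->
  (forall x : R, is_derive x 1 d2 (d3 x)) -> (forall x, `|d3 x| <= C) ->
  forall tau, `|taylor_remainder u (d1 t) (d2 t) t tau| <= C / 6 * `|tau| ^+ 3.
Proof.
move=> ud1 d12 d23 d3C tau.
have H1 := ler_taylor0 t d23 d3C.
have e2 (x : R) : is_derive x 1
    (fun y => d1 (t + y) - d1 t - d2 t * y) (d2 (t + x) - d2 t).
  have := is_deriveB (is_derive_shift (d12 (t + x)))
    (is_derive_affine (d2 t) (d1 t) x).
  rewrite (_ : _ - _ = fun y => d1 (t + y) - d1 t - d2 t * y)//.
  by apply/funext => y; rewrite !fctE; ring.
have e3 (x : R) := is_derive_taylor_remainder (d1 t) (d2 t) (ud1 (t + x)).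
have H2 : forall x, `|d1 (t + x) - d1 t - d2 t * x| <= C / 2 * `|x| ^+ 2.
  apply: (ler_norm_derive_pow (n := 1) e2) => [|x].
    by rewrite addr0 subrr mulr0 subrr.
  by rewrite expr1.
have -> : C / 6 = C / 2 / 3 by field.
apply: (ler_norm_derive_pow (n := 2) e3) => [|//].
by rewrite /taylor_remainder addr0 subrr !mulr0 expr0n /= mulr0 !subrr.
Qed.

End Taylor.

(** * Freezing the amplitude and the phase of one component *)

Section Components.
Context {R : realType} {K : nat}.
Variables (A phi : 'I_K -> R -> R) (eps1 eps3 : R).
Hypothesis A_C2 : forall k, class_Cn 2 (A k).
Hypothesis phi_C3 : forall k, class_Cn 3 (phi k).
Hypothesis A_lip : forall k t, `|derive1 (A k) t| <= eps1.
Hypothesis phi_3 : forall k t, `|derive1n 3 (phi k) t| <= eps3.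
Hypothesis A_gt0 : forall k t, 0 < A k t.
Implicit Types (k : 'I_K) (t : R).

Lemma is_derive_A k (x : R) : is_derive x 1 (A k) (derive1 (A k) x).
Proof.
have [/(_ 0%N isT x) h _] := A_C2 k.
by apply: DeriveDef; [exact: h|rewrite -derive1E].
Qed.

Lemma is_derive_phi k (x : R) : is_derive x 1 (phi k) (dphi phi k x).
Proof.
have [/(_ 0%N isT x) h _] := phi_C3 k.
by apply: DeriveDef; [exact: h|rewrite -derive1E].
Qed.

Lemma is_derive_dphi k (x : R) : is_derive x 1 (dphi phi k) (ddphi phi k x).
Proof.
have [/(_ 1%N isT x) h _] := phi_C3 k.
by apply: DeriveDef; [exact: h|rewrite -derive1E].
Qed.

Lemma is_derive_ddphi k (x : R) :
  is_derive x 1 (ddphi phi k) (derive1n 3 (phi k) x).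
Proof.
have [/(_ 2%N isT x) h _] := phi_C3 k.
by apply: DeriveDef; [exact: h|rewrite -derive1E].
Qed.

Lemma amplitude_increment k t tau : `|A k (t + tau) - A k t| <= eps1 * `|tau|.
Proof. exact: (ler_taylor0 t (is_derive_A k) (A_lip k)). Qed.

Definition phase_remainder k t : R -> R :=
  taylor_remainder (phi k) (dphi phi k t) (ddphi phi k t) t.

Lemma is_derive_phase_remainder k t (x : R) :
  is_derive x 1 (phase_remainder k t)
    (dphi phi k (t + x) - dphi phi k t - ddphi phi k t * x).
Proof. exact: is_derive_taylor_remainder (is_derive_phi k (t + x)). Qed.

Lemma ler_phase_remainder k t tau :
  `|phase_remainder k t tau| <= eps3 / 6 * `|tau| ^+ 3.
Proof.
exact: (ler_taylor_remainder t (is_derive_phi k) (is_derive_dphi k)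
  (is_derive_ddphi k) (phi_3 k)).
Qed.

Lemma continuous_A k : continuous (A k).
Proof. exact: is_derive_continuous (is_derive_A k). Qed.

Lemma continuous_phi k : continuous (phi k).
Proof. exact: is_derive_continuous (is_derive_phi k). Qed.

Lemma continuous_shift (u : R -> R) t : continuous u ->
  continuous (fun x => u (t + x)).
Proof.
move=> cu x; apply: (@continuous_comp _ _ _ (fun y => t + y) u x); last exact: cu.
by apply: cvgD; [exact: cvg_cst|exact: cvg_id].
Qed.

Lemma continuousZ (c : R) (u : R -> R) : continuous u ->
  continuous (fun x => c * u x).
Proof. by move=> cu x; apply: cvgM; [exact: cvg_cst|exact: cu]. Qed.

Lemma ccontinuous_cexpi_phi k t :
  ccontinuous (fun tau => cexpi (2 * pi * phi k (t + tau))).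
Proof.
apply: ccontinuous_cexpi; apply: continuousZ; apply: continuous_shift.
exact: continuous_phi.
Qed.

(** The bound on A_k' makes the amplitude grow at most linearly in tau: |A_k(t + tau)| <= A_k(t) +
    eps1 |tau|. *)
Lemma polybounded_component k t :
  polybounded (fun tau => component A phi k (t + tau)).
Proof.
split.
  apply: ccontinuousM; last exact: ccontinuous_cexpi_phi.
  apply: ccontinuous_real; apply: continuous_shift; exact: continuous_A.
exists 1%N, (A k t + eps1) => tau.
have e0 : 0 <= eps1 by exact: le_trans (A_lip k t).
rewrite /component cmodM cmod_cexpi mulr1 cmod_real expr1 mulrDl.
have := amplitude_increment k t tau.
have := ler_normD (A k (t + tau) - A k t) (A k t).
rewrite subrK (gtr0_norm (A_gt0 k t)).
have : 0 <= `|tau| by [].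
have := A_gt0 k t.
move: (`|A k (t + tau)|) (`|A k (t + tau) - A k t|) (`|tau|) => a b c.
nra.
Qed.

Lemma polybounded_sum (I : Type) (r : seq I) (p : I -> R -> R[i]) :
  (forall i, polybounded (p i)) -> polybounded (fun x => \sum_(i <- r) p i x).
Proof.
move=> H; elim: r => [|i r IH].
  rewrite (_ : (fun _ => _) = fun=> 0); first exact: polybounded_cst.
  by apply/funext => x; rewrite big_nil.
rewrite (_ : (fun _ => _) = fun x => p i x + \sum_(i <- r) p i x).
  exact: polyboundedD.
by apply/funext => x; rewrite big_cons.
Qed.

Lemma polybounded_signal t : polybounded (fun tau => signal A phi (t + tau)).
Proof. by apply: polybounded_sum => k; exact: polybounded_component. Qed.

Lemma is_derive_chirp_phase k t (x : R) : is_derive x 1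
  (fun tau => 2 * pi * (dphi phi k t * tau + 2^-1 * ddphi phi k t * tau ^+ 2))
  (2 * pi * (dphi phi k t + ddphi phi k t * x)).
Proof.
have q := is_derive_sqr (pi * ddphi phi k t) x.
have l := is_derive_affine (2 * pi * dphi phi k t) 0 x.
have := is_deriveD l q.
rewrite (_ : _ + _ = (fun tau =>
   2 * pi * (dphi phi k t * tau + 2^-1 * ddphi phi k t * tau ^+ 2))).
  by move/is_derive_eq; apply; ring.
by apply/funext => y; rewrite !fctE; field.
Qed.

Lemma polybounded_chirp k t : polybounded (chirp phi k t).
Proof.
apply: polybounded_cexpi; exact: is_derive_continuous (is_derive_chirp_phase k t).
Qed.

Lemma is_cderive_chirp k t (x : R) : is_cderive (chirp phi k t) x
  (i2pi * (dphi phi k t)%:C * chirp phi k t x +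
   i2pi * (ddphi phi k t)%:C * (x%:C * chirp phi k t x)).
Proof.
have := is_cderive_cexpi (is_derive_chirp_phase k t x).
move/is_cderive_eq; apply; rewrite -/(chirp phi k t x).
by rewrite i2piE !real_complexM real_complex_nat !(real_complexD, real_complexM); ring.
Qed.

(** The error of freezing the amplitude while the exact phase is kept. [phase_part] is then the
    error of replacing the phase by its quadratic part, at frozen amplitude; together they make up
    the integrand of [res]. *)
Definition amplitude_part k t (tau : R) : R[i] :=
  (A k (t + tau) - A k t)%:C * cexpi (2 * pi * phi k (t + tau)).

Definition phase_part k t (tau : R) : R[i] :=
  component A phi k t * chirp phi k t tau *
    (cexpi (2 * pi * phase_remainder k t tau) - 1).

Lemma ler_amplitude_part k t tau :
  cmod (amplitude_part k t tau) <= eps1 * `|tau| ^+ 1.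
Proof.
by rewrite cmodM cmod_cexpi mulr1 cmod_real expr1 amplitude_increment.
Qed.

(** The constant is 2 pi times 1/6: the unit exponential is 1-Lipschitz and the cubic phase
    remainder has constant eps3/6. *)
Lemma ler_phase_part k t tau :
  cmod (phase_part k t tau) <= pi / 3 * eps3 * A k t * `|tau| ^+ 3.
Proof.
rewrite /phase_part /component !cmodM !cmod_cexpi !mulr1 cmod_real.
rewrite (gtr0_norm (A_gt0 k t)).
have := ler_cmod_cexpiB1 (2 * pi * phase_remainder k t tau).
rewrite normrM ger0_norm ?mulr_ge0 ?pi_ge0// => h.
have h2 : 2 * pi * `|phase_remainder k t tau| <=
    2 * pi * (eps3 / 6 * `|tau| ^+ 3).
  by rewrite ler_wpM2l ?mulr_ge0 ?pi_ge0// ler_phase_remainder.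
apply: (@le_trans _ _ (A k t * (2 * pi * (eps3 / 6 * `|tau| ^+ 3)))).
  by rewrite ler_wpM2l ?(le_trans h)// ltW.
by rewrite le_eqVlt; apply/orP; left; apply/eqP; field.
Qed.

Lemma polybounded_power p (c : R) n : 0 <= c -> ccontinuous p ->
  (forall tau : R, cmod (p tau) <= c * `|tau| ^+ n) -> polybounded p.
Proof.
move=> c0 cp H; split=> //; exists n, c => x; apply: (le_trans (H x)).
by rewrite ler_wpM2l// lerXn2r ?nnegrE ?addr_ge0// lerDr.
Qed.

Lemma polybounded_amplitude_part k t : polybounded (amplitude_part k t).
Proof.
apply: polybounded_power (ler_amplitude_part k t).
  exact: le_trans (A_lip k t).
apply: ccontinuousM; last exact: ccontinuous_cexpi_phi.
apply: ccontinuous_real; apply: is_derive_continuous => x.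
exact: is_derive_shiftB (is_derive_A k (t + x)).
Qed.

Lemma polybounded_phase_part k t : polybounded (phase_part k t).
Proof.
have e0 : 0 <= eps3 by exact: le_trans (phi_3 k t).
apply: polybounded_power (ler_phase_part k t).
  by rewrite !mulr_ge0 ?pi_ge0 ?invr_ge0// ltW.
apply: ccontinuousM.
  apply: ccontinuousM; first exact: ccontinuous_cst.
  by have [] := polybounded_chirp k t.
apply: ccontinuousD; last exact: ccontinuous_cst.
apply: ccontinuous_cexpi; apply: continuousZ.
exact: is_derive_continuous (is_derive_phase_remainder k t).
Qed.

Lemma component_split k t tau : component A phi k (t + tau) =
  component A phi k t * chirp phi k t tau +
  (amplitude_part k t tau + phase_part k t tau).
Proof.
rewrite /amplitude_part /phase_part /component /chirp.
have -> : cexpi (2 * pi * phase_remainder k t tau) =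
   cexpi (2 * pi * phi k (t + tau)) * cexpi (- (2 * pi * phi k t)) *
   cexpi (- (2 * pi * (dphi phi k t * tau + 2^-1 * ddphi phi k t * tau ^+ 2))).
  by rewrite -!cexpiD; congr cexpi; rewrite /phase_remainder /taylor_remainder; ring.
have inv (x : R) : cexpi x * cexpi (- x) = 1 by rewrite -cexpiD subrr cexpi0.
have := inv (2 * pi * phi k t).
have := inv (2 * pi * (dphi phi k t * tau + 2^-1 * ddphi phi k t * tau ^+ 2)).
rewrite real_complexB.
(* With the exponentials generalized, only the relations a a' = 1 and b b' = 1 are left and the
   identity is polynomial. *)
move: (cexpi (2 * pi * phi k (t + tau))) (cexpi (2 * pi * phi k t))
  (cexpi (- (2 * pi * phi k t)))
  (cexpi (2 * pi * (dphi phi k t * tau + 2^-1 * ddphi phi k t * tau ^+ 2)))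
  (cexpi (- (2 * pi * (dphi phi k t * tau +
     2^-1 * ddphi phi k t * tau ^+ 2)))) => e a a' b b' h1 h2.
have -> : (A k t)%:C * a * b * (e * a' * b' - 1) =
  (A k t)%:C * (e * (a * a') * (b * b') - a * b) by ring.
by rewrite h1 h2; ring.
Qed.

End Components.

(** * Splitting the transform into chirps and residuals *)

Section Stft.
Context {R : realType} {K : nat}.
Variables (g : R -> R[i]) (sigma : R -> R) (A phi : 'I_K -> R -> R).
Variables (eps1 eps3 : R).
Hypothesis g_schwartz : schwartz g.
Hypothesis sigma_gt0 : forall t, 0 < sigma t.
Hypothesis A_C2 : forall k, class_Cn 2 (A k).
Hypothesis phi_C3 : forall k, class_Cn 3 (phi k).
Hypothesis A_lip : forall k t, `|derive1 (A k) t| <= eps1.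
Hypothesis phi_3 : forall k t, `|derive1n 3 (phi k) t| <= eps3.
Hypothesis A_gt0 : forall k t, 0 < A k t.
Implicit Types (k : 'I_K) (t eta : R) (f : R -> R[i]).

(** The window is left free: the windows u^j g give the functions [Gj], while g' enters through the
    integration by parts. *)
Definition chirp_part f k t eta : R[i] := wft (sigma t) (chirp phi k t) f eta.

Lemma decays_g : decays g.
Proof. by rewrite -[g]cderivn0; exact: schwartz_decays. Qed.

Lemma decays_dg : decays (cderiv g).
Proof. exact: schwartz_decays. Qed.

Lemma is_cderive_g x : is_cderive g x (cderiv g x).
Proof. by have := schwartz_is_cderive 0 x g_schwartz; rewrite cderivn0. Qed.

Lemma decays_idM f : decays f -> decays (fun u => u%:C * f u).
Proof. exact: decays_polyM polybounded_id. Qed.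

Lemma decays_g1 : decays (g1 g).
Proof. exact: decays_idM decays_g. Qed.

Lemma g2E : g2 g = fun u => u%:C * g1 g u.
Proof. by apply/funext => u; rewrite /g2 /g1 expr2 real_complexM mulrA. Qed.

Lemma decays_g2 : decays (g2 g).
Proof. by rewrite g2E; exact: decays_idM decays_g1. Qed.

Lemma decays_g3 : decays (g3 g).
Proof. exact: decays_idM decays_dg. Qed.

Let p_chirp k t : polybounded (chirp phi k t).
Proof. exact: polybounded_chirp. Qed.

Let p_amp k t : polybounded (amplitude_part A phi k t).
Proof. exact: polybounded_amplitude_part A_lip k t. Qed.

Let p_phase k t : polybounded (phase_part A phi k t).
Proof. exact: polybounded_phase_part phi_3 _ k t. Qed.

Let p_signal t : polybounded (fun tau => signal A phi (t + tau)).
Proof. exact: polybounded_signal A_lip _ t. Qed.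

Lemma polybounded_res k t :
  polybounded (fun tau => amplitude_part A phi k t tau + phase_part A phi k t tau).
Proof. by apply: polyboundedD; [exact: p_amp|exact: p_phase]. Qed.

Lemma resE f t eta : res sigma A phi f t eta =
  \sum_(k < K) wft (sigma t)
    (fun tau => amplitude_part A phi k t tau + phase_part A phi k t tau) f eta.
Proof. by []. Qed.

(** Stated for every decaying window, since the time derivative of V requires the splitting for g,
    [g1 g] and [cderiv g] at once. *)
Lemma stft_split f t eta : decays f -> stft sigma A phi f t eta =
  \sum_(k < K) component A phi k t * chirp_part f k t eta
    + res sigma A phi f t eta.
Proof.
move=> df; rewrite resE -big_split /=.
transitivity (wft (sigma t) (fun tau => \sum_(k < K)
    (component A phi k t * chirp phi k t tau +
     (amplitude_part A phi k t tau + phase_part A phi k t tau))) f eta).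
  rewrite /stft /wft; apply: eq_fourier => tau; congr (_ * _ * _).
  by apply: eq_bigr => k _; exact: component_split.
have pc k : polybounded (fun tau => component A phi k t * chirp phi k t tau).
  by apply: polyboundedM; [exact: polybounded_cst|exact: p_chirp].
rewrite wft_sum//; last first.
  by move=> k; apply: polyboundedD; [exact: pc|exact: polybounded_res].
apply: eq_bigr => k _; rewrite [LHS]wftD//; last exact: polybounded_res.
by rewrite wftZ//; exact: p_chirp.
Qed.

(** The normalization tau^j / sigma^(j+1) of [Gj] is sigma^-1 (tau/sigma)^j, so the power of tau
    goes into the window. *)
Lemma GjE j k t eta : Gj g sigma phi j k t eta =
  chirp_part (fun u => (u ^+ j)%:C * g u) k t eta.
Proof.
rewrite /chirp_part /wft /Gj; apply: eq_fourier => tau.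
rewrite [RHS]mulrA; congr (_ * _); rewrite -mulrA; congr (_ * _).
rewrite -real_complexM; congr (_%:C); rewrite expr_div_n exprS.
have s_ := lt0r_neq0 (sigma_gt0 t); have sj := expf_neq0 j s_.
by field; rewrite ?s_ ?sj.
Qed.

Lemma Gj0E k t eta : Gj g sigma phi 0 k t eta = chirp_part g k t eta.
Proof.
rewrite GjE /chirp_part /wft; apply: eq_fourier => tau.
by rewrite expr0 mul1r.
Qed.

Lemma Gj1E k t eta : Gj g sigma phi 1 k t eta = chirp_part (g1 g) k t eta.
Proof. by rewrite GjE. Qed.

Lemma Gj2E k t eta : Gj g sigma phi 2 k t eta = chirp_part (g2 g) k t eta.
Proof. by rewrite GjE. Qed.

Lemma is_cderive_chirp_part f k t eta : decays f ->
  is_cderive (chirp_part f k t) eta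
    (- i2pi * (sigma t)%:C * chirp_part (fun u => u%:C * f u) k t eta).
Proof. by move=> df; apply: is_cderive_wft => //; exact: p_chirp. Qed.

Lemma is_cderive_stft f t eta : decays f ->
  is_cderive (stft sigma A phi f t) eta
    (- i2pi * (sigma t)%:C * stft sigma A phi (fun u => u%:C * f u) t eta).
Proof. by move=> df; apply: is_cderive_wft => //; exact: p_signal. Qed.

Lemma is_cderive_res f t eta : decays f ->
  is_cderive (res sigma A phi f t) eta
    (- i2pi * (sigma t)%:C * res sigma A phi (fun u => u%:C * f u) t eta).
Proof.
move=> df; rewrite !resE mulr_sumr.
rewrite (_ : res _ _ _ _ _ = fun eta => \sum_(k < K) wft (sigma t)
  (fun tau => amplitude_part A phi k t tau + phase_part A phi k t tau) f eta).
  apply: is_cderive_sum => k _; apply: is_cderive_wft => //.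
  exact: polybounded_res.
by apply/funext.
Qed.

Lemma ler_cmod_res t eta :
  cmod (res sigma A phi g t eta) <= sigma t * Pi0 g sigma A eps1 eps3 t.
Proof.
rewrite resE; apply: (le_trans (ler_cmod_sum _ _ _)).
have s0 := sigma_gt0 t.
apply: (@le_trans _ _ (\sum_(k < K) (eps1 * sigma t ^+ 1 * absmoment g 1 +
   pi / 3 * eps3 * A k t * sigma t ^+ 3 * absmoment g 3))).
  apply: ler_sum => k _; rewrite wftD//; last 1 first.
  - exact: decays_g.
  apply: (le_trans (ler_cmodD _ _)); apply: lerD.
    apply: ler_cmod_wft => //; first exact: decays_g.
    exact: ler_amplitude_part.
  apply: ler_cmod_wft => //; first exact: decays_g.
  exact: ler_phase_part.
rewrite big_split /= sumr_const card_ord /Pi0.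
rewrite le_eqVlt; apply/orP; left; apply/eqP.
rewrite mulrDr -mulr_natl; congr (_ + _); first by ring.
rewrite !mulr_sumr; apply: eq_bigr => k _; ring.
Qed.

(** The chirp has derivative i2pi (phi_k' + phi_k'' tau) times itself. Of the two factors sigma in
    the last term, one comes from the dilation of the window and the other from tau = sigma u. *)
Lemma chirp_part_cderive k t eta : chirp_part (cderiv g) k t eta =
  i2pi * (eta - dphi phi k t)%:C * (sigma t)%:C * chirp_part g k t eta
  - i2pi * (ddphi phi k t * sigma t ^+ 2)%:C * chirp_part (g1 g) k t eta.
Proof.
pose c1 := i2pi * (dphi phi k t)%:C; pose c2 := i2pi * (ddphi phi k t)%:C.
have p2 : polybounded (fun x => x%:C * chirp phi k t x).
  by apply: polyboundedM; [exact: polybounded_id|exact: p_chirp].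
have pd : polybounded (fun x => c1 * chirp phi k t x +
    c2 * (x%:C * chirp phi k t x)).
  apply: polyboundedD; apply: polyboundedM => //; exact: polybounded_cst.
have := @wft_cderive _ (sigma t) (chirp phi k t) _ g _ eta (sigma_gt0 t)
  (p_chirp k t) pd decays_g decays_dg (is_cderive_chirp phi k t) is_cderive_g.
rewrite -/(chirp_part _ k t eta) => ->.
have pc c : polybounded (fun x => c * chirp phi k t x).
  by apply: polyboundedM; [exact: polybounded_cst|exact: p_chirp].
have pc2 c : polybounded (fun x => c * (x%:C * chirp phi k t x)).
  by apply: polyboundedM; [exact: polybounded_cst|].
rewrite wftD//; last exact: decays_g.
rewrite !wftZ//; try exact: decays_g.
have -> : wft (sigma t) (fun x => x%:C * chirp phi k t x) g eta =
    (sigma t)%:C * chirp_part (g1 g) k t eta.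
  rewrite /chirp_part -wftZ//; last exact: decays_g1.
  rewrite /wft; apply: eq_fourier => x; rewrite /g1 real_complexM.
  have e : (sigma t)%:C * ((sigma t)^-1)%:C = 1 :> R[i].
    by rewrite -real_complexM divff// gt_eqF.
  have -> : (sigma t)%:C * chirp phi k t x * ((sigma t)^-1)%:C *
     (x%:C * ((sigma t)^-1)%:C * g (x / sigma t)) =
     (sigma t)%:C * ((sigma t)^-1)%:C * (x%:C * chirp phi k t x *
       ((sigma t)^-1)%:C * g (x / sigma t)) by ring.
  by rewrite e mul1r.
rewrite -/(chirp_part g k t eta) /c1 /c2 !(real_complexB, real_complexM).
ring.
Qed.

End Stft.

(** * Differentiation in time *)

Section TimeDerivative.
Context {R : realType}.

Lemma cint_shift (f : R -> R[i]) (s : R) : cintegrable setT f ->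
  cintegrable setT (fun y => f (y - s)) /\
  cint setT (fun y => f (y - s)) = cint setT f.
Proof.
have E y : y - s = 1 * y + - s :> R by rewrite mul1r.
under eq_fun do rewrite E.
move=> [i1 i2]; split.
  by split; [exact: (integrable_affine (- s) ltr01 i1)|
             exact: (integrable_affine (- s) ltr01 i2)].
apply: eq_ReIm; rewrite /cint /=.
  by rewrite (Rintegral_affine (- s) ltr01 i1) invr1 mul1r.
by rewrite (Rintegral_affine (- s) ltr01 i2) invr1 mul1r.
Qed.

Lemma polybounded_shift (x : R -> R[i]) (s : R) : polybounded x ->
  polybounded (fun tau => x (s + tau)).
Proof.
move=> px; split.
  apply: ccontinuous_comp; first by case: px.
  by move=> y; apply: cvgD; [exact: cvg_cst|exact: cvg_id].
have [m [M [M0 H]]] := polybounded_ge0 px.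
exists m, (M * (1 + `|s|) ^+ m) => tau; apply: (le_trans (H _)).
rewrite -mulrA ler_wpM2l// -exprMn lerXn2r ?nnegrE ?mulr_ge0 ?addr_ge0//.
have := ler_normD s tau; have : 0 <= `|s| by []; have : 0 <= `|tau| by [].
nra.
Qed.

(** These constants allow a dominating function that does not depend on the time near t. *)
Lemma continuous_local_bounds (sigma dsigma : R -> R) (t : R) :
  continuous sigma -> continuous dsigma -> 0 < sigma t ->
  exists delta c C S : R, [/\ 0 < delta, 0 < c, 0 <= S &
    forall s, `|t - s| < delta ->
      [/\ c <= sigma s, sigma s <= C & `|dsigma s| <= S]].
Proof.
move=> cs cds s0.
have s20 : 0 < sigma t / 2 by rewrite divr_gt0.
have /cvgrPdist_lt/(_ _ s20) h1 := cs t.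
have /cvgrPdist_lt/(_ _ ltr01) h2 := cds t.
have [d /= d0 Hd] := filterI h1 h2.
exists d, (sigma t / 2), (2 * sigma t), (`|dsigma t| + 1); split=> //.
move=> s /Hd[] /=; rewrite !ltr_norml => /andP[a1 a2] a3; split; [lra|lra|].
have := ler_normB (dsigma t) (dsigma t - dsigma s).
rewrite subKr => h; apply: (le_trans h); rewrite lerD2l ltW// ltr_norml.
exact: a3.
Qed.

(** The numerical part of the domination. Here [a] is 1/sigma(s) and [b] its local upper bound, [ds]
    is |sigma'(s)| with local bound [S], [E] is 2 pi |eta|, and [U], [F], [F'] are the moduli of u,
    f(u), f'(u) at u = (y - s)/sigma(s). *)
Lemma ler_kernel_terms (a b S E ds U F F' : R) :
  0 <= a -> a <= b -> 0 <= E -> ds <= S -> 0 <= ds -> 0 <= U ->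
  0 <= F -> 0 <= F' ->
  ds * a ^+ 2 * F + a * (F' * (a + U * ds * a)) + a * F * E <=
  (S * b ^+ 2 + b ^+ 2 + S * b ^+ 2 + b * E) * ((1 + U) * (F + F')).
Proof.
move=> a0 ab E0 dS d0 U0 F0 F'0.
have S0 : 0 <= S by exact: le_trans dS.
have a2 : a ^+ 2 <= b ^+ 2 by rewrite lerXn2r ?nnegrE// (le_trans a0).
have a20 : 0 <= a ^+ 2 by exact: sqr_ge0.
have Sab : ds * a ^+ 2 <= S * b ^+ 2 by exact: ler_pM.
have UF : 0 <= U * F by exact: mulr_ge0.
have UF' : 0 <= U * F' by exact: mulr_ge0.
set P := (1 + U) * (F + F').
have FP : F <= P by rewrite /P; lra.
have F'P : F' <= P by rewrite /P; lra.
have UF'P : U * F' <= P by rewrite /P; lra.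
rewrite !mulrDl.
have -> : a * (F' * (a + U * ds * a)) =
  a ^+ 2 * F' + ds * a ^+ 2 * (U * F') by ring.
have -> : a * F * E = a * E * F by ring.
rewrite addrA; apply: lerD; last first.
  by apply: ler_pM => //; [exact: mulr_ge0|apply: ler_wpM2r].
apply: lerD; last by apply: ler_pM => //; exact: mulr_ge0.
apply: lerD; last by apply: ler_pM.
by apply: ler_pM => //; exact: mulr_ge0.
Qed.

(* Only the window is differentiated: after the substitution
   [y = s + tau] the signal no longer depends on the time [s]. *)
Lemma is_cderive_wft_time (x f df : R -> R[i]) (sigma dsigma : R -> R)
    (t eta : R) :
  polybounded x -> decays f -> decays df ->
  (forall u, is_cderive f u (df u)) ->
  (forall s, 0 < sigma s) -> (forall s : R, is_derive s 1 sigma (dsigma s)) ->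
  continuous dsigma ->
  is_cderive (fun s => wft (sigma s) (fun tau => x (s + tau)) f eta) t
    (- (dsigma t / sigma t)%:C *
       (wft (sigma t) (fun tau => x (t + tau)) f eta +
        wft (sigma t) (fun tau => x (t + tau)) (fun u => u%:C * df u) eta)
     - ((sigma t)^-1)%:C * wft (sigma t) (fun tau => x (t + tau)) df eta
     + i2pi * eta%:C * wft (sigma t) (fun tau => x (t + tau)) f eta).
Proof.
move=> px cf cdf fdf s0 sds cds.
have px' s := polybounded_shift s px.
have cudf : decays (fun u => u%:C * df u).
  exact: decays_polyM polybounded_id cdf.
pose w (y : R) : R[i] := cexpi (- (2 * pi * eta * y)).
pose F s tau := x (s + tau) * ((sigma s)^-1)%:C * f (tau / sigma s) * w tau.
pose k s y := x y * (((sigma s)^-1)%:C * f ((y - s) / sigma s) * w (y - s)).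
(* The derivative in s of the window argument (y - s)/sigma(s). *)
pose du s y : R := - (sigma s)^-1 - (y - s) / sigma s * (dsigma s / sigma s).
pose dk s y := x y * (((- (dsigma s / sigma s ^+ 2))%:C * f ((y - s) / sigma s) +
    ((sigma s)^-1)%:C * (df ((y - s) / sigma s) * (du s y)%:C)) * w (y - s) +
  ((sigma s)^-1)%:C * f ((y - s) / sigma s) *
    (i2pi * eta%:C * w (y - s))).
have FkE s : k s = fun y => F s (y - s).
  by apply/funext => y; rewrite /k /F [s + _]addrC subrK; ring.
have Fi s : cintegrable setT (F s).
  by apply: decays_integrable; apply: decays_wave; exact: decays_wft.
have ki s : cintegrable setT (k s) by rewrite FkE; exact: (cint_shift s (Fi s)).1.
have kE s : wft (sigma s) (fun tau => x (s + tau)) f eta = cint setT (k s).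
  by rewrite FkE (cint_shift s (Fi s)).2.
have kdk s y : is_cderive (k ^~ y) s (dk s y).
  apply: is_cderiveZ.
  have dys : is_derive s 1 (fun z : R => y - z) (-1).
    have := is_derive_affine (-1) y s.
    rewrite (_ : (fun _ => _) = fun z => y - z)//.
    by apply/funext => z; rewrite mulN1r addrC.
  have sV := is_deriveV (lt0r_neq0 (s0 s)) (sds s).
  have dus : is_derive s 1 (fun z => (y - z) / sigma z) (du s y).
    have := is_deriveM dys sV.
    rewrite (_ : (fun y0 : R => y - y0) * (fun y0 : R => (sigma y0)^-1) =
      (fun z => (y - z) / sigma z))//.
    move/is_derive_eq; apply; rewrite /du /GRing.scale /=.
    by field; exact: lt0r_neq0.
  have dw : is_cderive (fun z => w (y - z)) s (i2pi * eta%:C * w (y - s)).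
    have dw' : is_derive s 1 (fun z => - (2 * pi * eta * (y - z))) (2 * pi * eta).
      have := is_derive_affine (2 * pi * eta) (- (2 * pi * eta * y)) s.
      rewrite (_ : (fun _ => _) = (fun z => - (2 * pi * eta * (y - z))))//.
      by apply/funext => z; ring.
    have := is_cderive_cexpi dw'.
    move/is_cderive_eq; apply.
    by rewrite -/(w (y - s)) i2piE !real_complexM real_complex_nat; ring.
  apply: is_cderiveM; last exact: dw.
  have sV' : is_cderive (fun z => ((sigma z)^-1)%:C) s
      (- (dsigma s / sigma s ^+ 2))%:C.
    apply: is_cderive_real; apply: is_derive_eq sV _.
    by rewrite /GRing.scale /= mulNr mulrC.
  apply: (is_cderiveM sV').
  exact: (is_cderive_comp (fdf _) dus).
have [delta [c [C [S [d0 c0 S0 H]]]]] :=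
  continuous_local_bounds (is_derive_continuous sds) cds (s0 t).
have [n [M [M0 HM]]] := polybounded_ge0 px.
(* Of the n + 3 powers, n absorb the growth of x, two pay for the factor 1 + y^2, and one for the
   factor 1 + |u| that [du] brings in. *)
have [N1 N10 HN1] := decays_bound n.+3 cf.
have [N2 N20 HN2] := decays_bound n.+3 cdf.
have C0 : 0 < C.
  have tt : `|t - t| < delta by rewrite subrr normr0.
  by have [_ h _] := H t tt; exact: lt_le_trans (s0 t) h.
(* Chosen so that 1 + |y| <= L (1 + |u|): y = s + sigma(s) u, with |s| <= |t| + delta and sigma(s)
   <= C. *)
pose L := 1 + `|t| + delta + C.
pose K0 := S * c^-1 ^+ 2 + c^-1 ^+ 2 + S * c^-1 ^+ 2 + c^-1 * (2 * pi * `|eta|).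
have K00 : 0 <= K0.
  by rewrite /K0 !addr_ge0 ?mulr_ge0 ?sqr_ge0 ?invr_ge0 ?pi_ge0// ltW.
have L0 : 0 <= L by rewrite /L; have : 0 <= `|t| by []; lra.
pose B := M * L ^+ n.+2 * K0 * (N1 + N2).
have Ia : `]t - delta, t + delta[%classic t.
  by rewrite /= in_itv/= ltrBlDr !ltrDl d0.
have bd s y : `]t - delta, t + delta[%classic s ->
    cmod (dk s y) <= B * (1 + y ^+ 2)^-1.
  rewrite /= in_itv/= => /andP[ts1 ts2].
  have [cs sC dS] : [/\ c <= sigma s, sigma s <= C & `|dsigma s| <= S].
    by apply: H; rewrite ltr_norml; apply/andP; split; lra.
  have p : 0 < 1 + y ^+ 2 by rewrite ltr_wpDr// sqr_ge0.
  rewrite ler_pdivlMr//.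
  set u := (y - s) / sigma s.
  have U0 : 0 <= `|u| by [].
  have ywE : 1 + y ^+ 2 <= (1 + `|y|) ^+ 2.
    rewrite sqrrD -(real_normK (num_real y)) expr1n mul1r addrAC lerDl.
    by rewrite mulrn_wge0.
  have yE : 1 + `|y| <= L * (1 + `|u|).
    have -> : y = s + sigma s * u.
      by rewrite /u mulrC divfK ?gt_eqF// addrC subrK.
    have n1 := ler_normD s (sigma s * u).
    rewrite normrM (gtr0_norm (s0 s)) in n1.
    have n2 : `|s| <= `|t| + delta.
      have : `|s - t| <= delta by rewrite ler_norml; apply/andP; split; lra.
      have := ler_normD (s - t) t; rewrite subrK; lra.
    have n3 : sigma s * `|u| <= C * `|u| by rewrite ler_wpM2r.
    have n4 : 0 <= (1 + `|t| + delta) * `|u|.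
      by rewrite mulr_ge0// !addr_ge0// ltW.
    rewrite /L; have := C0; lra.
  have xE : cmod (x y) * (1 + y ^+ 2) <= M * L ^+ n.+2 * (1 + `|u|) ^+ n.+2.
    apply: (@le_trans _ _ (M * (1 + `|y|) ^+ n * (1 + `|y|) ^+ 2)).
      by apply: ler_pM => //; [exact: cmod_ge0|exact: ltW].
    rewrite -mulrA -exprD addn2 -mulrA -exprMn ler_wpM2l//.
    apply: lerXn2r => //; rewrite nnegrE; first exact: addr_ge0.
    by apply: mulr_ge0 => //; exact: addr_ge0.
  have dkE : cmod (dk s y) <= cmod (x y) *
      (K0 * ((1 + `|u|) * (cmod (f u) + cmod (df u)))).
    rewrite /dk cmodM ler_wpM2l ?cmod_ge0//.
    apply: le_trans (@ler_kernel_terms (sigma s)^-1 c^-1 S (2 * pi * `|eta|)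
      `|dsigma s| `|u| (cmod (f u)) (cmod (df u)) _ _ _ dS _ _ _ _) => //;
      rewrite ?invr_ge0 ?(ltW (s0 s)) ?cmod_ge0//.
    - apply: (le_trans (ler_cmodD _ _)); apply: lerD.
        rewrite cmodM cmod_cexpi mulr1; apply: (le_trans (ler_cmodD _ _)).
        rewrite -/u !cmodM !cmod_real normrN normrM normfV normrX.
        rewrite (gtr0_norm (s0 s)) normfV (gtr0_norm (s0 s)) exprVn lerD//.
        rewrite ler_wpM2l ?invr_ge0 ?(ltW (s0 s))//.
        rewrite ler_wpM2l ?cmod_ge0// /du -/u.
        apply: (le_trans (ler_normB _ _)).
        rewrite normrN normfV !normrM normfV (gtr0_norm (s0 s)).
        by rewrite mulrA.
      rewrite -/u !cmodM cmod_cexpi cmod_i2pi !cmod_real mulr1 normfV.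
      by rewrite (gtr0_norm (s0 s)).
    - by rewrite lef_pV2 ?posrE.
    - by rewrite !mulr_ge0 ?pi_ge0.
  apply: (@le_trans _ _ ((M * L ^+ n.+2 * (1 + `|u|) ^+ n.+2) *
     (K0 * ((1 + `|u|) * (cmod (f u) + cmod (df u)))))).
    apply: (@le_trans _ _ (cmod (x y) * (1 + y ^+ 2) *
      (K0 * ((1 + `|u|) * (cmod (f u) + cmod (df u)))))).
      rewrite -mulrA [(1 + y ^+ 2) * _]mulrC mulrA ler_wpM2r//.
      exact: ltW.
    apply: ler_wpM2r => //; apply: mulr_ge0 => //; apply: mulr_ge0.
      exact: addr_ge0.
    by apply: addr_ge0; exact: cmod_ge0.
  have -> : M * L ^+ n.+2 * (1 + `|u|) ^+ n.+2 *
     (K0 * ((1 + `|u|) * (cmod (f u) + cmod (df u)))) =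
     M * L ^+ n.+2 * K0 * ((1 + `|u|) ^+ n.+3 * cmod (f u) +
       (1 + `|u|) ^+ n.+3 * cmod (df u)) by rewrite [_ ^+ n.+3]exprS; ring.
  apply: ler_wpM2l; last exact: lerD.
  by apply: mulr_ge0 => //; apply: mulr_ge0 => //; exact: exprn_ge0.
have -> : (fun s => wft (sigma s) (fun tau => x (s + tau)) f eta) =
    (fun s => cint setT (k s)) by exact/funext.
have := @is_cderive_under_cint R setT k dk (fun y => B * (1 + y ^+ 2)^-1) t _ _
  measurableT Ia (fun s _ => ki s) (fun s y _ _ => kdk s y)
  (integrableZl_fin B measurableT (@integrable_oneDsqrV R)) (fun s y Is _ => bd s y Is).
move/is_cderive_eq; apply.
(* At s = t the substitution is undone; the differentiated integrand becomes a combination of the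
   kernels for the windows f, u f' and f'. *)
pose ker h tau := x (t + tau) * ((sigma t)^-1)%:C * h (tau / sigma t).
have cker h : decays h -> decays (ker h) by move=> dh; exact: decays_wft.
pose c1 := i2pi * eta%:C - (dsigma t / sigma t)%:C.
pose c2 := - (dsigma t / sigma t)%:C : R[i].
pose c3 := - ((sigma t)^-1)%:C : R[i].
pose h tau := c1 * ker f tau + c2 * ker (fun u => u%:C * df u) tau + c3 * ker df tau.
have hz a d : decays d -> decays (fun tau => a * ker d tau).
  by move=> dd; apply: decaysZ; exact: cker.
have dh12 : decays (fun tau => c1 * ker f tau +
  c2 * ker (fun u => u%:C * df u) tau) by apply: decaysD; exact: hz.
have dh : decays h by apply: decaysD => //; exact: hz.
transitivity (fourier h eta).
  have hi := decays_integrable (decays_wave eta dh).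
  rewrite /fourier -(cint_shift t hi).2; apply: eq_cint => y _.
  rewrite /dk /h /ker -/(w (y - t)) [t + _]addrC subrK.
  have s_ := lt0r_neq0 (s0 t).
  rewrite /du /c1 /c2 /c3.
  have -> : (- (dsigma t / sigma t ^+ 2))%:C =
      - (dsigma t / sigma t)%:C * ((sigma t)^-1)%:C :> R[i].
    by rewrite -real_complexN -real_complexM; congr (_%:C); field.
  rewrite !(real_complexB, real_complexN, real_complexM).
  ring.
rewrite /h fourierD//; last exact: hz.
rewrite fourierD//; [|exact: hz..].
rewrite !fourierZ//; [|exact: cker..].
by rewrite -![fourier (ker _) _]/(wft _ _ _ _) /c1 /c2 /c3; ring.
Qed.

End TimeDerivative.

(** * The second-order phase transformation *)

Section SecondOrderAlgebra.
Context {R : realType}.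

Let nz (s : R) : s != 0 -> s%:C != 0 :> R[i].
Proof. by rewrite real_complex_eq0. Qed.

(** The contribution of one component l after integration by parts, recentred at the index k: [pl],
    [ql] and [pk], [qk] are the first and second phase derivatives of l and k. The differences that
    remain are the summands of B_k and D_k. *)
Lemma chirp_coefficients (i x c0 c1 : R[i]) (s e pk pl qk ql : R) : s != 0 ->
  i * e%:C * (x * c0) - (s^-1)%:C * (x * (i * (e - pl)%:C * s%:C * c0
    - i * (ql * s ^+ 2)%:C * c1)) =
  i * pk%:C * (x * c0) + i * (s * qk)%:C * (x * c1) +
  i * (x * (pl - pk)%:C * c0) + i * s%:C * (x * (ql - qk)%:C * c1).
Proof.
move=> /nz s0; rewrite real_complexV !real_complexB !real_complexM.
by field.
Qed.

(** The hypothesis is the identity for the chirp sums alone. Adding the residuals [r0], [r1], [rd]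
    of the windows g, g1, g' to the sums [c0], [c1], [cd] leaves exactly the residual terms of
    Res_1. *)
Lemma residual_coefficients (i c0 c1 cd b d r0 r1 rd dl v3 : R[i])
    (s e p q : R) : s != 0 ->
  i * e%:C * c0 - (s^-1)%:C * cd =
    i * p%:C * c0 + i * (s * q)%:C * c1 + i * b + i * s%:C * d ->
  - dl * (c0 + r0 + v3) - (s^-1)%:C * (cd + rd) + i * e%:C * (c0 + r0) =
  i * p%:C * (c0 + r0) + i * (s * q)%:C * (c1 + r1) +
  (i * b + i * s%:C * d + i * (e - p)%:C * r0 - rd / s%:C -
   i * (q * s)%:C * r1) - dl * (c0 + r0 + v3).
Proof.
move=> /nz s0; rewrite real_complexV !real_complexB !real_complexM => key.
have -> : cd = s%:C * (i * e%:C * c0 -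
    (i * p%:C * c0 + i * (s%:C * q%:C) * c1 + i * b + i * s%:C * d)).
  by rewrite -key; field.
by field.
Qed.

(** The coefficients of Res_2 come from 4 pi^2 = -(i2pi)^2, each differentiation in eta contributing
    the factor -i2pi sigma. *)
Lemma residual_derivative (ee f r0 r1 r2 r3 : R[i]) (s p q e : R) : s != 0 ->
  i2pi * (- i2pi * s%:C * ee) + i2pi * s%:C * (- i2pi * s%:C * f) +
  (i2pi * r0 + i2pi * (e - p)%:C * (- i2pi * s%:C * r1)) -
  (- i2pi * s%:C * r3 * (s%:C)^-1 + 0) -
  i2pi * (q * s)%:C * (- i2pi * s%:C * r2) =
  (4 * pi ^+ 2 * s)%:C * ee + (4 * pi ^+ 2 * s ^+ 2)%:C * f + i2pi * r0 +
  (4 * pi ^+ 2 * (e - p) * s)%:C * r1 + i2pi * r3 -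
  (4 * pi ^+ 2 * q * s ^+ 2)%:C * r2.
Proof.
move=> /nz s0.
have e4 : (4 * pi ^+ 2)%:C = - (i2pi * i2pi) :> R[i].
  by apply: eq_ReIm; rewrite !ReImE /=; ring.
have e4M (a : R) : (4 * pi ^+ 2 * a)%:C = - (i2pi * i2pi) * a%:C.
  by rewrite real_complexM e4.
rewrite -!(mulrA (4 * pi ^+ 2)) !e4M !(real_complexM, real_complexB).
by move: i2pi => i; field.
Qed.

(** Here d and d' are the time derivative of V and its derivative in eta, with [p] = phi_k' and [a]
    = sigma phi_k''. Dividing d by v and differentiating, the braces in P_0 reduce to i a (v1/v)' +
    (r1/v)': the constant i p disappears and the v3 terms cancel. Hence P_0 is i a plus
    (r1/v)'/(v1/v)', the latter being Res_3, and i a then cancels in omega. *)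
Lemma reassignment_identity (i v v' v1 v1' v3 v3' dl r1 r2 p a : R[i]) :
  i != 0 -> v != 0 -> v1' * v - v1 * v' != 0 ->
  let d := i * p * v + i * a * v1 + r1 - dl * (v + v3) in
  let d' := i * p * v' + i * a * v1' + r2 - dl * (v' + v3') in
  dl / i + d / (i * v) - v1 / (i * v) *
    (((v1' * v - v1 * v') / v ^+ 2)^-1 * ((d' * v - d * v') / v ^+ 2 +
      dl * ((v3' * v - v3 * v') / v ^+ 2))) + dl * (v3 / (i * v)) - p =
  r1 / (i * v) - v1 * ((v * r2 - v' * r1) / (v * v1' - v1 * v')) / (i * v).
Proof.
move=> i0 v0 N0 /=.
have N0' : v * v1' - v1 * v' != 0 by rewrite mulrC.
by field; rewrite ?N0 ?N0' ?v0 ?i0.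
Qed.

End SecondOrderAlgebra.

(** * The time derivative of V and the exact phase error *)

Section SecondOrder.
Context {R : realType} {K : nat}.
Variables (g : R -> R[i]) (sigma : R -> R) (A phi : 'I_K -> R -> R).
Variables (eps1 eps3 : R).
Hypothesis g_schwartz : schwartz g.
Hypothesis sigma_gt0 : forall t, 0 < sigma t.
Hypothesis sigma_C1 : class_Cn 1 sigma.
Hypothesis A_C2 : forall k, class_Cn 2 (A k).
Hypothesis phi_C3 : forall k, class_Cn 3 (phi k).
Hypothesis A_lip : forall k t, `|derive1 (A k) t| <= eps1.
Hypothesis phi_3 : forall k t, `|derive1n 3 (phi k) t| <= eps3.
Hypothesis A_gt0 : forall k t, 0 < A k t.
Implicit Types (k : 'I_K) (t eta : R) (f : R -> R[i]).

Local Notation V := (V g sigma A phi).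
Local Notation V1 := (V1 g sigma A phi).
Local Notation V3 := (V3 g sigma A phi).
Local Notation Vd := (stft sigma A phi (cderiv g)).
Local Notation res := (res sigma A phi).
Local Notation x_ := (component A phi).
Local Notation dls := (dlogsigma sigma).

Let g1E : g1 g = fun u => u%:C * g u. Proof. by []. Qed.
Let g3E : g3 g = fun u => u%:C * cderiv g u. Proof. by []. Qed.

Local Opaque dphi ddphi chirp_part component cderiv i2pi g1 g2 g3.

Lemma is_derive_sigma (s : R) : is_derive s 1 sigma (derive1 sigma s).
Proof.
have [/(_ 0%N isT s) h _] := sigma_C1.
by apply: DeriveDef; [exact: h|rewrite -derive1E].
Qed.

Lemma continuous_dsigma : continuous (derive1 sigma).
Proof. by have [_ h] := sigma_C1; exact: h. Qed.

Lemma dtVE t eta : dt V t eta =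
  - dls t * (V t eta + V3 t eta) - ((sigma t)^-1)%:C * Vd t eta
  + i2pi * eta%:C * V t eta.
Proof.
apply: is_cderiveE.
have px : polybounded (signal A phi).
  have := polybounded_signal A_C2 phi_C3 A_lip A_gt0 0.
  by under eq_fun do rewrite add0r.
exact: (is_cderive_wft_time t eta px (decays_g g_schwartz)
  (decays_dg g_schwartz) (is_cderive_g g_schwartz) sigma_gt0 is_derive_sigma
  continuous_dsigma).
Qed.

Let split f t eta : decays f -> stft sigma A phi f t eta =
  \sum_(k < K) x_ k t * chirp_part sigma phi f k t eta + res f t eta.
Proof. exact: (stft_split sigma_gt0 A_C2 phi_C3 A_lip phi_3 A_gt0). Qed.

(** In B_k, D_k, E_k and F_k the term l = k would contain a vanishing difference, so these sums may
    run over all l and combine with the full sums in V. *)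
Lemma sum_neq (k : 'I_K) (F : 'I_K -> R[i]) : F k = 0 ->
  \sum_(l < K | l != k) F l = \sum_(l < K) F l.
Proof. by move=> Fk; rewrite [RHS](bigD1 k)//= Fk add0r. Qed.

Lemma BkE k t eta : Bk g sigma A phi k t eta = \sum_(l < K)
  x_ l t * (dphi phi l t - dphi phi k t)%:C * chirp_part sigma phi g l t eta.
Proof.
rewrite /Bk sum_neq; last by rewrite subrr mulr0 mul0r.
by apply: eq_bigr => l _; rewrite Gj0E.
Qed.

Lemma DkE k t eta : Dk g sigma A phi k t eta = \sum_(l < K)
  x_ l t * (ddphi phi l t - ddphi phi k t)%:C *
    chirp_part sigma phi (g1 g) l t eta.
Proof.
rewrite /Dk sum_neq; last by rewrite subrr mulr0 mul0r.
by apply: eq_bigr => l _; rewrite Gj1E.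
Qed.

Lemma EkE k t eta : Ek g sigma A phi k t eta = \sum_(l < K)
  x_ l t * (dphi phi l t - dphi phi k t)%:C *
    chirp_part sigma phi (g1 g) l t eta.
Proof.
rewrite /Ek sum_neq; last by rewrite subrr mulr0 mul0r.
by apply: eq_bigr => l _; rewrite Gj1E.
Qed.

Lemma FkE k t eta : Fk g sigma A phi k t eta = \sum_(l < K)
  x_ l t * (ddphi phi l t - ddphi phi k t)%:C *
    chirp_part sigma phi (g2 g) l t eta.
Proof.
rewrite /Fk sum_neq; last by rewrite subrr mulr0 mul0r.
by apply: eq_bigr => l _; rewrite Gj2E.
Qed.

Lemma dtV_Res1 k t eta : dt V t eta =
  i2pi * (dphi phi k t)%:C * V t eta
  + i2pi * (sigma t * ddphi phi k t)%:C * V1 t eta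
  + Res1 g sigma A phi k t eta - dls t * (V t eta + V3 t eta).
Proof.
rewrite dtVE /Res1 BkE DkE.
have dg := decays_g g_schwartz.
have -> : Vd t eta = _ := split t eta (decays_dg g_schwartz).
have -> : V t eta = _ := split t eta dg.
have -> : V1 t eta = _ := split t eta (decays_g1 g_schwartz).
set S0 := \sum_(l < K) x_ l t * chirp_part sigma phi g l t eta.
set S1 := \sum_(l < K) x_ l t * chirp_part sigma phi (g1 g) l t eta.
set Sd := \sum_(l < K) x_ l t * chirp_part sigma phi (cderiv g) l t eta.
set SB := \sum_(l < K) _ * _ * chirp_part sigma phi g l t eta.
set SD := \sum_(l < K) _ * _ * chirp_part sigma phi (g1 g) l t eta.
(* Summand by summand this is the integration by parts against the l-th chirp, recentred at k. *)
have key : i2pi * eta%:C * S0 - ((sigma t)^-1)%:C * Sd =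
   i2pi * (dphi phi k t)%:C * S0 + i2pi * (sigma t * ddphi phi k t)%:C * S1 +
   i2pi * SB + i2pi * (sigma t)%:C * SD.
  rewrite /S0 /S1 /Sd /SB /SD !mulr_sumr -sumrB -!big_split /=.
  apply: eq_bigr => l _.
  rewrite (chirp_part_cderive phi g_schwartz sigma_gt0).
  exact/chirp_coefficients/lt0r_neq0.
exact: residual_coefficients (lt0r_neq0 (sigma_gt0 t)) key.
Qed.

Let dchirp f k t eta (df : decays f) :=
  is_cderive_chirp_part phi sigma_gt0 k t eta df.

(** Up to the factor -i2pi sigma, differentiation multiplies the window by u: B_k turns into E_k,
    D_k into F_k, and the residuals for g, g1, g' into those for g1, g2, g3. The factor eta - phi_k'
    contributes one more term in res_0. *)
Lemma is_cderive_Res1 k t eta :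
  is_cderive (Res1 g sigma A phi k t) eta (Res2 g sigma A phi k t eta).
Proof.
have dg := decays_g g_schwartz; have dg1 := decays_g1 g_schwartz.
have dres f : decays f -> is_cderive (res f t) eta
    (- i2pi * (sigma t)%:C * res (fun u => u%:C * f u) t eta).
  exact: (is_cderive_res sigma_gt0 A_C2 phi_C3 A_lip phi_3 A_gt0).
have dB : is_cderive (Bk g sigma A phi k t) eta
    (- i2pi * (sigma t)%:C * Ek g sigma A phi k t eta).
  rewrite EkE mulr_sumr.
  rewrite (_ : Bk _ _ _ _ _ _ = fun eta => \sum_(l < K) x_ l t *
    (dphi phi l t - dphi phi k t)%:C * chirp_part sigma phi g l t eta).
    apply: is_cderive_sum => l _; apply: is_cderive_eq.
      by apply: is_cderiveZ; exact: dchirp.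
    by rewrite -g1E [RHS]mulrCA.
  by apply/funext => e; rewrite BkE.
have dD : is_cderive (Dk g sigma A phi k t) eta
    (- i2pi * (sigma t)%:C * Fk g sigma A phi k t eta).
  rewrite FkE mulr_sumr.
  rewrite (_ : Dk _ _ _ _ _ _ = fun eta => \sum_(l < K) x_ l t *
    (ddphi phi l t - ddphi phi k t)%:C * chirp_part sigma phi (g1 g) l t eta).
    apply: is_cderive_sum => l _; apply: is_cderive_eq.
      by apply: is_cderiveZ; exact: dchirp.
    by rewrite -g2E [RHS]mulrCA.
  by apply/funext => e; rewrite DkE.
have did : is_cderive (fun e => i2pi * (e - dphi phi k t)%:C) eta i2pi.
  have h : is_derive eta 1 (fun e : R => e - dphi phi k t) 1.
    have := is_derive_affine 1 (- dphi phi k t) eta.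
    rewrite (_ : (fun _ => _) = fun e => e - dphi phi k t)//.
    by apply/funext => e; rewrite mul1r.
  by have := is_cderiveZ i2pi (is_cderive_real h); rewrite mulr1.
rewrite /Res1.
apply: is_cderive_eq.
  apply: is_cderiveB.
    apply: is_cderiveB.
      apply: is_cderiveD.
        apply: is_cderiveD; apply: is_cderiveZ; [exact: dB|exact: dD].
      by apply: is_cderiveM; [exact: did|exact: dres].
    apply: is_cderiveM; first exact: dres (decays_dg g_schwartz).
    exact: is_cderive_cst.
  by apply: is_cderiveZ; exact: dres dg1.
rewrite mulr0 -g1E -g3E -g2E /Res2.
exact/residual_derivative/lt0r_neq0.
Qed.

Lemma is_cderive_V t eta : is_cderive (V t) eta (deta V t eta).
Proof.
have h := is_cderive_stft sigma_gt0 A_C2 phi_C3 A_lip A_gt0 t eta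
  (decays_g g_schwartz).
by rewrite /deta (is_cderiveE h); exact: h.
Qed.

Lemma is_cderive_V1 t eta : is_cderive (V1 t) eta (deta V1 t eta).
Proof.
have h := is_cderive_stft sigma_gt0 A_C2 phi_C3 A_lip A_gt0 t eta
  (decays_g1 g_schwartz).
by rewrite /deta (is_cderiveE h); exact: h.
Qed.

Lemma is_cderive_V3 t eta : is_cderive (V3 t) eta (deta V3 t eta).
Proof.
have h := is_cderive_stft sigma_gt0 A_C2 phi_C3 A_lip A_gt0 t eta
  (decays_g3 g_schwartz).
by rewrite /deta (is_cderiveE h); exact: h.
Qed.

Lemma deta_ratio1E t eta : V t eta != 0 -> deta (ratio1 g sigma A phi) t eta =
  (deta V1 t eta * V t eta - V1 t eta * deta V t eta) / V t eta ^+ 2.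
Proof.
move=> V0; apply: is_cderiveE.
exact: is_cderive_div V0 (is_cderive_V1 t eta) (is_cderive_V t eta).
Qed.

Lemma omega_c_Res4 k t eta : V t eta != 0 ->
  deta (ratio1 g sigma A phi) t eta != 0 ->
  omega_c g sigma A phi t eta - (dphi phi k t)%:C =
  Res4 g sigma A phi k t eta.
Proof.
move=> V0 r0.
have rE := deta_ratio1E V0.
have N0 : deta V1 t eta * V t eta - V1 t eta * deta V t eta != 0.
  by apply: contra r0; rewrite rE => /eqP ->; rewrite mul0r.
have i0 : i2pi != 0 :> R[i] := i2pi_neq0.
have dV := is_cderive_V t eta.
have dV1 := is_cderive_V1 t eta.
have dV3 := is_cderive_V3 t eta.
pose d0 := i2pi * (dphi phi k t)%:C * deta V t eta
  + i2pi * (sigma t * ddphi phi k t)%:C * deta V1 t eta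
  + Res2 g sigma A phi k t eta - dls t * (deta V t eta + deta V3 t eta).
(* For fixed k the formula for the time derivative holds at every eta, inside the zone or not, and
   so can be differentiated in eta. *)
have ddt : is_cderive (dt V t) eta d0.
  rewrite (_ : dt V t = fun e => i2pi * (dphi phi k t)%:C * V t e
    + i2pi * (sigma t * ddphi phi k t)%:C * V1 t e
    + Res1 g sigma A phi k t e - dls t * (V t e + V3 t e)).
    apply: is_cderiveB.
      apply: is_cderiveD; last exact: is_cderive_Res1.
      by apply: is_cderiveD; apply: is_cderiveZ; [exact: dV|exact: dV1].
    by apply: is_cderiveZ; apply: is_cderiveD; [exact: dV|exact: dV3].
  by apply/funext => e; exact: dtV_Res1.
have q1 : deta (fun s e => dt V s e / V s e) t eta =
    (d0 * V t eta - dt V t eta * deta V t eta) / V t eta ^+ 2.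
  by apply: is_cderiveE; exact: is_cderive_div V0 ddt dV.
have q3 : deta (fun s e => V3 s e / V s e) t eta =
    (deta V3 t eta * V t eta - V3 t eta * deta V t eta) / V t eta ^+ 2.
  by apply: is_cderiveE; exact: is_cderive_div V0 dV3 dV.
rewrite /omega_c /P0 q1 q3 rE /Res4 /Res3 /d0 (dtV_Res1 k).
exact: reassignment_identity.
Qed.

End SecondOrder.

(** * Zones and the size of the phase error *)

Section Zones.
Context {R : realType} {K : nat}.
Variables (g : R -> R[i]) (sigma : R -> R) (A phi : 'I_K -> R -> R).
Variables (eps1 eps3 : R).
Hypothesis g_schwartz : schwartz g.
Hypothesis sigma_gt0 : forall t, 0 < sigma t.
Hypothesis sigma_C1 : class_Cn 1 sigma.
Hypothesis A_C2 : forall k, class_Cn 2 (A k).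
Hypothesis phi_C3 : forall k, class_Cn 3 (phi k).
Hypothesis A_lip : forall k t, `|derive1 (A k) t| <= eps1.
Hypothesis phi_3 : forall k t, `|derive1n 3 (phi k) t| <= eps3.
Hypothesis A_gt0 : forall k t, 0 < A k t.
Implicit Types (k : 'I_K) (t eta : R) (f : R -> R[i]).

Local Notation V := (V g sigma A phi).
Local Notation V1 := (V1 g sigma A phi).
Local Notation x_ := (component A phi).
Local Notation G := (Gk g sigma phi).

Definition chirped k t (tau : R) : R[i] :=
  cexpi (pi * sigma t ^+ 2 * ddphi phi k t * tau ^+ 2) * g tau.

Lemma polybounded_quadratic (c : R) :
  polybounded (fun tau : R => cexpi (c * tau ^+ 2)).
Proof.
by apply: polybounded_cexpi; apply: is_derive_continuous => x.
Qed.

Lemma decays_chirped k t : decays (chirped k t).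
Proof.
by apply: decays_polyM; [exact: polybounded_quadratic|exact: decays_g].
Qed.

(** Under tau = sigma u the linear part of the chirp phase joins the wave and shifts its frequency,
    while the quadratic part becomes pi sigma^2 phi_k'' u^2. *)
Lemma chirp_part_Gk k t eta :
  chirp_part sigma phi g k t eta = G k t (sigma t * (eta - dphi phi k t)).
Proof.
have s0 := sigma_gt0 t; have s_ := lt0r_neq0 s0.
have s10 : 0 < (sigma t)^-1 by rewrite invr_gt0.
set xi := sigma t * _.
have di := decays_integrable (decays_wave xi (decays_chirped k t)).
set F := fun tau : R => _ in di.
have [i1 i2] := di.
have cF : cintegrable setT (fun y => F ((sigma t)^-1 * y + 0)).
  by split; [exact: (integrable_affine 0 s10 i1)|
             exact: (integrable_affine 0 s10 i2)].
transitivity (((sigma t)^-1)%:C * cint setT (fun y => F ((sigma t)^-1 * y + 0))).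
  rewrite -cintZ// /chirp_part /wft /fourier; apply: eq_cint => y _.
  rewrite /F /chirped addr0 [(sigma t)^-1 * y]mulrC.
  have -> : chirp phi k t y * ((sigma t)^-1)%:C * g (y / sigma t) *
      cexpi (- (2 * pi * eta * y)) = ((sigma t)^-1)%:C * (g (y / sigma t) *
      (chirp phi k t y * cexpi (- (2 * pi * eta * y)))) by ring.
  congr (_ * _).
  rewrite /chirp [RHS]mulrAC [RHS]mulrC -!cexpiD; congr (_ * cexpi _).
  by rewrite /xi; field.
rewrite (_ : cint _ _ = (sigma t)%:C * G k t xi).
  by rewrite mulrA -real_complexM mulVf// mul1r.
rewrite -[RHS]addr0; apply: eq_ReIm.
  by rewrite addr0 cReM /= mul0r subr0 (Rintegral_affine 0 s10 i1) invrK.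
by rewrite addr0 cImM /= mul0r addr0 (Rintegral_affine 0 s10 i2) invrK.
Qed.

Lemma Gj0_Gk k t eta :
  Gj g sigma phi 0 k t eta = G k t (sigma t * (eta - dphi phi k t)).
Proof. by rewrite Gj0E// chirp_part_Gk. Qed.

Lemma V_split t eta : V t eta =
  \sum_(k < K) x_ k t * Gj g sigma phi 0 k t eta + res sigma A phi g t eta.
Proof.
rewrite [LHS](stft_split sigma_gt0 A_C2 phi_C3 A_lip phi_3 A_gt0 _ _
  (decays_g g_schwartz)).
by congr (_ + _); apply: eq_bigr => k _; rewrite Gj0E//.
Qed.

Lemma cmod_component k t : cmod (x_ k t) = A k t.
Proof.
by rewrite /component cmodM cmod_cexpi mulr1 cmod_real gtr0_norm.
Qed.

Lemma zone_cover (tau0 e1 t eta : R) :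
  tau0 * \sum_(k < K) A k t + sigma t * Pi0 g sigma A eps1 eps3 t <= e1 ->
  e1 < cmod (V t eta) -> exists k, zone g sigma phi tau0 k (t, eta).
Proof.
move=> He1 HV; apply: contrapT => /forallNP nz.
move: HV; apply/negP; rewrite -leNgt (le_trans _ He1)// V_split.
apply: (le_trans (ler_cmodD _ _)); apply: lerD; last first.
  exact: (ler_cmod_res g_schwartz sigma_gt0 A_C2 phi_C3 A_lip phi_3 A_gt0).
apply: (le_trans (ler_cmod_sum _ _ _)); rewrite mulr_sumr.
apply: ler_sum => k _; rewrite cmodM cmod_component mulrC.
rewrite ler_wpM2r ?(ltW (A_gt0 k t))// Gj0_Gk leNgt; apply/negP.
exact: nz.
Qed.

Definition bound_term (e1 e2 : R) k t eta : R :=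
  cmod (Res1 g sigma A phi k t eta) / (2 * pi * e1)
  + (2 * pi * e1 ^+ 3 * e2)^-1 * cmod (V1 t eta)
    * (cmod (deta V t eta) * cmod (Res1 g sigma A phi k t eta)
       + e1 * cmod (Res2 g sigma A phi k t eta)).

Lemma bound_term_ge0 (e1 e2 : R) k t eta : 0 < e1 -> 0 < e2 ->
  0 <= bound_term e1 e2 k t eta.
Proof.
move=> e10 e20; have p0 : 0 <= pi :> R by exact: pi_ge0.
apply: addr_ge0.
  by rewrite divr_ge0 ?cmod_ge0// !mulr_ge0// ltW.
rewrite !mulr_ge0 ?addr_ge0 ?mulr_ge0 ?cmod_ge0 ?invr_ge0 ?mulr_ge0//;
  by rewrite ?exprn_ge0// ltW.
Qed.

(** The factor e1/v is kept rather than replaced by 1, because the strict inequality of (b) depends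
    on it. In the application [p] = 2 pi, [a] and [b] are |Res_1| and |Res_2|, [d] and [m] the
    moduli of dV/deta and V^{g1}, and [v], [q] the two quantities above the thresholds e1, e2. *)
Lemma ler_reassignment_error (p a b d m v q e1 e2 : R) : 0 < p -> 0 < e1 ->
  0 < e2 -> 0 <= a -> 0 <= b -> 0 <= d -> 0 <= m -> e1 < v -> e2 < q ->
  a / (p * v) + m * ((v * b + d * a) / (q * v ^+ 2)) / (p * v) <=
  e1 / v * (a / (p * e1) + (p * e1 ^+ 3 * e2)^-1 * m * (d * a + e1 * b)).
Proof.
move=> p0 e10 e20 a0 b0 d0 m0 ev eq.
have v0 : 0 < v by exact: lt_trans ev.
have q0 : 0 < q by exact: lt_trans eq.
have [v_ q_ p_ e1_ e2_] := And5 (lt0r_neq0 v0) (lt0r_neq0 q0) (lt0r_neq0 p0)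
  (lt0r_neq0 e10) (lt0r_neq0 e20).
have -> : e1 / v * (a / (p * e1) +
    (p * e1 ^+ 3 * e2)^-1 * m * (d * a + e1 * b)) =
    a / (p * v) + m / (p * v) * (b / (e1 * e2) + d * a / (e1 ^+ 2 * e2)).
  by field; rewrite ?v_ ?p_ ?e1_ ?e2_.
have -> : m * ((v * b + d * a) / (q * v ^+ 2)) / (p * v) =
    m / (p * v) * (b / (v * q) + d * a / (v ^+ 2 * q)).
  by field; rewrite ?v_ ?p_ ?q_.
rewrite lerD2l; apply: ler_wpM2l.
  by rewrite divr_ge0// mulr_ge0// ltW.
have v2 : e1 ^+ 2 <= v ^+ 2 by rewrite lerXn2r ?nnegrE// ltW.
apply: lerD; apply: ler_wpM2l => //.
- rewrite lef_pV2 ?posrE ?mulr_gt0//.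
  by apply: ler_pM; rewrite ltW.
- exact: mulr_ge0.
- rewrite lef_pV2 ?posrE ?mulr_gt0 ?exprn_gt0//.
  by apply: ler_pM => //; rewrite ?exprn_ge0 ?ltW.
Qed.

(** The denominator of Res_3 is V^2 times the eta-derivative of V^{g1}/V, so the two thresholds
    bound it from below. *)
Lemma ler_Res4 (e1 e2 : R) k t eta : 0 < e1 -> 0 < e2 ->
  e1 < cmod (V t eta) -> e2 < cmod (deta (ratio1 g sigma A phi) t eta) ->
  cmod (Res4 g sigma A phi k t eta) <=
  e1 / cmod (V t eta) * bound_term e1 e2 k t eta.
Proof.
move=> e10 e20 HV HR.
have V0 : V t eta != 0 by rewrite -cmod_gt0; exact: lt_trans HV.
have p0 : 0 < 2 * pi :> R by rewrite mulr_gt0 ?pi_gt0.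
have rE := deta_ratio1E g_schwartz sigma_gt0 A_C2 phi_C3 A_lip A_gt0 V0.
have NE : cmod (V t eta * deta V1 t eta - V1 t eta * deta V t eta) =
    cmod (deta (ratio1 g sigma A phi) t eta) * cmod (V t eta) ^+ 2.
  rewrite rE cmodM cmodV expr2 [cmod (V t eta * V t eta)]cmodM.
  rewrite [V t eta * _]mulrC divfK// mulf_neq0//.
    by rewrite cmod_eq0.
  by rewrite cmod_eq0.
have := ler_reassignment_error p0 e10 e20
  (cmod_ge0 (Res1 g sigma A phi k t eta))
  (cmod_ge0 (Res2 g sigma A phi k t eta)) (cmod_ge0 (deta V t eta))
  (cmod_ge0 (V1 t eta)) HV HR.
apply: le_trans; rewrite /Res4; apply: (le_trans (ler_cmodB _ _)).
rewrite !cmodM !cmodV !cmodM cmod_i2pi; apply: lerD => //.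
rewrite NE.
apply: ler_wpM2r.
  by rewrite invr_ge0 mulr_ge0 ?cmod_ge0// ltW.
apply: ler_wpM2l; first exact: cmod_ge0.
apply: ler_wpM2r.
  by rewrite invr_ge0 mulr_ge0 ?exprn_ge0 ?cmod_ge0.
by apply: (le_trans (ler_cmodB _ _)); rewrite !cmodM.
Qed.

Lemma bound_term_Bd1 (tau0 e1 e2 : R) k t eta :
  zone g sigma phi tau0 k (t, eta) ->
  ((bound_term e1 e2 k t eta)%:E <= Bd1 g sigma A phi tau0 e1 e2 t)%E.
Proof.
move=> zk; rewrite /Bd1.
pose S l := ereal_sup [set (bound_term e1 e2 l t e)%:E |
  e in zone_at g sigma phi tau0 l t].
apply: (@le_trans _ _ (S k)); last exact: (le_bigmax _ S k).
by apply: ereal_sup_ubound; exists eta.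
Qed.

(** The error is at most e1/|V| < 1 times the bound at this eta. If that bound is positive,
    strictness follows at once; if it is 0, the error is 0 as well and the positivity of [Bd1] is
    used. *)
Lemma omega_error (tau0 e1 e2 : R) k t eta : 0 < e1 -> 0 < e2 ->
  e1 < cmod (V t eta) -> e2 < cmod (deta (ratio1 g sigma A phi) t eta) ->
  zone g sigma phi tau0 k (t, eta) ->
  [/\ omega_c g sigma A phi t eta - (dphi phi k t)%:C =
        Res4 g sigma A phi k t eta,
      (`|omega g sigma A phi t eta - dphi phi k t|%:E <=
         Bd1 g sigma A phi tau0 e1 e2 t)%E &
      (0 < Bd1 g sigma A phi tau0 e1 e2 t)%E ->
      (`|omega g sigma A phi t eta - dphi phi k t|%:E <
         Bd1 g sigma A phi tau0 e1 e2 t)%E].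
Proof.
move=> e10 e20 HV HR zk.
have V0 : V t eta != 0 by rewrite -cmod_gt0; exact: lt_trans HV.
have R0 : deta (ratio1 g sigma A phi) t eta != 0.
  by rewrite -cmod_gt0; exact: lt_trans HR.
have E := omega_c_Res4 g_schwartz sigma_gt0 sigma_C1 A_C2 phi_C3 A_lip phi_3
  A_gt0 k V0 R0.
have Hb : `|omega g sigma A phi t eta - dphi phi k t| <=
    e1 / cmod (V t eta) * bound_term e1 e2 k t eta.
  apply: le_trans (ler_Res4 k e10 e20 HV HR); rewrite -E.
  by apply: le_trans (ler_Re_cmod _); rewrite cReD cReN.
have T0 := bound_term_ge0 k t eta e10 e20.
have TB := bound_term_Bd1 e1 e2 zk.
have v0 : 0 < cmod (V t eta) by exact: lt_trans HV.
have r1 : e1 / cmod (V t eta) < 1 by rewrite ltr_pdivrMr// mul1r.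
split=> //.
  apply: le_trans TB; rewrite lee_fin (le_trans Hb)//.
  by rewrite ler_piMl// ltW.
move=> B0; have [T00|T00] := eqVneq (bound_term e1 e2 k t eta) 0.
  apply: le_lt_trans B0; rewrite lee_fin.
  by move: Hb; rewrite T00 mulr0.
apply: lt_le_trans TB; rewrite lte_fin (le_lt_trans Hb)//.
by rewrite -[ltRHS]mul1r ltr_pM2r// lt_def T00.
Qed.

End Zones.

(** * Mollified reassignment *)

Section CompactSupport.
Context {R : realType}.
Local Notation mu := (@lebesgue_measure R).
Implicit Types (f h : R -> R[i]).

(** The components attain their maxima on [-|M|, |M|]; the absolute value is taken because M may be
    negative. *)
Lemma decays_compact_support f (M : R) : ccontinuous f ->
  (forall x, M <= `|x| -> f x = 0) -> decays f.
Proof.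
move=> [c1 c2] H; split=> // m.
pose N := `|M|.
have NN : - N <= N by rewrite -subr_ge0 opprK addr_ge0 ?normr_ge0.
have cn (u : R -> R) : continuous u ->
      {within `[- N, N], continuous (fun x => `|u x|)}.
  move=> cu; apply: continuous_subspaceT => x.
  apply: (@continuous_comp _ _ _ u (fun y : R => `|y|) x); first exact: cu.
  exact: norm_continuous.
have [a _ Ha] := EVT_max NN (cn _ c1).
have [b _ Hb] := EVT_max NN (cn _ c2).
pose C := `|complex.Re (f a)| + `|complex.Im (f b)|.
have C0 : 0 <= C by exact: addr_ge0.
exists ((1 + N) ^+ m * C) => x.
have N0 : 0 <= N by exact: normr_ge0.
have [xN|xN] := leP `|x| N; last first.
  rewrite H ?cmod0 ?mulr0; first by rewrite mulr_ge0// exprn_ge0// addr_ge0.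
  by rewrite (le_trans (ler_norm _))// ltW.
apply: ler_pM; rewrite ?exprn_ge0 ?addr_ge0 ?cmod_ge0//.
  by rewrite lerXn2r ?nnegrE ?addr_ge0// lerD2l.
have xi : x \in `[- N, N] by rewrite in_itv/= -ler_norml.
by rewrite (le_trans (ler_cmod_ReIm _))// lerD ?Ha ?Hb.
Qed.

Lemma compact_support_bound f : compact (closure [set x | f x != 0]) ->
  exists M : R, forall x, M <= `|x| -> f x = 0.
Proof.
move=> /compact_bounded[M [Mr HM]]; exists (M + 2) => x Mx.
apply/eqP; apply: contraTT Mx => fx; rewrite -ltNge.
have := HM (M + 1) _ x; rewrite ltrDl ltr01 => /(_ isT).
have sx : closure [set x | f x != 0] x by exact: subset_closure.
by move=> /(_ sx) /= h; apply: le_lt_trans h _; rewrite ltrD2l ltr1n.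
Qed.

(** For a mollifier this is a smoothed Heaviside function: 0 to the left of the support and 1 to its
    right. *)
Definition cprimitive h (x : R) : R[i] := cint `]-oo, x] h.

Lemma is_cderive_cprimitive h x : ccontinuous h -> cintegrable setT h ->
  is_cderive (cprimitive h) x (h x).
Proof.
move=> [c1 c2] [i1 i2].
have key (u : R -> R) : continuous u -> mu.-integrable setT (EFin \o u) ->
    is_derive x 1 (fun y => \int[mu]_(z in `]-oo, y]) u z) (u x).
  move=> cu ui.
  have xx : x < x + 1 by rewrite ltrDl.
  have ui' : mu.-integrable [set` Interval -oo%O (BRight (x + 1))] (EFin \o u).
    by apply: (@integrableS _ _ _ mu setT).
  have [|d e] := continuous_FTC1 xx ui' _ (cu x); first exact: ltNyr.
  by apply: DeriveDef; [exact: d|rewrite -derive1E e].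
by split; exact: key.
Qed.

Lemma cprimitive_left h (M x : R) : (forall y, M <= `|y| -> h y = 0) ->
  x <= - M -> cprimitive h x = 0.
Proof.
move=> H xM; rewrite /cprimitive -[RHS](cint0 `]-oo, x]).
apply: eq_cint => y; rewrite inE /= in_itv/= => yx; apply: H.
have yM : M <= - y by rewrite lerNr (le_trans yx).
by rewrite -normrN (le_trans yM)// ler_norm.
Qed.

Lemma cprimitive_right h (M x : R) : cintegrable setT h ->
  (forall y, M <= `|y| -> h y = 0) -> M <= x -> cprimitive h x = cint setT h.
Proof.
move=> hi H Mx; rewrite /cprimitive.
have E : (setT : set R) = `]-oo, x] `|` `]x, +oo[.
  apply/seteqP; split=> // y _ /=; rewrite !in_itv/= andbT.
  by case: (leP y x); [left|right].
rewrite [in RHS]E cint_setU//; last 2 first.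
- by rewrite -E.
- apply/eqP; rewrite -subset0 => y [] /=; rewrite !in_itv/= andbT => yx xy.
  by move: (le_lt_trans yx xy); rewrite ltxx.
rewrite [X in _ = _ + X](_ : _ = 0) ?addr0//.
rewrite -[RHS](cint0 `]x, +oo[); apply: eq_cint => y.
rewrite inE /= in_itv/= andbT => xy; apply: H.
by rewrite (le_trans Mx)// (le_trans (ltW xy))// ler_norm.
Qed.

Lemma ler_cmod_cprimitive h x : cintegrable setT h ->
  cmod (cprimitive h x) <= \int[mu]_y cmod (h y).
Proof.
move=> hi.
have hS : cintegrable `]-oo, x] h by exact: (cintegrableS measurableT).
apply: (le_trans (ler_cmod_cint_cmod _ hS)) => //.
have ni := cintegrable_cmod measurableT hi.
rewrite Rintegral_mkcond; apply: le_Rintegral => //.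
- rewrite -restrict_EFin; apply/(@integrable_mkcond _ _ _ mu `]-oo, x]) => //.
  by apply: (@integrableS _ _ _ mu setT).
- move=> y _; rewrite patchE; case: ifP => // _; exact: cmod_ge0.
Qed.

End CompactSupport.

(** * Integrals depending on a parameter *)

Section MollifiedIntegral.
Context {R : realType}.
Local Notation mu := (@lebesgue_measure R).

Lemma ccontinuous_under_cint (D : set R) (F : R -> R -> R[i]) (G : R -> R) :
  measurable D ->
  (forall x, cintegrable D (F x)) ->
  (forall y, D y -> ccontinuous (F ^~ y)) ->
  mu.-integrable D (EFin \o G) ->
  (forall x y, D y -> cmod (F x y) <= G y) ->
  ccontinuous (fun x => cint D (F x)).
Proof.
move=> mD Fi cF Gi H.
have key (p : R[i] -> R) : (forall z, `|p z| <= cmod z) ->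
    (forall x, mu.-integrable D (EFin \o (fun y => p (F x y)))) ->
    (forall y, D y -> continuous (fun x => p (F x y))) ->
    continuous (fun x => \int[mu]_(y in D) p (F x y)).
  move=> pz pi pc x.
  have Ix : x \in `]x - 1, x + 1[%classic.
    by rewrite inE /= in_itv/= ltrBlDr !ltrDl ltr01.
  apply: (@continuity_under_integral R _ _ mu (fun x y => p (F x y)) D mD
    (x - 1) (x + 1) _ _ G Gi _ x Ix).
  - by move=> z _; exact: pi.
  - by apply: aeW => y Dy z _; exact: pc.
  - by move=> z _; apply: aeW => y Dy; apply: le_trans (pz _) (H _ _ Dy).
split; apply: key.
- exact: ler_Re_cmod.
- by move=> x; have [] := Fi x.
- by move=> y /cF[].
- exact: ler_Im_cmod.
- by move=> x; have [] := Fi x.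
- by move=> y /cF[].
Qed.

Lemma cint_FTC2 (F f : R -> R[i]) (a b : R) : a < b ->
  (forall x, is_cderive F x (f x)) -> ccontinuous f ->
  cint `[a, b] f = F b - F a.
Proof.
move=> ab Ff [c1 c2].
have key (u v : R -> R) : (forall x : R, is_derive x 1 u (v x)) ->
    continuous v -> \int[mu]_(x in `[a, b]) v x = u b - u a.
  move=> uv cv; have cu : continuous u.
    move=> x; apply/differentiable_continuous/derivable1_diffP.
    by have := @ex_derive _ _ _ _ _ _ _ (uv x).
  rewrite /Rintegral (@continuous_FTC2 _ v u _ _ ab)//.
  - exact: continuous_subspaceT.
  - split.
    + by move=> x _; have := @ex_derive _ _ _ _ _ _ _ (uv x).
    + by apply: cvg_at_right_filter; exact: cu.
    + by apply: cvg_at_left_filter; exact: cu.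
  - move=> x _; rewrite derive1E.
    by have := @derive_val _ _ _ _ _ _ _ (uv x).
apply: eq_ReIm; rewrite ?cReD ?cImD ?cReN ?cImN.
  by apply: (key (fun x => complex.Re (F x))) => // x; have [] := Ff x.
by apply: (key (fun x => complex.Im (F x))) => // x; have [] := Ff x.
Qed.

(** Eventual equality is the form of convergence that occurs: at a fixed point the primitive of the
    mollifier takes exactly the values 0 or 1 once lambda is small. *)
Lemma cint_dominated_eventually (D : set R) (F : nat -> R -> R[i])
    (f : R -> R[i]) (G : R -> R) : measurable D ->
  (forall n, cmeasurable D (F n)) -> cmeasurable D f ->
  mu.-integrable D (EFin \o G) ->
  (forall n y, D y -> cmod (F n y) <= G y) ->
  (forall y, D y -> \forall n \near \oo, F n y = f y) ->
  complex.Re (cint D (F n)) @[n --> \oo] --> complex.Re (cint D f) /\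
  complex.Im (cint D (F n)) @[n --> \oo] --> complex.Im (cint D f).
Proof.
move=> mD mF mf iG H Ff.
have key (p : R[i] -> R) : (forall z, `|p z| <= cmod z) ->
    (forall n, measurable_fun D (fun y => p (F n y))) ->
    measurable_fun D (fun y => p (f y)) ->
    \int[mu]_(y in D) p (F n y) @[n --> \oo] --> \int[mu]_(y in D) p (f y).
  move=> pz pF pf.
  have := @dominated_convergence _ _ _ mu D mD (fun n y => (p (F n y))%:E)
    (fun y => (p (f y))%:E) (EFin \o G).
  case.
  - by move=> n; apply/measurable_EFinP; exact: pF.
  - by apply/measurable_EFinP; exact: pf.
  - apply: aeW => y Dy; apply: cvg_near_cst.
    by apply: filterS (Ff y Dy) => n ->.
  - exact: iG.
  - by apply: aeW => y n Dy; rewrite lee_fin (le_trans (pz _))// H.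
  move=> fi _ Hc.
  apply: (@fine_cvg _ _ _ _ (fun n => \int[mu]_(y in D) (p (F n y))%:E)%E).
  rewrite /Rintegral fineK; last exact: integrable_fin_num.
  exact: Hc.
split; apply: key.
- exact: ler_Re_cmod.
- by move=> n; have [] := mF n.
- by have [] := mf.
- exact: ler_Im_cmod.
- by move=> n; have [] := mF n.
- by have [] := mf.
Qed.

Lemma cvg_complex (F : R -> R[i]) (l : R[i]) (T : set_system R) {FT : Filter T} :
  complex.Re (F x) @[x --> T] --> complex.Re l ->
  complex.Im (F x) @[x --> T] --> complex.Im l ->
  (F x : R[i]^o) @[x --> T] --> (l : R[i]^o).
Proof.
move=> c1 c2; apply/cvgrPdist_lt => e e0.
(* In the partial order of [R[i]] a positive element is real. *)
have [e1 e2] : 0 < complex.Re e /\ complex.Im e = 0.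
  by move: e0; rewrite ltcE /= => /andP[/eqP <- ->].
have eE : e = (complex.Re e)%:C by apply: eq_ReIm.
have e20 : 0 < complex.Re e / 2 by rewrite divr_gt0.
have h1 := (@cvgrPdist_lt _ _ _ _ FT _ _).1 c1 _ e20.
have h2 := (@cvgrPdist_lt _ _ _ _ FT _ _).1 c2 _ e20.
apply: filterS2 h1 h2 => x x1 x2.
rewrite eE -cmod_normE ltcR (le_lt_trans (ler_cmod_ReIm _))//.
by rewrite [complex.Re e]splitr ltrD// ?cReD ?cReN ?cImD ?cImN.
Qed.

End MollifiedIntegral.

(** * The limit of the mollified integral *)

Section MollifiedLimit.
Context {R : realType}.
Local Notation mu := (@lebesgue_measure R).

Lemma cmeasurable_comp (D : set R) (f : R -> R[i]) (u : R -> R) :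
  ccontinuous f -> measurable_fun D u -> cmeasurable D (fun x => f (u x)).
Proof.
move=> [f1 f2] mu_; split.
  by apply: (measurableT_comp (f := fun y => complex.Re (f y))) => //;
    exact: continuous_measurable_fun.
by apply: (measurableT_comp (f := fun y => complex.Im (f y))) => //;
  exact: continuous_measurable_fun.
Qed.

Lemma integrable_cst_fin (D : set R) (C : R) : measurable D -> (mu D < +oo)%E ->
  mu.-integrable D (EFin \o (fun=> C)).
Proof.
move=> mD Doo; apply: (@measurable_bounded_integrable _ _ _ mu) => //.
exact: bounded_cst.
Qed.

Lemma cintegrable_bounded (D : set R) (f : R -> R[i]) (C : R) : measurable D ->
  (mu D < +oo)%E -> cmeasurable D f -> (forall x, D x -> cmod (f x) <= C) ->
  cintegrable D f.
Proof.
move=> mD Doo mf fC; apply: (cintegrable_dominated mD mf _ fC).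
exact: integrable_cst_fin.
Qed.

Lemma cint_itv_oo_cc (a b : R) (f : R -> R[i]) : cintegrable `[a, b] f ->
  cint `]a, b[ f = cint `[a, b] f.
Proof.
move=> fi.
have [i1 i2] : cintegrable `]a, b[ f.
  by apply: (cintegrableS _ _ _ fi) => //; exact: subset_itv_oo_cc.
have [j1 j2] : cintegrable `]a, b] f.
  by apply: (cintegrableS _ _ _ fi) => //; exact: subset_itv_oc_cc.
apply: eq_ReIm; rewrite /cint /=.
  by rewrite Rintegral_itv_bndo_bndc// Rintegral_itv_obnd_cbnd.
by rewrite Rintegral_itv_bndo_bndc// Rintegral_itv_obnd_cbnd.
Qed.

Variables (S : set R) (W : R -> R[i]) (om : R -> R) (h : R -> R[i]).
Variables (M B c e : R).
Hypothesis mS : measurable S.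
Hypothesis Soo : (mu S < +oo)%E.
Hypothesis mW : cmeasurable S W.
Hypothesis WB : forall x, S x -> cmod (W x) <= B.
Hypothesis mom : measurable_fun S om.
Hypothesis ch : ccontinuous h.
Hypothesis hM : forall x, M <= `|x| -> h x = 0.
Hypothesis h1 : cint setT h = 1.
Hypothesis e0 : 0 < e.

Let dh : decays h. Proof. exact: decays_compact_support ch hM. Qed.
Let hi : cintegrable setT h. Proof. exact: decays_integrable. Qed.
Let Phi := cprimitive h.
Let Phi' x : is_cderive Phi x (h x).
Proof. exact: is_cderive_cprimitive. Qed.
Let cPhi : ccontinuous Phi. Proof. exact: is_cderive_ccontinuous Phi'. Qed.
Let N : R := \int[mu]_y cmod (h y).
Let PhiN x : cmod (Phi x) <= N. Proof. exact: ler_cmod_cprimitive. Qed.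

Let mshift (lam xi : R) : measurable_fun S (fun eta => (xi - om eta) / lam).
Proof.
by apply: measurable_funM => //; apply: measurable_funB.
Qed.

Let mWf (f : R -> R[i]) lam xi : ccontinuous f ->
  cmeasurable S (fun eta => W eta * f ((xi - om eta) / lam)).
Proof.
move=> cf; apply: cmeasurableM => //.
exact: (cmeasurable_comp cf (mshift lam xi)).
Qed.

Let WC (f : R -> R[i]) C x y : (forall z, cmod (f z) <= C) -> S x ->
  cmod (W x * f y) <= B * C.
Proof.
move=> fC Sx; rewrite cmodM; apply: ler_pM; rewrite ?cmod_ge0//.
exact: WB.
Qed.

Let iWf (f : R -> R[i]) C lam xi : ccontinuous f -> (forall z, cmod (f z) <= C) ->
  cintegrable S (fun eta => W eta * f ((xi - om eta) / lam)).
Proof.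
move=> cf fC; apply: (cintegrable_bounded (C := B * C)) => //; first exact: mWf.
by move=> x Sx; exact: WC.
Qed.

(** In place of Fubini's theorem: the inner integral is the derivative in xi of the integral of W
    Phi((xi - om)/lam) over S, so the fundamental theorem of calculus evaluates the outer one. *)
Lemma mollified_primitive (lam : R) : 0 < lam ->
  cint [set xi | `|xi - c| < e] (fun xi =>
    cint S (fun eta => W eta * (lam^-1)%:C * h ((xi - om eta) / lam))) =
  cint S (fun eta => W eta * (Phi ((c + e - om eta) / lam) -
                              Phi ((c - e - om eta) / lam))).
Proof.
move=> lam0.
have [C C0 HC] := decays_bound 0 dh.
have {}HC x : cmod (h x) <= C by have := HC x; rewrite expr0 mul1r.
have ab : c - e < c + e by rewrite ltrBlDr -addrA ltrDl addr_gt0.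
have -> : [set xi | `|xi - c| < e] = `]c - e, c + e[%classic.
  by apply/seteqP; split=> x /=; rewrite in_itv/= ltr_distl.
pose f xi eta := W eta * (h ((xi - om eta) / lam) * (lam^-1)%:C).
pose h' x := h x * (lam^-1)%:C.
have ch' : ccontinuous h' by apply: ccontinuousM => //; exact: ccontinuous_cst.
have HC' x : cmod (h' x) <= C * lam^-1.
  rewrite cmodM cmod_real ger0_norm ?invr_ge0 ?(ltW lam0)//.
  by rewrite ler_wpM2r// invr_ge0 ltW.
have fi xi : cintegrable S (f xi) by exact: (iWf (f := h')).
have iB : mu.-integrable S (EFin \o (fun=> B * (C * lam^-1))).
  exact: integrable_cst_fin.
have fB xi eta : S eta -> cmod (f xi eta) <= B * (C * lam^-1).
  by move=> Se; exact: (WC (f := h')).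
have dPsi xi : is_cderive
    (fun z => cint S (fun eta => W eta * Phi ((z - om eta) / lam))) xi
    (cint S (f xi)).
  have Ix : `]xi - 1, xi + 1[%classic xi.
    by rewrite /= in_itv/= ltrBlDr !ltrDl ltr01.
  apply: (@is_cderive_under_cint R S
    (fun z eta => W eta * Phi ((z - om eta) / lam)) f
    (fun=> B * (C * lam^-1)) xi _ _ mS Ix).
  - by move=> z _; exact: iWf.
  - move=> z y _ Sy; apply: is_cderiveZ.
    apply: (@is_cderive_comp _ Phi (fun z => (z - om y) / lam)).
      exact: Phi'.
    have := is_derive_affine lam^-1 (- om y / lam) z.
    rewrite (_ : (fun _ => _) = (fun z => (z - om y) / lam))//.
    by apply/funext => t; rewrite mulrBl mulNr mulrC.
  - exact: iB.
  - by move=> z y _ Sy; exact: fB.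
have cf : ccontinuous (fun xi => cint S (f xi)).
  apply: (@ccontinuous_under_cint R S f (fun=> B * (C * lam^-1))) => //.
  move=> y Sy; apply: ccontinuousM; first exact: ccontinuous_cst.
  apply: (@ccontinuous_comp _ h' (fun x => (x - om y) / lam)) => // x.
  by apply: cvgM; [apply: cvgB; [exact: cvg_id|exact: cvg_cst]|exact: cvg_cst].
have -> : cint `]c - e, c + e[ (fun xi =>
    cint S (fun eta => W eta * (lam^-1)%:C * h ((xi - om eta) / lam))) =
    cint `]c - e, c + e[ (fun xi => cint S (f xi)).
  by apply: eq_cint => xi _; apply: eq_cint => y _; rewrite /f; ring.
rewrite cint_itv_oo_cc; last first.
  have [f1 f2] := cf.
  by split; apply: continuous_compact_integrable;
    [exact: segment_compact|exact: continuous_subspaceT|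
     exact: segment_compact|exact: continuous_subspaceT].
rewrite (cint_FTC2 ab dPsi cf) -cintB//; [|exact: iWf|exact: iWf].
by apply: eq_cint => y _; rewrite mulrBr.
Qed.

Hypothesis om_e : forall x, S x -> `|om x - c| != e.

Let T : set R := [set x | `|om x - c| < e].

Let mST : measurable (S `&` T).
Proof.
rewrite (_ : T = om @^-1` `]c - e, c + e[); first exact: mom.
by apply/seteqP; split=> x; rewrite /T /= in_itv/= ltr_distl.
Qed.

Let limit_integrand (x : R) : R[i] := W x * (\1_(S `&` T) x)%:C.

Let cint_limit : cint S limit_integrand = cint (S `&` T) W.
Proof.
apply: eq_ReIm; rewrite /cint /= Rintegral_mkcondr; apply: eq_Rintegral => x xS;
  rewrite /limit_integrand patchE indicE in_setI xS /=.
  by case: ifP => _; rewrite cReM /= ?mulr1 ?mulr0 ?subr0// subrr.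
by case: ifP => _; rewrite cImM /= ?mulr1 ?mulr0 ?add0r ?mul0r.
Qed.

(** As a is not 0, the quotient a/u_n leaves the support of h, on the side given by the sign of
    a. *)
Lemma Phi_near (a : R) (u : nat -> R) : a != 0 -> (forall n, 0 < u n) ->
  u n @[n --> \oo] --> (0 : R) ->
  \forall n \near \oo, Phi (a / u n) = if 0 < a then 1 else 0.
Proof.
move=> a0 u0 cu.
have d0 : 0 < `|a| / (`|M| + 1).
  by rewrite divr_gt0 ?normr_gt0// ltr_wpDl.
have /cvgrPdist_lt/(_ _ d0) := cu; apply: filterS => n.
rewrite sub0r normrN (gtr0_norm (u0 n)) ltr_pdivlMr ?ltr_wpDl// => un.
have Ma : M <= `|a| / u n.
  rewrite ler_pdivlMr//; apply: le_trans (ltW un).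
  rewrite mulrC ler_wpM2l ?(ltW (u0 n))//.
  by rewrite (le_trans (ler_norm _))// lerDl.
case: ifPn => [a1|a1].
  by rewrite /Phi (cprimitive_right hi hM) ?h1//; rewrite gtr0_norm in Ma.
have a2 : a < 0 by rewrite lt_neqAle a0 leNgt.
by apply: (cprimitive_left hM); rewrite ltr0_norm// mulNr lerNr in Ma.
Qed.

(* Integrating in [xi] first turns the mollifier into a difference of values of
   its antiderivative, which for small [lam] equals 1 if [`|om eta - c| < e] and
   0 if [`|om eta - c| > e]. *)
Lemma mollified_limit :
  (cint [set xi | `|xi - c| < e] (fun xi =>
    cint S (fun eta => W eta * (lam^-1)%:C * h ((xi - om eta) / lam))) : R[i]^o)
    @[lam --> 0^'+] --> (cint (S `&` T) W : R[i]^o).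
Proof.
pose F lam eta := W eta * (Phi ((c + e - om eta) / lam) -
                           Phi ((c - e - om eta) / lam)).
(* Dominated convergence applies to sequences; the limit at 0+ is recovered from all positive
   sequences tending to 0. *)
have key (u : R^nat) : (forall n, 0 < u n) -> u n @[n --> \oo] --> (0 : R) ->
    complex.Re (cint S (F (u n))) @[n --> \oo] --> complex.Re (cint (S `&` T) W) /\
    complex.Im (cint S (F (u n))) @[n --> \oo] --> complex.Im (cint (S `&` T) W).
  move=> u0 cu; rewrite -cint_limit.
  apply: (@cint_dominated_eventually R S (fun n => F (u n)) limit_integrand
    (fun=> B * (N + N))) => //.
  - move=> n; rewrite /F; under eq_fun do rewrite mulrBr.
    by apply: cmeasurableB; exact: mWf.
  - apply: cmeasurableM => //; split; last exact: measurable_cst.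
    by apply: measurable_funTS; apply/measurable_indicP.
  - exact: integrable_cst_fin.
  - move=> n y Sy; rewrite /F cmodM; apply: ler_pM; rewrite ?cmod_ge0//.
      exact: WB.
    by apply: (le_trans (ler_cmodB _ _)); exact: lerD.
  - move=> y Sy.
    have := om_e Sy => ye.
    have a0 : c + e - om y != 0.
      apply: contra ye; rewrite subr_eq0 => /eqP <-.
      by rewrite addrAC subrr add0r gtr0_norm.
    have b0 : c - e - om y != 0.
      apply: contra ye; rewrite subr_eq0 => /eqP <-.
      by rewrite addrAC subrr add0r normrN gtr0_norm.
    apply: filterS2 (Phi_near a0 u0 cu) (Phi_near b0 u0 cu) => n.
    rewrite /F /limit_integrand => -> ->; congr (_ * _).
    rewrite indicE in_setI mem_set//=.
    have -> : (y \in T) = (`|om y - c| < e) by apply/idP/idP; rewrite inE.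
    rewrite ltr_distl !subr_gt0.
    have [y1|y1] := ltP (c - e) (om y); have [y2|y2] := ltP (om y) (c + e) => /=.
    + by rewrite ifN ?subr0// -leNgt ltW.
    + by rewrite ifN ?subr0// -leNgt ltW.
    + case: ifPn; rewrite ?subrr// -leNgt => y3.
      by move: b0; rewrite subr_eq0 eq_le y1 y3.
    + by exfalso; have := le_trans y2 y1; have := e0; lra.
have Fnear : {near 0^'+, (fun lam => cint S (F lam)) =1 (fun lam =>
    cint [set xi | `|xi - c| < e] (fun xi =>
    cint S (fun eta => W eta * (lam^-1)%:C * h ((xi - om eta) / lam))))}.
  near=> lam; rewrite mollified_primitive//.
have lim : (cint S (F lam) : R[i]^o) @[lam --> 0^'+] -->
    (cint (S `&` T) W : R[i]^o).
  apply: cvg_complex.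
    by apply/cvg_at_rightP => u [u0 cu]; have [] := key u u0 cu.
  by apply/cvg_at_rightP => u [u0 cu]; have [] := key u u0 cu.
by apply: cvg_trans lim; exact: near_eq_cvg.
Unshelve. all: end_near. Qed.

End MollifiedLimit.

(** * Reconstruction of a component *)

Section ZoneGeometry.
Context {R : realType}.

(** Monotonicity is weak, so strictness below alpha comes from the uniqueness of the crossing point.
    That uniqueness concerns positive points only; the point 0 is compared with alpha/2. *)
Lemma superlevel_itv (u : R -> R) (tau0 alpha : R) : even_decreasing u ->
  0 < alpha -> u alpha = tau0 ->
  (forall x, 0 < x -> u x = tau0 -> x = alpha) ->
  forall x, (tau0 < u x) = (`|x| < alpha).
Proof.
move=> [ue ud] a0 ua uniq x.
have -> : u x = u `|x|.
  have [x0|x0] := leP 0 x; first by rewrite ger0_norm.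
  by rewrite ltr0_norm// ue.
have x0 : 0 <= `|x| by [].
move: (`|x|) x0 => {x} x x0; apply/idP/idP => [ux|xa].
  by rewrite ltNge; apply/negP => ax; have := ud _ _ (ltW a0) ax;
    rewrite ua leNgt ux.
have pos y : 0 < y -> y < alpha -> tau0 < u y.
  move=> y0 ya; rewrite lt_neqAle -[in X in _ && X]ua ud ?ltW// andbT.
  by apply/eqP => /esym /(uniq _ y0) ye; move: ya; rewrite ye ltxx.
have [x1|] := ltP 0 x; first exact: pos.
move=> x1; have -> : x = 0 by apply/eqP; rewrite eq_le x1 x0.
have a2 : 0 < alpha / 2 by rewrite divr_gt0.
apply: (lt_le_trans (pos _ a2 _)); last by apply: ud => //; exact: ltW.
by rewrite ltr_pdivrMr// ltr_pMr// ltr1n.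
Qed.

Lemma disjoint_itv_dist (c d r s : R) : 0 < r -> 0 < s ->
  (forall x, `|x - c| < r -> `|x - d| < s -> False) -> r + s <= `|c - d|.
Proof.
move=> r0 s0 H; rewrite leNgt; apply/negP => cd.
have rs : 0 < r + s by exact: addr_gt0.
have rs_ := lt0r_neq0 rs.
(* The point dividing the segment from c to d in the ratio r : s; it lies in both intervals as soon
   as |c - d| < r + s. *)
pose x := (s * c + r * d) / (r + s).
apply: (H x).
  have -> : x - c = r / (r + s) * - (c - d) by rewrite /x; field.
  rewrite !normrM normrN normfV (gtr0_norm r0) (gtr0_norm rs).
  by rewrite mulrAC ltr_pdivrMr// ltr_pM2l.
have -> : x - d = s / (r + s) * (c - d) by rewrite /x; field.
rewrite !normrM normfV (gtr0_norm s0) (gtr0_norm rs).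
by rewrite mulrAC ltr_pdivrMr// ltr_pM2l.
Qed.

Variables (K : nat) (g : R -> R[i]) (sigma : R -> R) (phi : 'I_K -> R -> R).
Variables (tau0 : R) (alpha : 'I_K -> R -> R).
Hypothesis sep : well_separating g sigma phi tau0 alpha.
Hypothesis phi_increasing : forall k l : 'I_K, l = k.+1 :> nat ->
  (0 < ereal_inf [set (dphi phi l t - dphi phi k t)%:E | t in setT])%E.
Implicit Types (k l : 'I_K) (t : R).

Let s0 t : 0 < sigma t. Proof. by have [[]] := sep. Qed.

Let al0 k t : 0 < alpha k t.
Proof. by have [_ _ /(_ k t)[]] := sep. Qed.

Lemma zoneE k t eta : zone g sigma phi tau0 k (t, eta) <->
  `|eta - dphi phi k t| < alpha k t / sigma t.
Proof.
have [_ /(_ k t) ed /(_ k t)[a0 ua uniq] _] := sep.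
rewrite /zone /= (superlevel_itv ed a0 ua uniq) normrM (gtr0_norm (s0 t)).
by rewrite ltr_pdivlMr// mulrC.
Qed.

Lemma zone_dist k l t : k != l ->
  (alpha k t + alpha l t) / sigma t <= `|dphi phi k t - dphi phi l t|.
Proof.
move=> kl; rewrite mulrDl; apply: disjoint_itv_dist; rewrite ?divr_gt0//.
move=> x xk xl; have [_ _ _ /(_ k l kl) H] := sep.
have : (zone g sigma phi tau0 k `&` zone g sigma phi tau0 l) (t, x).
  by split; apply/zoneE.
by rewrite H.
Qed.

Lemma dphi_increasing t k l : (k < l)%N -> dphi phi k t < dphi phi l t.
Proof.
have step (i j : 'I_K) : j = i.+1 :> nat -> dphi phi i t < dphi phi j t.
  move=> ij; rewrite -subr_gt0 -lte_fin.
  apply: (lt_le_trans (phi_increasing ij)).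
  by apply: ereal_inf_lbound; exists t.
case: l => l lK /=; elim: l lK => // l IH lK; rewrite ltnS leq_eqVlt.
have lK' : (l < K)%N by exact: ltnW.
have hstep := step (Ordinal lK') (Ordinal lK) erefl.
move=> /orP[/eqP kl|kl].
  by rewrite (_ : k = Ordinal lK')//; exact: val_inj.
exact: lt_trans (IH lK' kl) hstep.
Qed.

Lemma Lk_neighbour k l t : (l.+1 == k :> nat) || (k.+1 == l :> nat) ->
  (Lk sigma alpha k t <= `|dphi phi k t - dphi phi l t|%:E)%E.
Proof.
move=> kl; rewrite /Lk.
have knl : k != l.
  by apply: contraTneq kl => ->; rewrite orbb gtn_eqF.
apply: (@le_trans _ _ ((sigma t)^-1%:E * (alpha k t + alpha l t)%:E)%E).
  rewrite lee_wpmul2l ?lee_fin ?invr_ge0 ?(ltW (s0 t))//.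
  exact: (@bigmin_le_cond _ _ _ _ l).
by rewrite -EFinM lee_fin mulrC zone_dist.
Qed.

(** Only neighbours of k enter [Lk], but the phi_l' are ordered, so the neighbour on the side of l
    is no farther from k than l itself. *)
Lemma Lk_dist k l t : l != k ->
  (Lk sigma alpha k t <= `|dphi phi k t - dphi phi l t|%:E)%E.
Proof.
move=> lk; have [kl|kl|kl] := ltngtP k l; last first.
- by move: lk; rewrite (val_inj kl) eqxx.
- have k0 : (0 < k)%N by exact: leq_ltn_trans kl.
  have k1K : (k.-1 < K)%N by rewrite prednK// ltnW.
  pose m := Ordinal k1K.
  have mk : (m.+1 == k :> nat) by rewrite /= prednK.
  have nb : (m.+1 == k :> nat) || (k.+1 == m :> nat) by rewrite mk.
  apply: (le_trans (Lk_neighbour t nb)).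
  have h1 : dphi phi m t < dphi phi k t.
    by apply: dphi_increasing; rewrite -(eqP mk).
  have h2 : dphi phi l t <= dphi phi m t.
    have : (l <= m)%N by rewrite -ltnS (eqP mk).
    rewrite leq_eqVlt => /orP[/eqP lm|lm]; last by rewrite ltW// dphi_increasing.
    by rewrite (val_inj lm).
  rewrite lee_fin !gtr0_norm ?subr_gt0//; first by rewrite lerD2l lerN2.
  exact: le_lt_trans h1.
- have k1K : (k.+1 < K)%N by exact: leq_ltn_trans kl _.
  pose m := Ordinal k1K.
  have nb : (m.+1 == k :> nat) || (k.+1 == m :> nat) by rewrite /= eqxx orbT.
  apply: (le_trans (Lk_neighbour t nb)).
  have h1 : dphi phi k t < dphi phi m t by exact: dphi_increasing.
  have h2 : dphi phi m t <= dphi phi l t.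
    move: (kl : (m <= l)%N).
    rewrite leq_eqVlt => /orP[/eqP lm|lm]; last by rewrite ltW// dphi_increasing.
    by rewrite (val_inj lm).
  rewrite lee_fin !ltr0_norm ?subr_lt0//; last exact: lt_le_trans h2.
  by rewrite !opprB lerD2r.
Qed.

End ZoneGeometry.

(** * The chirped window and its transform *)

Section ChirpedWindow.
Context {R : realType} {K : nat}.
Variables (g : R -> R[i]) (sigma : R -> R) (phi : 'I_K -> R -> R).
Hypothesis g_schwartz : schwartz g.
Implicit Types (k : 'I_K) (t : R).

(** The regularity that integrability of the transform and inversion at 0 ask of the chirped window
    e g. Since e' = p e with p linear, the derivatives are e times polynomial combinations of
    derivatives of g. *)
Lemma chirped_C2 k t : exists d1 d2 : R -> R[i],
  [/\ decays d1, decays d2, forall x, is_cderive (chirped g sigma phi k t) x (d1 x)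
    & forall x, is_cderive d1 x (d2 x)].
Proof.
pose c := pi * sigma t ^+ 2 * ddphi phi k t.
pose e (x : R) : R[i] := cexpi (c * x ^+ 2).
pose p (x : R) : R[i] := 'i%C * (2 * c * x)%:C.
have pe : polybounded e by exact: polybounded_quadratic.
have pp : polybounded p.
  apply: polyboundedM; first exact: polybounded_cst.
  under eq_fun do rewrite real_complexM.
  by apply: polyboundedM; [exact: polybounded_cst|exact: polybounded_id].
have dp x : is_cderive p x ('i%C * (2 * c)%:C).
  apply: is_cderiveZ; apply: is_cderive_real.
  have := is_derive_affine (2 * c) 0 x.
  by under eq_fun do rewrite addr0.
have de x : is_cderive e x (p x * e x).
  exact: is_cderive_cexpi (is_derive_sqr c x).
have dg0 := decays_g g_schwartz.
have dg1 := schwartz_decays 1 g_schwartz.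
have dg2 := schwartz_decays 2 g_schwartz.
have g1' := is_cderive_g g_schwartz.
have g2' x := schwartz_is_cderive 1 x g_schwartz.
pose q x := p x * g x + cderivn 1 g x.
pose dq x := 'i%C * (2 * c)%:C * g x + p x * cderivn 1 g x + cderivn 2 g x.
have qdq x : is_cderive q x (dq x).
  by apply: is_cderiveD => //; apply: is_cderiveM => //; exact: g1'.
have cq : decays q by apply: decaysD => //; exact: decays_polyM.
have cdq : decays dq.
  apply: decaysD => //; apply: decaysD; first exact: decaysZ.
  exact: decays_polyM.
exists (fun x => e x * q x), (fun x => p x * e x * q x + e x * dq x); split.
- exact: decays_polyM.
- apply: decaysD; last exact: decays_polyM.
  by apply: decays_polyM => //; exact: polyboundedM.
- move=> x; apply: is_cderive_eq (is_cderiveM (de x) (g1' x)) _.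
  by rewrite /q /cderiv; ring.
- by move=> x; exact: is_cderiveM.
Qed.

Lemma Gk_fourier k t : Gk g sigma phi k t = fourier (chirped g sigma phi k t).
Proof. by []. Qed.

Lemma Gk_integrable k t : cintegrable setT (Gk g sigma phi k t).
Proof.
have [d1 [d2 [cd1 cd2 h1 h2]]] := chirped_C2 k t.
exact: fourier_integrable (decays_chirped _ _ g_schwartz k t) cd1 cd2 h1 h2.
Qed.

Lemma cint_Gk k t : cint setT (Gk g sigma phi k t) = g 0.
Proof.
have [d1 [d2 [cd1 cd2 h1 h2]]] := chirped_C2 k t.
rewrite Gk_fourier (fourier_inversion0 (decays_chirped _ _ g_schwartz k t)
  cd1 cd2 h1 h2).
by rewrite /chirped expr0n /= mulr0 cexpi0 mul1r.
Qed.

Lemma ler_cmod_Gk k t xi : cmod (Gk g sigma phi k t xi) <= L1norm g.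
Proof.
apply: ler_cmod_fourier; first exact: decays_chirped.
  by apply: cintegrable_cmod => //; exact/decays_integrable/decays_g.
by move=> x; rewrite /chirped cmodM cmod_cexpi mul1r.
Qed.

End ChirpedWindow.

(** * The limit of the synthesis integral *)

Section Reconstruction.
Context {R : realType} {K : nat}.
Local Notation mu := (@lebesgue_measure R).
Variables (g h : R -> R[i]) (sigma : R -> R) (A phi : 'I_K -> R -> R).
Variables (eps1 eps3 : R).
Hypothesis g_schwartz : schwartz g.
Hypothesis sigma_gt0 : forall t, 0 < sigma t.
Hypothesis sigma_C1 : class_Cn 1 sigma.
Hypothesis A_C2 : forall k, class_Cn 2 (A k).
Hypothesis phi_C3 : forall k, class_Cn 3 (phi k).
Hypothesis A_lip : forall k t, `|derive1 (A k) t| <= eps1.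
Hypothesis phi_3 : forall k t, `|derive1n 3 (phi k) t| <= eps3.
Hypothesis A_gt0 : forall k t, 0 < A k t.
Implicit Types (k : 'I_K) (eta : R) (f : R -> R[i]).
Variable (t : R).

Local Notation V := (V g sigma A phi).
Local Notation V1 := (V1 g sigma A phi).
Local Notation res := (res sigma A phi).
Local Notation x_ := (component A phi).
Local Notation ratio1 := (ratio1 g sigma A phi).

Let dg := decays_g g_schwartz.

Let m_stft f : decays f -> cmeasurable setT (stft sigma A phi f t).
Proof.
move=> df; apply: ccontinuous_measurable => //; apply: wft_ccontinuous => //.
exact: polybounded_signal A_lip A_gt0 t.
Qed.

Let m_chirp f k : decays f -> cmeasurable setT (chirp_part sigma phi f k t).
Proof.
move=> df; apply: ccontinuous_measurable => //; apply: wft_ccontinuous => //.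
exact: polybounded_chirp.
Qed.

Let m_res f : decays f -> cmeasurable setT (res f t).
Proof.
move=> df; apply: ccontinuous_measurable => //.
apply: is_cderive_ccontinuous => eta.
exact: (is_cderive_res sigma_gt0 A_C2 phi_C3 A_lip phi_3 A_gt0 t eta df).
Qed.

Let m_V : cmeasurable setT (V t). Proof. exact: m_stft. Qed.

Let m_V1 : cmeasurable setT (V1 t).
Proof. by apply: m_stft; exact: decays_g1. Qed.

Let m_dstft f : decays f -> cmeasurable setT (deta (stft sigma A phi f) t).
Proof.
move=> df.
rewrite (_ : deta _ t = fun eta => - i2pi * (sigma t)%:C *
    stft sigma A phi (fun u => u%:C * f u) t eta).
  apply: cmeasurableM; first exact: cmeasurable_cst.
  by apply: m_stft; exact: decays_idM.
apply/funext => eta; apply: is_cderiveE.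
exact: (is_cderive_stft sigma_gt0 A_C2 phi_C3 A_lip A_gt0 t eta df).
Qed.

Let m_Res1 k : cmeasurable setT (Res1 g sigma A phi k t).
Proof.
apply: ccontinuous_measurable => //; apply: is_cderive_ccontinuous => eta.
exact: (is_cderive_Res1 g_schwartz sigma_gt0 A_C2 phi_C3 A_lip phi_3 A_gt0).
Qed.

Let m_real (u : R -> R) : continuous u -> cmeasurable setT (fun x => (u x)%:C).
Proof.
move=> cu; apply: ccontinuous_measurable => //; exact: ccontinuous_real.
Qed.

Let m_Res2 k : cmeasurable setT (Res2 g sigma A phi k t).
Proof.
have dg1 := decays_g1 g_schwartz; have dg2 := decays_g2 g_schwartz.
have dg3 := decays_g3 g_schwartz.
have cst c : cmeasurable setT (fun _ : R => c : R[i]).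
  exact: cmeasurable_cst.
have mE : cmeasurable setT (Ek g sigma A phi k t).
  rewrite (_ : Ek _ _ _ _ _ _ = fun eta => \sum_(l < K)
    x_ l t * (dphi phi l t - dphi phi k t)%:C *
    chirp_part sigma phi (g1 g) l t eta).
    by apply: cmeasurable_sum => l _; apply: cmeasurableM;
      [exact: cst|exact: m_chirp].
  by apply/funext => eta; rewrite EkE.
have mF : cmeasurable setT (Fk g sigma A phi k t).
  rewrite (_ : Fk _ _ _ _ _ _ = fun eta => \sum_(l < K)
    x_ l t * (ddphi phi l t - ddphi phi k t)%:C *
    chirp_part sigma phi (g2 g) l t eta).
    by apply: cmeasurable_sum => l _; apply: cmeasurableM;
      [exact: cst|exact: m_chirp].
  by apply/funext => eta; rewrite FkE.
rewrite /Res2.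
apply: cmeasurableB; last by apply: cmeasurableM => //; exact: m_res.
apply: cmeasurableD; last by apply: cmeasurableM => //; exact: m_res.
apply: cmeasurableD.
  apply: cmeasurableD; last by apply: cmeasurableM => //; exact: m_res.
  by apply: cmeasurableD; apply: cmeasurableM.
apply: cmeasurableM; last exact: m_res.
by apply: m_real; apply: is_derive_continuous => eta.
Qed.

Let m_dV : cmeasurable setT (fun eta => deta V t eta).
Proof. exact: m_dstft. Qed.

Let m_dV1 : cmeasurable setT (fun eta => deta V1 t eta).
Proof. exact: m_dstft (decays_g1 g_schwartz). Qed.

Let m_Res4 k : cmeasurable setT (Res4 g sigma A phi k t).
Proof.
have mden : cmeasurable setT (fun eta => (i2pi * V t eta)^-1).
  apply: cmeasurableV => //; apply: cmeasurableM; last exact: m_V.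
  exact: cmeasurable_cst.
have mR3 : cmeasurable setT (Res3 g sigma A phi k t).
  rewrite /Res3; apply: cmeasurableM.
    apply: cmeasurableB; apply: cmeasurableM;
      [exact: m_V|exact: m_Res2|exact: m_dV|exact: m_Res1].
  apply: cmeasurableV => //; apply: cmeasurableB; apply: cmeasurableM;
    [exact: m_V|exact: m_dV1|exact: m_V1|exact: m_dV].
rewrite /Res4; apply: cmeasurableB; apply: cmeasurableM;
  [exact: m_Res1|exact: mden| |exact: mden].
by apply: cmeasurableM; [exact: m_V1|exact: mR3].
Qed.

(** The quotient-rule formula is measurable on the whole line, whatever its value where V vanishes;
    it equals [deta ratio1] wherever |V| > e1, which is all that is needed. *)
Let ratio' eta : R[i] :=
  (deta V1 t eta * V t eta - V1 t eta * deta V t eta) / (V t eta * V t eta).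

Let m_ratio' : cmeasurable setT ratio'.
Proof.
rewrite /ratio'; apply: cmeasurableM.
  apply: cmeasurableB; apply: cmeasurableM;
    [exact: m_dV1|exact: m_V|exact: m_V1|exact: m_dV].
by apply: cmeasurableV => //; apply: cmeasurableM; exact: m_V.
Qed.

Lemma measurable_superlevel (u : R -> R) (c : R) : measurable_fun setT u ->
  measurable [set x | c < u x].
Proof.
move=> mu_; rewrite -[X in measurable X]setTI.
rewrite (_ : [set x | c < u x] = u @^-1` `]c, +oo[); first exact: mu_.
by apply/seteqP; split=> x /=; rewrite in_itv/= andbT.
Qed.

Variables (e1 e2 : R).
Hypothesis e1_gt0 : 0 < e1.
Hypothesis e2_gt0 : 0 < e2.

Let V_neq0 eta : e1 < cmod (V t eta) -> V t eta != 0.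
Proof. by move=> H; rewrite -cmod_gt0; exact: lt_trans H. Qed.

Let ratioE eta : e1 < cmod (V t eta) -> deta ratio1 t eta = ratio' eta.
Proof.
move=> /V_neq0 V0.
rewrite (deta_ratio1E g_schwartz sigma_gt0 A_C2 phi_C3 A_lip A_gt0 V0).
by rewrite expr2.
Qed.

Definition reliable : set R :=
  [set eta | e1 < cmod (V t eta) /\ e2 < cmod (deta ratio1 t eta)].

Let X := [set eta | e1 < cmod (V t eta)].

Lemma measurable_reliable : measurable reliable.
Proof.
rewrite (_ : reliable = X `&` [set eta | e2 < cmod (ratio' eta)]).
  apply: measurableI => //; apply: measurable_superlevel; exact: measurable_cmod.
by apply/seteqP; split=> eta [] /= a b; split=> //; rewrite ?ratioE// -ratioE.
Qed.

Let V_bounded : exists B : R, forall eta, cmod (V t eta) <= B.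
Proof.
have pS := polybounded_signal A_C2 phi_C3 A_lip A_gt0 t.
have dk := decays_wft (sigma_gt0 t) pS dg.
exists (\int[mu]_tau
  cmod (signal A phi (t + tau) * ((sigma t)^-1)%:C * g (tau / sigma t))).
move=> eta; apply: ler_cmod_fourier => //.
by apply: cintegrable_cmod => //; exact: decays_integrable.
Qed.

Variables (tau0 : R) (alpha : 'I_K -> R -> R).
Hypothesis sep : well_separating g sigma phi tau0 alpha.
Hypothesis phi_increasing : forall k l : 'I_K, l = k.+1 :> nat ->
  (0 < ereal_inf [set (dphi phi l t - dphi phi k t)%:E | t in setT])%E.
Hypothesis e1_large :
  tau0 * \sum_(k < K) A k t + sigma t * Pi0 g sigma A eps1 eps3 t <= e1.

Let rad k : R := alpha k t / sigma t.

Let rad_gt0 k : 0 < rad k.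
Proof.
by rewrite divr_gt0//; have [_ _ /(_ k t)[]] := sep.
Qed.

Lemma zone_at_itv k : zone_at g sigma phi tau0 k t =
  `]dphi phi k t - rad k, dphi phi k t + rad k[%classic.
Proof.
apply/seteqP; split=> eta /=; rewrite in_itv/=.
  by move=> /(zoneE sep); rewrite ltr_distl.
by rewrite -ltr_distl => H; apply/(zoneE sep).
Qed.

Let zone_cov eta : e1 < cmod (V t eta) ->
  exists k, zone g sigma phi tau0 k (t, eta).
Proof.
exact: (zone_cover g_schwartz sigma_gt0 A_C2 phi_C3 A_lip phi_3 A_gt0 e1_large).
Qed.

(** By (a) this set is covered by the zones, finitely many bounded intervals. Finite measure makes
    constants admissible dominating functions in the mollified limit. *)
Lemma reliable_finite : (mu reliable < +oo)%E.
Proof.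
pose B := \sum_(k < K) (`|dphi phi k t| + rad k).
have sub : reliable `<=` `[- B, B].
  move=> eta [He _] /=; have [k zk] := zone_cov He.
  rewrite in_itv/= -ler_norml.
  have : `|eta| <= `|dphi phi k t| + rad k.
    have /(zoneE sep) := zk; have := ler_normD (eta - dphi phi k t) (dphi phi k t).
    rewrite subrK /rad => a b; lra.
  move=> H; apply: (le_trans H); rewrite /B (bigD1 k)//= lerDl.
  by apply: sumr_ge0 => l _; rewrite addr_ge0// ltW.
have := @le_measure _ _ _ mu reliable `[- B, B]%classic.
rewrite !inE => /(_ measurable_reliable (measurable_itv _) sub) H.
have fin : (mu `[(- B)%R, B]%classic < +oo)%E.
  by rewrite lebesgue_measure_itv/=; case: ifPn => _; rewrite ?ltry.
exact: le_lt_trans H fin.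
Qed.

Variables (k : 'I_K) (e3 : R).
Hypothesis e3_gt0 : 0 < e3.
Hypothesis Bd1_e3 : (Bd1 g sigma A phi tau0 e1 e2 t <= e3%:E)%E.
Hypothesis e3_Lk : (e3%:E <= 2^-1%:E * Lk sigma alpha k t)%E.

Let omega_near l eta : reliable eta -> zone g sigma phi tau0 l (t, eta) ->
  `|omega g sigma A phi t eta - dphi phi l t| < e3.
Proof.
move=> [HV HR] zl.
have [_ a b] := omega_error g_schwartz sigma_gt0 sigma_C1 A_C2 phi_C3 A_lip
  phi_3 A_gt0 e1_gt0 e2_gt0 HV HR zl.
(* If [Bd1] is positive the strict bound applies; otherwise the weak one suffices because e3 > 0. *)
rewrite -lte_fin; have [B0|B0] := ltP 0%E (Bd1 g sigma A phi tau0 e1 e2 t).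
  exact: lt_le_trans (b B0) Bd1_e3.
by apply: le_lt_trans a (le_lt_trans B0 _); rewrite lte_fin.
Qed.

Let far l : l != k -> 2 * e3 <= `|dphi phi k t - dphi phi l t|.
Proof.
move=> lk; have H := Lk_dist sep phi_increasing t lk.
have : (e3%:E <= 2^-1%:E * `|dphi phi k t - dphi phi l t|%:E)%E.
  by apply: (le_trans e3_Lk); rewrite lee_wpmul2l// lee_fin.
by rewrite -EFinM lee_fin; lra.
Qed.

Let omega_far l eta : l != k -> reliable eta ->
  zone g sigma phi tau0 l (t, eta) ->
  e3 < `|omega g sigma A phi t eta - dphi phi k t|.
Proof.
move=> lk He zl; have a := omega_near He zl; have b := far lk.
have := ler_normB (omega g sigma A phi t eta - dphi phi l t)
  (omega g sigma A phi t eta - dphi phi k t).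
have -> : omega g sigma A phi t eta - dphi phi l t -
  (omega g sigma A phi t eta - dphi phi k t) = dphi phi k t - dphi phi l t.
  by ring.
lra.
Qed.

(** On the zone of k the distance is below e3 and on every other zone above it; the exceptional case
    of the mollified limit therefore never occurs. *)
Let omega_neq eta : reliable eta ->
  `|omega g sigma A phi t eta - dphi phi k t| != e3.
Proof.
move=> He; have [l zl] := zone_cov He.1.
have [lk|lk] := eqVneq l k; last first.
  by apply/negbT/gt_eqF; exact: (omega_far lk He zl).
by move: zl; rewrite lk => zl; apply/negbT/lt_eqF; exact: (omega_near He zl).
Qed.

Let reliable_zone : reliable `&`
    [set eta | `|omega g sigma A phi t eta - dphi phi k t| < e3] =
  reliable `&` zone_at g sigma phi tau0 k t.
Proof.
apply/seteqP; split=> eta [He H]; last first.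
  by split; [exact: He|exact: (omega_near He H)].
split; first exact: He.
have [l zl] := zone_cov He.1.
have [lk|lk] := eqVneq l k; first by move: zl; rewrite lk.
have := lt_trans (omega_far lk He zl) H.
by rewrite ltxx; discriminate.
Qed.

(** On the reliable set the identity of (b) holds for any index, in or out of its zone, so omega is
    there phi_k' + Re Res_4, whose ingredients are explicitly measurable in eta. *)
Let m_omega : measurable_fun reliable (omega g sigma A phi t).
Proof.
have [m4 _] := m_Res4 k.
have : measurable_fun reliable
    (fun eta => dphi phi k t + complex.Re (Res4 g sigma A phi k t eta)).
  by apply: measurable_funTS; exact: measurable_funD.
apply: eq_measurable_fun => eta; rewrite inE => -[HV HR].
have R0 : deta ratio1 t eta != 0.
  by rewrite -cmod_gt0; exact: lt_trans HR.
rewrite -(omega_c_Res4 g_schwartz sigma_gt0 sigma_C1 A_C2 phi_C3 A_lip phi_3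
  A_gt0 k (V_neq0 HV) R0).
by rewrite cReD cReN /= addrC subrK.
Qed.

Lemma fsst_limit : mollifier h ->
  ((sigma t)%:C / g 0 * cint [set xi | `|xi - dphi phi k t| < e3]
     (fsst g sigma A phi h e1 e2 lam t) : R[i]^o) @[lam --> 0^'+] -->
  ((sigma t)%:C / g 0 * cint (reliable `&` zone_at g sigma phi tau0 k t) (V t)
     : R[i]^o).
Proof.
move=> [hs hc hint].
have [M hM] := compact_support_bound hc.
have ch : ccontinuous h.
  have [h1 h2] := hs; split=> x; apply/differentiable_continuous/derivable1_diffP.
    exact: (h1 0%N x).
  exact: (h2 0%N x).
have [B HB] := V_bounded.
have mV : cmeasurable reliable (V t).
  by have [a b] := m_V; split; apply: measurable_funTS.
rewrite -reliable_zone.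
have := mollified_limit measurable_reliable reliable_finite mV
  (fun eta _ => HB eta) m_omega ch hM hint e3_gt0 omega_neq.
move=> H.
exact: (@cvgZl_tmp _ _ _ _ _ ((sigma t)%:C / g 0) _ _ H).
Qed.

End Reconstruction.

Section IntegralBounds.
Context {R : realType}.
Local Notation mu := (@lebesgue_measure R).
Implicit Types (D E : set R) (f : R -> R[i]).

Lemma ler_cmod_cint_cst D f (C : R) : measurable D -> (mu D < +oo)%E ->
  cintegrable D f -> (forall x, D x -> cmod (f x) <= C) ->
  cmod (cint D f) <= C * fine (mu D).
Proof.
move=> mD Doo fi fC; rewrite -(Rintegral_cst mu mD C).
by apply: ler_cmod_cint => //; exact: integrable_cst_fin.
Qed.

Lemma ler_cmod_cint_subset D E f : measurable D -> measurable E -> D `<=` E ->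
  cintegrable E f -> cmod (cint D f) <= \int[mu]_(x in E) cmod (f x).
Proof.
move=> mD mE DE fi; have fD := cintegrableS mE mD DE fi.
apply: (le_trans (ler_cmod_cint_cmod mD fD)).
have nD := cintegrable_cmod mD fD; have nE := cintegrable_cmod mE fi.
rewrite Rintegral_mkcond [leRHS]Rintegral_mkcond; apply: le_Rintegral => //.
- by rewrite -restrict_EFin; apply/(@integrable_mkcond _ _ _ mu D).
- by rewrite -restrict_EFin; apply/(@integrable_mkcond _ _ _ mu E).
- move=> x _; rewrite !patchE; case: ifPn => [xD|_].
    by rewrite ifT//; move: xD; rewrite !inE => /DE.
  by case: ifP => // _; exact: cmod_ge0.
Qed.

Lemma ler_fine_measure D E : measurable D -> measurable E -> D `<=` E ->
  (mu E < +oo)%E -> fine (mu D) <= fine (mu E).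
Proof.
move=> mD mE DE Eoo.
have le : (mu D <= mu E)%E by apply: le_measure; rewrite ?inE.
apply: fine_le => //; rewrite ge0_fin_numE//.
exact: le_lt_trans le Eoo.
Qed.

End IntegralBounds.

(** * Error of an integral over part of a zone *)

Section ErrorBound.
Context {R : realType} {K : nat}.
Local Notation mu := (@lebesgue_measure R).
Variables (V r : R -> R[i]) (G : 'I_K -> R -> R[i]) (x : 'I_K -> R[i]).
Variables (s a e p N : R) (k : 'I_K) (O X Q : set R) (c T : R[i]).
Hypothesis s_gt0 : 0 < s.
Hypothesis c_neq0 : c != 0.
Hypothesis e_ge0 : 0 <= e.
Hypothesis p_ge0 : 0 <= p.
Hypothesis mO : measurable O.
Hypothesis mX : measurable X.
Hypothesis mQ : measurable Q.
Hypothesis QX : Q `<=` X.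
Hypothesis muO : mu O = (2 * (a / s))%:E.
Hypothesis VE : forall y, V y = \sum_(l < K) x l * G l y + r y.
Hypothesis iG : forall l, cintegrable O (G l).
Hypothesis ir : cintegrable O r.
Hypothesis r_le : forall y, cmod (r y) <= p.
Hypothesis G_le : forall y, cmod (G k y) <= N.
Hypothesis V_le : forall y, ~ X y -> cmod (V y) <= e.
Hypothesis mainE : s%:C * cint O (G k) = c - T.

Let P : set R := Q `&` O.
Let Z : set R := (O `&` X) `\` Q.
Let Y : set R := O `\` X.

Let mP : measurable P. Proof. exact: measurableI. Qed.

Let mZ : measurable Z.
Proof. by apply: measurableD => //; exact: measurableI. Qed.

Let mY : measurable Y. Proof. exact: measurableD. Qed.

Let PO : P `<=` O. Proof. by move=> y []. Qed.

Let ZO : Z `<=` O. Proof. by move=> y [[]]. Qed.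

Let YO : Y `<=` O. Proof. by move=> y []. Qed.

Let Ooo : (mu O < +oo)%E. Proof. by rewrite muO ltry. Qed.

Let iGs (D : set R) l : measurable D -> D `<=` O -> cintegrable D (G l).
Proof. by move=> mD DO; exact: cintegrableS (iG l). Qed.

Let irs (D : set R) : measurable D -> D `<=` O -> cintegrable D r.
Proof. by move=> mD DO; exact: cintegrableS ir. Qed.

Let isum (D : set R) : measurable D -> D `<=` O ->
  cintegrable D (fun y => \sum_(l < K) x l * G l y).
Proof.
move=> mD DO; apply: cintegrable_sum => // l _.
by apply: cintegrableZ => //; exact: iGs.
Qed.

Let V_fun : V = fun y => \sum_(l < K) x l * G l y + r y.
Proof. exact/funext. Qed.

Let iVs (D : set R) : measurable D -> D `<=` O -> cintegrable D V.
Proof.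
move=> mD DO; rewrite V_fun.
by apply: cintegrableD => //; [exact: isum|exact: irs].
Qed.

Let others (D : set R) : R[i] := \sum_(l < K | l != k) x l * cint D (G l).

Let cint_V (D : set R) : measurable D -> D `<=` O ->
  cint D V = x k * cint D (G k) + others D + cint D r.
Proof.
move=> mD DO; rewrite V_fun cintD//; [|exact: isum|exact: irs].
rewrite cint_sum//; last by move=> l _; apply: cintegrableZ => //; exact: iGs.
rewrite (bigD1 k)//= cintZ//; last exact: iGs.
congr (_ + _ + _); apply: eq_bigr => l _; rewrite cintZ//.
exact: iGs.
Qed.

Let O_split : O = (P `|` Z) `|` Y.
Proof.
apply/seteqP; split=> y; last by move=> [[|]|]; [exact: PO|exact: ZO|exact: YO].
move=> Oy; have [HX|HX] := pselect (X y); last by right.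
by left; have [HQ|HQ] := pselect (Q y); [left|right].
Qed.

Let cint_O : cint O V = cint P V + cint Z V + cint Y V.
Proof.
rewrite {1}O_split cint_setU//.
- rewrite cint_setU//.
  + by apply: iVs; [exact: measurableU|rewrite subUset; split].
  + by apply/disj_set2P; rewrite -subset0 => y [[Hr _]] [].
- exact: measurableU.
- by rewrite -O_split; exact: iVs.
- apply/disj_set2P; rewrite -subset0 => y [H [_ nX]]; apply: nX.
  by case: H => [[/QX]|[[]]].
Qed.

(** Since s times the measure of O is 2 a, with a = alpha_k in the application, this is the origin
    of the factors 2 alpha_k in Bd_2. *)
Let small (D : set R) f (C : R) : measurable D -> D `<=` O -> 0 <= C ->
  cintegrable D f -> (forall y, D y -> cmod (f y) <= C) ->
  cmod (s%:C * cint D f) <= 2 * a * C.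
Proof.
move=> mD DO C0 fi fC; rewrite cmodM cmod_real gtr0_norm//.
have -> : 2 * a * C = s * (C * (2 * (a / s))).
  by field; rewrite gt_eqF.
apply: ler_wpM2l; first exact: ltW.
have Doo : (mu D < +oo)%E.
  by apply: le_lt_trans Ooo; apply: le_measure; rewrite ?inE.
apply: (le_trans (ler_cmod_cint_cst mD Doo fi fC)).
apply: ler_wpM2l => //.
by apply: (le_trans (ler_fine_measure mD mO DO Ooo)); rewrite muO.
Qed.

Let M := \sum_(l < K | l != k)
  cmod (x l) * (s * \int[mu]_(y in O) cmod (G l y)).

Let others_le (D : set R) : measurable D -> D `<=` O ->
  cmod (s%:C * others D) <= M.
Proof.
move=> mD DO; rewrite mulr_sumr; apply: (le_trans (ler_cmod_sum _ _ _)).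
apply: ler_sum => l _; rewrite mulrCA cmodM.
apply: ler_wpM2l; first exact: cmod_ge0.
rewrite cmodM cmod_real gtr0_norm//; apply: ler_wpM2l; first exact: ltW.
exact: ler_cmod_cint_subset.
Qed.

(* In the application [O] is the zone, [Q] the set over which the transform is
   synthesized, and [X] the set where [V] exceeds its threshold; so [V] is small
   on [Y], while [Z] is the set called Z_t. *)
Lemma split_reconstruction_error :
  cmod (s%:C / c * cint P V - x k) <= (cmod c)^-1 *
    ((2 * a * (e + p) + cmod (x k) * cmod T + M) +
     (2 * a * p + s * cmod (x k) * N * fine (mu Z) + M)).
Proof.
(* The integral over P is the one over O minus those over Z and Y. On O and Z the transform is
   expanded into components and residual; on Y it is kept whole, being below the threshold. *)
have key : s%:C / c * cint P V - x k = c^-1 *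
    (- (x k * T) + s%:C * others O + s%:C * cint O r - s%:C * cint Y V
     - (x k * (s%:C * cint Z (G k)) + s%:C * others Z + s%:C * cint Z r)).
  have e1 : s%:C * cint P V = s%:C * cint O V - s%:C * cint Z V - s%:C * cint Y V.
    by rewrite cint_O; ring.
  have e2 : s%:C * cint O V = x k * (c - T) + s%:C * others O + s%:C * cint O r.
    by rewrite (cint_V mO (@subset_refl _ O)) -mainE; ring.
  have e3 : s%:C * cint Z V =
      x k * (s%:C * cint Z (G k)) + s%:C * others Z + s%:C * cint Z r.
    by rewrite (cint_V mZ ZO); ring.
  by rewrite mulrAC e1 e2 e3; field.
have bO := others_le mO (@subset_refl _ O).
have bZ := others_le mZ ZO.
have bOr : cmod (s%:C * cint O r) <= 2 * a * p by apply: small.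
have bZr : cmod (s%:C * cint Z r) <= 2 * a * p.
  by apply: small => //; exact: irs.
have bY : cmod (s%:C * cint Y V) <= 2 * a * e.
  by apply: small => //; [exact: iVs|move=> y [_]; exact: V_le].
have bZk : cmod (x k * (s%:C * cint Z (G k))) <=
    s * cmod (x k) * N * fine (mu Z).
  rewrite !cmodM cmod_real gtr0_norm//.
  rewrite -2!mulrA mulrCA; apply: ler_wpM2l; first exact: ltW.
  apply: ler_wpM2l; first exact: cmod_ge0.
  apply: ler_cmod_cint_cst => //; last exact: iGs.
  by apply: le_lt_trans Ooo; apply: le_measure; rewrite ?inE.
rewrite key cmodM cmodV.
apply: ler_wpM2l; first by rewrite invr_ge0 cmod_ge0.
apply: (le_trans (ler_cmodB _ _)); apply: lerD.
  apply: (@le_trans _ _ (cmod (x k) * cmod T + M + 2 * a * p + 2 * a * e)).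
    apply: (le_trans (ler_cmodB _ _)); apply: lerD => //.
    apply: (le_trans (ler_cmodD _ _)); apply: lerD => //.
    apply: (le_trans (ler_cmodD _ _)); apply: lerD => //.
    by rewrite cmodN cmodM.
  by rewrite le_eqVlt; apply/orP; left; apply/eqP; ring.
apply: (@le_trans _ _ (s * cmod (x k) * N * fine (mu Z) + M + 2 * a * p)).
  apply: (le_trans (ler_cmodD _ _)); apply: lerD => //.
  by apply: (le_trans (ler_cmodD _ _)); exact: lerD.
by rewrite le_eqVlt; apply/orP; left; apply/eqP; ring.
Qed.

End ErrorBound.

(** * Reconstruction error of a component *)

Section ReconstructionError.
Context {R : realType} {K : nat}.
Local Notation mu := (@lebesgue_measure R).
Variables (g : R -> R[i]) (sigma : R -> R) (A phi : 'I_K -> R -> R).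
Variables (eps1 eps3 : R).
Hypothesis g_schwartz : schwartz g.
Hypothesis g0 : g 0 != 0.
Hypothesis sigma_gt0 : forall t, 0 < sigma t.
Hypothesis A_C2 : forall k, class_Cn 2 (A k).
Hypothesis phi_C3 : forall k, class_Cn 3 (phi k).
Hypothesis A_lip : forall k t, `|derive1 (A k) t| <= eps1.
Hypothesis phi_3 : forall k t, `|derive1n 3 (phi k) t| <= eps3.
Hypothesis A_gt0 : forall k t, 0 < A k t.
Variables (t e1 e2 : R).
Hypothesis e1_gt0 : 0 < e1.
Variables (tau0 : R) (alpha : 'I_K -> R -> R).
Hypothesis sep : well_separating g sigma phi tau0 alpha.
Variable (k : 'I_K).

Local Notation V := (V g sigma A phi t).
Local Notation r0 := (res sigma A phi g t).
Local Notation G0 l := (Gj g sigma phi 0 l t).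
Local Notation x_ := (component A phi).
Local Notation s := (sigma t).
Local Notation P0 := (Pi0 g sigma A eps1 eps3 t).
Local Notation rel := (reliable g sigma A phi t e1 e2).

Let rad : R := alpha k t / s.

Let alpha_gt0 : 0 < alpha k t.
Proof. by have [_ _ /(_ k t)[]] := sep. Qed.

Let srad : s * rad = alpha k t.
Proof. by rewrite /rad mulrC divfK// gt_eqF. Qed.

Let rad_gt0 : 0 < rad. Proof. by rewrite divr_gt0. Qed.

Let O : set R := zone_at g sigma phi tau0 k t.

Let OE : O = `](dphi phi k t - rad), (dphi phi k t + rad)[%classic.
Proof. exact: zone_at_itv. Qed.

Let mO : measurable O. Proof. by rewrite OE; exact: measurable_itv. Qed.

Let muO : mu O = (2 * rad)%:E.
Proof.
rewrite OE; move: (dphi phi k t) => y.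
rewrite lebesgue_measure_itv/= lte_fin ltrBlDr -addrA ltrDl addr_gt0//.
by rewrite -EFinB; congr EFin; ring.
Qed.

Let Ooo : (mu O < +oo)%E. Proof. by rewrite muO ltry. Qed.

Let mV : cmeasurable setT V.
Proof.
apply: ccontinuous_measurable => //; apply: wft_ccontinuous => //.
  exact: (polybounded_signal A_C2 phi_C3 A_lip A_gt0 t).
exact: decays_g.
Qed.

Let G0_bound l eta : cmod (G0 l eta) <= L1norm g.
Proof. by rewrite Gj0_Gk//; exact: ler_cmod_Gk. Qed.

Let r0_bound eta : cmod (r0 eta) <= s * P0.
Proof. exact: (ler_cmod_res g_schwartz sigma_gt0 A_C2 phi_C3 A_lip phi_3 A_gt0). Qed.

Let cmeasurableO f : cmeasurable setT f -> cmeasurable O f.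
Proof.
by move=> [f1 f2]; split; apply: (measurable_funS measurableT (@subsetT _ O)).
Qed.

Let mG0 l : cmeasurable setT (G0 l).
Proof.
rewrite (_ : G0 l = chirp_part sigma phi g l t).
  apply: ccontinuous_measurable => //; apply: wft_ccontinuous => //.
    exact: polybounded_chirp.
  exact: decays_g.
by apply/funext => eta; rewrite Gj0E.
Qed.

Let iG0 l : cintegrable O (G0 l).
Proof.
apply: (cintegrable_bounded mO Ooo (cmeasurableO (mG0 l))) => eta _.
exact: G0_bound.
Qed.

Let mr0 : cmeasurable setT r0.
Proof.
apply: ccontinuous_measurable => //.
apply: is_cderive_ccontinuous => eta.
exact: (is_cderive_res sigma_gt0 A_C2 phi_C3 A_lip phi_3 A_gt0 t eta
  (decays_g g_schwartz)).
Qed.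

Let ir0 : cintegrable O r0.
Proof.
apply: (cintegrable_bounded mO Ooo (cmeasurableO mr0)) => eta _.
exact: r0_bound.
Qed.

Let VE eta : V eta = \sum_(l < K) x_ l t * G0 l eta + r0 eta.
Proof. exact: (V_split g_schwartz sigma_gt0 A_C2 phi_C3 A_lip phi_3 A_gt0). Qed.

Let tail : R[i] := cint [set u | alpha k t <= `|u|] (Gk g sigma phi k t).

(** The substitution u = sigma (eta - phi_k') maps O onto |u| < alpha_k, and the integral of G_k
    over the whole line is split at |u| = alpha_k. *)
Let cint_main : s%:C * cint O (G0 k) = g 0 - tail.
Proof.
have Gi := Gk_integrable sigma phi g_schwartz k t.
pose I : set R := `]- alpha k t, alpha k t[%classic.
have mI : measurable I by exact: measurable_itv.
have Ic : [set u | alpha k t <= `|u|] = ~` I.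
  apply/seteqP; split=> u; rewrite /I /= in_itv/= -ltr_norml leNgt => /negP//.
have gE : g 0 = cint I (Gk g sigma phi k t) + tail.
  rewrite -(cint_Gk sigma phi g_schwartz k t) -(setUv I) cint_setU.
  - by rewrite /tail Ic.
  - exact: mI.
  - exact: measurableC.
  - by rewrite setUv.
  - by apply/disj_setPCl.
rewrite gE addrK.
have [i1 i2] : cintegrable I (Gk g sigma phi k t).
  exact: cintegrableS Gi.
pose b := - (s * dphi phi k t).
have OI : O = (fun x => s * x + b) @^-1` I.
  rewrite OE /I /b -srad; move: (dphi phi k t) => y.
  apply/seteqP; split=> x; rewrite /= !in_itv/= -mulrBr -[- (s * rad)]mulrN !ltr_pM2l//;
  by move=> /andP[? ?]; apply/andP; split; lra.
have cE : cint O (G0 k) = (s^-1)%:C * cint I (Gk g sigma phi k t).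
  transitivity (cint O (fun x => Gk g sigma phi k t (s * x + b))).
    by apply: eq_cint => x _; rewrite Gj0_Gk// mulrBr.
  rewrite OI; apply: eq_ReIm; rewrite ?cReM ?cImM.
    by rewrite [LHS](Rintegral_affine_set b (sigma_gt0 t) mI i1) /= mul0r subr0.
  by rewrite [LHS](Rintegral_affine_set b (sigma_gt0 t) mI i2) /= mul0r addr0.
by rewrite cE mulrA -real_complexM divff ?mul1r// gt_eqF.
Qed.

Let X : set R := [set eta | e1 < cmod (V eta)].

Let mX : measurable X.
Proof. by apply: measurable_superlevel; exact: measurable_cmod. Qed.

Let mrel : measurable rel.
Proof. exact: (measurable_reliable g_schwartz sigma_gt0 A_C2 phi_C3). Qed.

Let ZE : Zt g sigma A phi tau0 e1 e2 k t = (O `&` X) `\` rel.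
Proof.
apply/seteqP; split=> eta.
  by move=> [zk HV HR]; split=> // -[_]; rewrite ltNge HR.
move=> [[zk HV] nr]; split=> //; rewrite leNgt; apply/negP => HR.
by apply: nr; split.
Qed.

Lemma reconstruction_error :
  cmod (s%:C / g 0 * cint (rel `&` zone_at g sigma phi tau0 k t) V - x_ k t) <=
  Bd2 g sigma A phi eps1 eps3 tau0 e1 e2 alpha k t.
Proof.
have sP0 : 0 <= s * P0 by apply: le_trans (cmod_ge0 _) (r0_bound 0).
have relX : rel `<=` X by move=> eta [].
have VX eta : ~ X eta -> cmod (V eta) <= e1 by move=> nX; rewrite leNgt; apply/negP.
have := split_reconstruction_error (x := fun l => x_ l t) (sigma_gt0 t) g0
  (ltW e1_gt0) sP0 mO mX mrel relX muO VE iG0 ir0 r0_bound (G0_bound k) VX cint_main.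
move=> /le_trans; apply.
rewrite -ZE /Bd2 /Bd2' /Bd2'' -mulrDr cmod_component//.
have -> : \sum_(l < K | l != k) cmod (x_ l t) *
    (s * \int[mu]_(y in O) cmod (G0 l y)) =
    \sum_(l < K | l != k) A l t * Mlk g sigma phi tau0 l k t.
  by apply: eq_bigr => l _; rewrite cmod_component.
by rewrite mulrA.
Qed.

End ReconstructionError.

Theorem theorem2 (R : realType) (K : nat) (g h : R -> R[i])
    (A phi : 'I_K -> R -> R) (sigma : R -> R) (alpha : 'I_K -> R -> R)
    (tau0 eps1 eps3 t e1 e2 : R)
    (K_gt0 : (0 < K)%N)
    (g_window : window g)
    (h_mollifier : mollifier h)
    (tau0_gt0 : 0 < tau0) (tau0_lt1 : tau0 < 1)
    (eps1_gt0 : 0 < eps1) (eps3_gt0 : 0 < eps3)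
    (x_class : signal_class g tau0 eps1 eps3 A phi)
    (sigma_sep : well_separating g sigma phi tau0 alpha)
    (e1_gt0 : 0 < e1) (e2_gt0 : 0 < e2) :
  [/\ (* (a) *)
      tau0 * \sum_(k < K) A k t + sigma t * Pi0 g sigma A eps1 eps3 t <= e1 ->
      forall eta : R, e1 < cmod (V g sigma A phi t eta) ->
        exists k : 'I_K, zone g sigma phi tau0 k (t, eta),
      (* (b) *)
      forall (k : 'I_K) (eta : R),
        e1 < cmod (V g sigma A phi t eta) ->
        e2 < cmod (deta (ratio1 g sigma A phi) t eta) ->
        zone g sigma phi tau0 k (t, eta) ->
        [/\ omega_c g sigma A phi t eta - (dphi phi k t)%:C =
              Res4 g sigma A phi k t eta,
            (`|omega g sigma A phi t eta - dphi phi k t|%:E <=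
               Bd1 g sigma A phi tau0 e1 e2 t)%E &
            (0 < Bd1 g sigma A phi tau0 e1 e2 t)%E ->
            (`|omega g sigma A phi t eta - dphi phi k t|%:E <
               Bd1 g sigma A phi tau0 e1 e2 t)%E] &
      (* (c) *)
      forall k : 'I_K,
        tau0 * \sum_(l < K) A l t + sigma t * Pi0 g sigma A eps1 eps3 t <= e1 ->
        (Bd1 g sigma A phi tau0 e1 e2 t <= 2^-1%:E * Lk sigma alpha k t)%E ->
        forall e3 : R, 0 < e3 ->
        (Bd1 g sigma A phi tau0 e1 e2 t <= e3%:E)%E ->
        (e3%:E <= 2^-1%:E * Lk sigma alpha k t)%E ->
        exists2 l : R[i]^o,
          ((sigma t)%:C / g 0 *
             cint [set xi | `|xi - dphi phi k t| < e3]
               (fsst g sigma A phi h e1 e2 lam t)) @[lam --> 0^'+] --> l &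
          cmod (l - component A phi k t) <=
            Bd2 g sigma A phi eps1 eps3 tau0 e1 e2 alpha k t].
Proof.
have [gS g0 _] := g_window.
have [H1 H2 H3 H4 _] := x_class.
have A_gt0 k s : 0 < A k s by have [] := H1 k s.
have A_C2 k : class_Cn 2 (A k) by have [] := H2 k.
have phi_C3 k : class_Cn 3 (phi k) by have [] := H2 k.
have A_lip k s : `|derive1 (A k) s| <= eps1 by have [] := H3 k s.
have phi_3 k s : `|derive1n 3 (phi k) s| <= eps3 by have [] := H3 k s.
have [[sigma_gt0 sigma_C1] _ _ _] := sigma_sep.
split.
- move=> He1 eta HV.
  exact: (zone_cover gS sigma_gt0 A_C2 phi_C3 A_lip phi_3 A_gt0 He1 HV).
- move=> k eta HV HR zk.
  exact: (omega_error gS sigma_gt0 sigma_C1 A_C2 phi_C3 A_lip phi_3 A_gt0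
    e1_gt0 e2_gt0 HV HR zk).
- move=> k He1 _ e3 e3_gt0 HB HL.
  exists ((sigma t)%:C / g 0 *
    cint (reliable g sigma A phi t e1 e2 `&` zone_at g sigma phi tau0 k t)
      (V g sigma A phi t)).
    exact: (fsst_limit gS sigma_gt0 sigma_C1 A_C2 phi_C3 A_lip phi_3 A_gt0
      e1_gt0 e2_gt0 sigma_sep H4 He1 e3_gt0 HB HL h_mollifier).
  exact: (reconstruction_error gS g0 sigma_gt0 A_C2 phi_C3 A_lip phi_3 A_gt0
    t e2 e1_gt0 sigma_sep k).
Qed.
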